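(* Let $\mathcal A$ be an arrangement of lines in $\mathbb{CP}^2$ satisfying at least one of the following conditions. (1) There exists a line $\ell\in\mathcal A$ whose intersections with the other lines of $\mathcal A$ are concentrated at no more than 3 points. (2) There exists a line $\ell\in\mathcal A$ such that every intersection point $p$ of $\mathcal A$ on $\ell$ has multiplicity $\bar m(p)\le 3$. (3) There exists a line $\ell\in\mathcal A$ such that the multiplicities $m_1\ge m_2\ge\cdots\ge m_n$ of the multi-arrangement obtained by restricting $\mathcal A$ to $\ell$ satisfy $m_1\ge\sum_{i=2}^n m_i$. (4) There exists a line $\ell\in\mathcal A$ such that the average $\frac1n\sum_{i=1}^n m_i$ of the multiplicities of the multi-arrangement obtained by restricting $\mathcal A$ to $\ell$ is less than $2$. Then Terao's conjecture holds for $\mathcal A$: if $\mathcal B$ and $\mathcal B'$ are line arrangements in $\mathbb{CP}^2$ whose intersection lattices are both isomorphic to that of $\mathcal A$, and $\mathcal B$ is free, then $\mathcal B'$ is free.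
   Context: A line arrangement $\mathcal A$ in $\mathbb{CP}^2$ is a finite set of distinct projective lines, equivalently a finite set of 2-dimensional linear subspaces $\ker\alpha_H$ ($H\in\mathcal A$) of $\mathbb C^3$. With $S=\mathbb C[x,y,z]$, $\mathcal A$ is called free if the $S$-module $D(\mathcal A)=\{\theta\in\mathrm{Der}_{\mathbb C}(S)\mid\theta(\alpha_H)\in\alpha_HS\ \text{for all }H\in\mathcal A\}$ is free. The intersection lattice of $\mathcal A$ is the set of all intersections of subfamilies of these subspaces of $\mathbb C^3$, ordered by reverse inclusion. An intersection point of $\mathcal A$ is a point of $\mathbb{CP}^2$ lying on at least two lines of $\mathcal A$. The multiplicity $\bar m(p)$ of a point $p$ is the number of lines of $\mathcal A$ passing through $p$. The restriction of $\mathcal A$ to a line $\ell\in\mathcal A$ is the multi-arrangement on $\ell\cong\mathbb{CP}^1$ consisting of the intersection points $p$ of $\mathcal A$ lying on $\ell$, each with multiplicity $m(p)=\bar m(p)-1$; $n$ denotes the number of these points. *)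

(* Defs.v *)
From HB Require Import structures.
From mathcomp Require Import all_boot all_order all_algebra.
From mathcomp Require Import finmap mpoly complex reals.

Set Implicit Arguments.
Unset Strict Implicit.
Unset Printing Implicit Defensive.

Import Order.TTheory GRing.Theory Num.Theory.

Local Open Scope fset_scope.
Local Open Scope ring_scope.

(* A projective line (resp. point) of P^2 is a 2-dimensional (resp.
   1-dimensional) subspace of F^3, so incidence is inclusion of subspaces. *)
Record line_arrangement (F : fieldType) := LineArrangement {
  lines : {fset {vspace 'rV[F]_3}};
  lines_dim : forall H, H \in lines -> \dim H = 2%N
}.

Section Arrangements.

Variable F : fieldType.

Local Notation V := 'rV[F]_3.
Local Notation S := {mpoly F[3]}.
Implicit Types (A B : line_arrangement F) (H l p : {vspace V}).

Definition is_derivation (theta : S -> S) : Prop :=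
  linear theta /\
  forall f g, theta (f * g) = theta f * g + f * theta g.

(* alpha is a linear form with kernel H; it is unique up to a nonzero scalar
   when H is a plane. *)
Definition defining_form H (alpha : S) : Prop :=
  alpha \is 1.-homog /\ forall v : V, (v \in H) = (alpha.@[v 0] == 0).

Definition in_D A (theta : S -> S) : Prop :=
  is_derivation theta /\
  forall H alpha, H \in lines A -> defining_form H alpha ->
    exists q : S, theta alpha = alpha * q.

(* D(A) has a basis as an S-module, the S-action on derivations being
   pointwise; the basis may a priori be infinite, linear combinations being
   finite. *)
Definition free_arrangement A : Prop :=
  exists (I : Type) (b : I -> S -> S),
    [/\ forall i, in_D A (b i),
        forall theta, in_D A theta ->
          exists (n : nat) (s : 'I_n -> I) (c : 'I_n -> S),
            forall f, theta f = \sum_(j < n) c j * b (s j) f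
      & forall (n : nat) (s : 'I_n -> I) (c : 'I_n -> S), injective s ->
          (forall f, \sum_(j < n) c j * b (s j) f = 0) ->
          forall j, c j = 0].

(* The empty subfamily contributes the whole space. *)
Definition intersection_lattice A : {fset {vspace V}} :=
  [fset (\bigcap_(H <- enum_fset B) H)%VS
    | B : {fset {vspace V}} in fpowerset (lines A)].

Definition lattice_isomorphic A B : Prop :=
  exists2 f : intersection_lattice A -> intersection_lattice B,
    bijective f &
    (* X <= Y in the lattice means that Y is contained in X *)
    forall X Y, (val (f Y) <= val (f X))%VS = (val Y <= val X)%VS.

Definition terao_conjecture_for A : Prop :=
  forall B B' : line_arrangement F,
    lattice_isomorphic B A -> lattice_isomorphic B' A ->
    free_arrangement B -> free_arrangement B'.

Definition point_mult A p : nat := #|` [fset H in lines A | (p <= H)%VS] |.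

(* The points of P^2 lying on at least two lines of A, see
   mem_intersection_points; taking them in the lattice makes them a finite
   set. *)
Definition intersection_points A : {fset {vspace V}} :=
  [fset p in intersection_lattice A | (\dim p == 1) && (1 < point_mult A p)]%N.

Definition points_on A l : {fset {vspace V}} :=
  [fset p in intersection_points A | (p <= l)%VS].

Definition restriction_mults A l : seq nat :=
  sort geq [seq (point_mult A p - 1)%N | p <- enum_fset (points_on A l)].

Lemma mem_intersection_points A p :
  (p \in intersection_points A) = (\dim p == 1) && (1 < point_mult A p)%N.
Proof.
rewrite !inE /= andb_idl // => /andP[/eqP dp1].
rewrite /point_mult; set C := [fset _ in _ | _] => C2.
have /fset0Pn[H1 H1C] : C != fset0 by rewrite -cardfs_gt0 ltnW.
have /fset0Pn[H2] : C `\ H1 != fset0.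
  by rewrite -cardfs_gt0 -(ltn_add2l (H1 \in C)) -cardfsD1 H1C.
rewrite !inE /= => /and3P[nH H2A pH2].
have := H1C; rewrite !inE /= => /andP[H1A pH1].
apply/imfsetP; exists [fset H1; H2] => /=.
  by rewrite fpowersetE; apply/fsubsetP => H; rewrite !inE => /orP[]/eqP->.
rewrite big_fsetU1 /= ?big_seq_fset1; last by rewrite inE eq_sym.
apply/eqP; rewrite eqEdim subv_cap pH1 pH2 dp1 /= leqNgt; apply/negP => d2.
have E1 : (H1 :&: H2)%VS = H1.
  by apply/eqP; rewrite eqEdim capvSl (lines_dim H1A).
have E2 : (H1 :&: H2)%VS = H2.
  by apply/eqP; rewrite eqEdim capvSr (lines_dim H2A).
by move: nH; rewrite -{1}E2 E1 eqxx.
Qed.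

End Arrangements.

(* Main.v *)
Require Import Defs.
From HB Require Import structures.
From mathcomp Require Import all_boot all_order all_algebra.
From mathcomp Require Import finmap mpoly complex reals boolp.
From mathcomp Require Import zify ring.

Set Implicit Arguments.
Unset Strict Implicit.
Unset Printing Implicit Defensive.

Import Order.TTheory GRing.Theory Num.Theory.
Local Open Scope ring_scope.

(** Fix a line l of the arrangement. Choose coordinates in which l is z = 0 and
    no other line contains the point (1 : 0 : 0) of l; the other lines are then
    x = t y + c z, and L is the list of the pairs (t, c). Subtracting a multiple
    of the Euler field from a derivation tangent to all lines leaves a field
    killing z, and setting z = 1 turns the homogeneous ones of degree k into
    polynomial fields on the plane, of degree at most k and tangent to the
    lines of L: this is [in_aff L k.+1]. The leading form of such a field
    belongs to the multiarrangement at infinity, which counts each slope t as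
    often as it occurs in L ([top_in_multi], Ziegler's restriction), and the
    leading form vanishes exactly when the degree drops. Three facts prove the
    theorem.

    Freeness is equivalent to surjectivity, in every degree, of the leading
    form map [top]. If the arrangement is free and u is in the target, then
    x^N u and y^N u lift for N large, and depth of a free module with respect to
    z and y produces a lift of u ([free_top_surjective]). Conversely lifts of
    a basis of the multiarrangement satisfy Saito's criterion
    ([saito_pair_exists], [surjective_free]).

    The dimension of the space of tangent fields of degree less than k, for
    k >= |L|, depends only on the incidence of the lines: add the lines one at
    a time; the new condition is the vanishing of the normal component along
    the new line, and the possible normal components form a space whose
    dimension involves only k, the number of previous lines and the number of
    points where these meet the new one ([restrict_image],
    [dim_aff_pattern]). The same count shows that [top] is surjective in
    degrees k >= |L| ([top_surjective_large]).

    The multiarrangement is free with exponents d1 <= d2 whose sum is the total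
    multiplicity |m| ([exponents_exist]), so its dimensions are known once d1
    is ([exponents_dim]), and under the four conditions d1 is a function of the
    multiplicities. Let n be the number of points and m1 the largest
    multiplicity. Then d1 = |m| - m1 if m1 >= |m| / 2 ([exponents_heavy]),
    d1 = min (|m| - n + 1, n - 1) if |m| < 2 n ([exponents_many]), d1 = n if
    all multiplicities are 2 and n > 1 ([exponents_double]), and d1 is |m| / 2
    rounded down if n = 3 and no multiplicity exceeds |m| / 2
    ([exponents_three]). Together with the trivial case of at most two points,
    these cover the four conditions.

    Let now two arrangements have the same lattice, the first one being free.
    Lines, concurrency and multiplicities correspond
    ([lattice_isomorphic_lines]), so the spaces of tangent fields have the same
    dimension in high degree and the targets of [top] have the same dimension
    in all degrees. The dimension of the space of tangent fields is at most the
    sum of the dimensions of the targets, with equality exactly when all maps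
    involved are surjective ([dim_aff_sum]). Hence surjectivity passes from the
    first arrangement to the second ([top_surjective_pattern]). *)

(** * Dimensions of subspaces *)

Section Dimension.
Variable F : fieldType.

Definition subspace (V : lmodType F) (P : V -> Prop) : Prop :=
  P 0 /\ forall (a : F) u v, P u -> P v -> P (a *: u + v).

Definition has_dim (V : lmodType F) (P : V -> Prop) (n : nat) : Prop :=
  exists b : 'I_n -> V,
    (forall v, P v <-> exists c : 'rV[F]_n, v = \sum_i c 0 i *: b i) /\
    (forall c : 'rV[F]_n, \sum_i c 0 i *: b i = 0 -> c = 0).

Lemma subspace_lin (V : lmodType F) (P : V -> Prop) a u v :
  subspace P -> P u -> P v -> P (a *: u + v).
Proof. by move=> [_]; apply. Qed.

Lemma subspace_scale (V : lmodType F) (P : V -> Prop) a u :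
  subspace P -> P u -> P (a *: u).
Proof. by move=> sP Pu; rewrite -[_ *: _]addr0; apply: subspace_lin => //; case: sP. Qed.

Lemma subspace_add (V : lmodType F) (P : V -> Prop) u v :
  subspace P -> P u -> P v -> P (u + v).
Proof. by move=> sP Pu Pv; rewrite -[u]scale1r; apply: subspace_lin. Qed.

Lemma subspace_sum (V : lmodType F) (P : V -> Prop) (I : Type) (r : seq I) (p : pred I) (f : I -> V) :
  subspace P -> (forall i, p i -> P (f i)) -> P (\sum_(i <- r | p i) f i).
Proof.
move=> sP Pf; apply: (big_ind P) => //; first by case: sP.
by move=> u v; apply: subspace_add.
Qed.

Lemma has_dim_subspace (V : lmodType F) (P : V -> Prop) n : has_dim P n -> subspace P.
Proof.
move=> [b [bP _]]; split.
  by apply/bP; exists 0; rewrite big1 // => i _; rewrite mxE scale0r.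
move=> a u v /bP[c ->] /bP[d ->]; apply/bP; exists (a *: c + d).
rewrite scaler_sumr -big_split /=; apply: eq_bigr => i _.
by rewrite !mxE scalerDl scalerA.
Qed.

Lemma has_dim_ext (V : lmodType F) (P Q : V -> Prop) n :
  (forall v, P v <-> Q v) -> has_dim P n -> has_dim Q n.
Proof.
move=> PQ [b [bP bI]]; exists b; split=> // v; split.
  by move=> /PQ /bP.
by move=> /bP /PQ.
Qed.

Lemma lincomb_mul (V : lmodType F) m n (A : 'M[F]_(m, n)) (b : 'I_n -> V) (c : 'rV[F]_m) :
  \sum_i c 0 i *: (\sum_j A i j *: b j) = \sum_j (c *m A) 0 j *: b j.
Proof.
under eq_bigr do rewrite scaler_sumr.
rewrite exchange_big /=; apply: eq_bigr => j _.
by rewrite mxE scaler_suml; apply: eq_bigr => i _; rewrite scalerA.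
Qed.

(** Writing a basis of the smaller space in a basis of the larger one gives a
    matrix with free rows. *)
Lemma has_dim_incl (V : lmodType F) (P Q : V -> Prop) m n :
    (forall v, P v -> Q v) -> has_dim P m -> has_dim Q n ->
  (m <= n)%N /\ (m = n -> forall v, Q v -> P v).
Proof.
move=> PQ [b [bP bI]] [d [dQ dI]].
have /fin_all_exists[A AE] (i : 'I_m) : exists a : 'rV[F]_n, b i = \sum_j a 0 j *: d j.
  apply/dQ; apply: PQ; apply/bP; exists (delta_mx 0 i).
  rewrite (bigD1 i) //= big1 ?addr0; first by rewrite mxE !eqxx scale1r.
  by move=> j ji; rewrite mxE (negPf ji) andbF scale0r.
pose B := \matrix_(i, j) A i 0 j.
have bE i : b i = \sum_j B i j *: d j.
  by rewrite AE; apply: eq_bigr => j _; rewrite mxE.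
have Bfree : row_free B.
  apply: inj_row_free => c cB; apply: bI.
  under eq_bigr do rewrite bE.
  by rewrite lincomb_mul cB big1 // => j _; rewrite mxE scale0r.
split; first by rewrite -(eqP Bfree) rank_leq_col.
move=> mn; case: n / mn d dQ dI A AE B bE Bfree => d dQ dI A AE B bE Bfree v /dQ[c ->].
have Bu : B \in unitmx by rewrite -row_free_unit.
apply/bP; exists (c *m invmx B).
under [RHS]eq_bigr do rewrite bE.
by rewrite lincomb_mul mulmxKV.
Qed.

Lemma has_dim_uniq (V : lmodType F) (P : V -> Prop) m n :
  has_dim P m -> has_dim P n -> m = n.
Proof.
move=> Pm Pn; apply/eqP; rewrite eqn_leq.
have id v : P v -> P v by [].
by rewrite (has_dim_incl id Pm Pn).1 (has_dim_incl id Pn Pm).1.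
Qed.

(** A subspace of row vectors is the row space of a matrix of maximal rank among
    those with rows in the subspace. *)
Lemma subspace_row n (P : 'rV[F]_n -> Prop) :
  subspace P -> exists A : 'M[F]_n, forall v, P v <-> (v <= A)%MS.
Proof.
move=> sP; pose ok r := `[< exists A : 'M[F]_n, (forall i, P (row i A)) /\ \rank A = r >].
have ok0 : exists r, ok r.
  exists 0%N; apply/asboolP; exists 0; rewrite mxrank0; split=> // i.
  by rewrite row0; case: sP.
have okn r : ok r -> (r <= n)%N by move=> /asboolP[A [_ <-]]; apply: rank_leq_row.
have [r /asboolP[A [AP Ar]] rmax] := ex_maxnP ok0 okn.
have spanP m (B : 'M_(m, n)) : (forall i, P (row i B)) -> forall v, (v <= B)%MS -> P v.
  move=> BP v /submxP[c ->]; rewrite mulmx_sum_row.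
  by apply: subspace_sum => // i _; apply: subspace_scale.
exists A => v; split; last exact: spanP.
move=> Pv; apply/negPn/negP => nvA.
have : ok (\rank (A + v)%MS).
  apply/asboolP; exists (A + v)%MS; split=> // i.
  apply: (spanP _ (col_mx A v)); last first.
    by apply: submx_trans (row_sub i _) _; rewrite addsmxE.
  move=> j; rewrite -[j]splitK; case: (split j) => k /=.
    by rewrite rowKu.
  by rewrite rowKd (_ : row k v = v) //; apply/rowP=> l; rewrite mxE (ord1 k).
move/rmax; rewrite -Ar leqNgt => /negP; apply.
by rewrite (ltn_leqif (mxrank_leqif_sup (addsmxSl A v))) addsmx_sub submx_refl.
Qed.

(** In coordinates with respect to a basis of the larger space this is
    [subspace_row]. *)
Lemma has_dim_sub (V : lmodType F) (P Q : V -> Prop) n :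
  subspace P -> (forall v, P v -> Q v) -> has_dim Q n -> exists m, has_dim P m.
Proof.
move=> sP PQ [d [dQ dI]].
pose U (c : 'rV[F]_n) := P (\sum_i c 0 i *: d i).
have sU : subspace U.
  split; first by rewrite /U big1 => [|i _]; [case: sP | rewrite mxE scale0r].
  move=> a u v Uu Uv; rewrite /U.
  under eq_bigr do rewrite !mxE scalerDl -scalerA.
  by rewrite big_split -scaler_sumr; apply: subspace_lin.
have [A AU] := subspace_row sU.
exists (\rank A), (fun i => \sum_j row_base A i j *: d j); split.
  move=> v; split.
    move=> Pv; have /dQ[c vE] := PQ v Pv.
    have /submxP[e cE] : (c <= row_base A)%MS.
      by rewrite eq_row_base; apply/AU; rewrite /U -vE.
    by exists e; rewrite lincomb_mul -cE.
  move=> [e ->]; rewrite lincomb_mul; apply/AU.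
  by rewrite -(eq_row_base A) submxMl.
move=> c; rewrite lincomb_mul => /dI /eqP.
by rewrite mulmx_free_eq0 ?row_base_free // => /eqP.
Qed.

Lemma lincomb_split (V : lmodType F) m n (b : 'I_m -> V) (d : 'I_n -> V) (c : 'rV[F]_(m + n)) :
  \sum_i c 0 i *: (match split i with inl j => b j | inr j => d j end) =
  \sum_i lsubmx c 0 i *: b i + \sum_i rsubmx c 0 i *: d i.
Proof.
rewrite big_split_ord /=; congr (_ + _); apply: eq_bigr => i _.
  by rewrite (unsplitK (inl i)) mxE.
by rewrite (unsplitK (inr i)) mxE.
Qed.

Lemma rank_nullity (V W : lmodType F) (f : V -> W) (P : V -> Prop) m n :
    linear f -> subspace P ->
    has_dim (fun v => P v /\ f v = 0) m ->
    has_dim (fun w => exists2 v, P v & f v = w) n ->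
  has_dim P (m + n).
Proof.
move=> lf sP [b [bP bI]] [d [dP dI]].
pose g : {linear V -> W} := HB.pack f (GRing.isLinear.Build F V W *:%R f lf).
have fB u w : f (u - w) = f u - f w := linearB g u w.
have fD u w : f (u + w) = f u + f w := linearD g u w.
have f0 : f 0 = 0 := linear0 g.
have /fin_all_exists[e eE] (i : 'I_n) : exists v, P v /\ f v = d i.
  have /dP[v Pv vE] : exists c : 'rV_n, d i = \sum_j c 0 j *: d j.
    exists (delta_mx 0 i); rewrite (bigD1 i) //= big1 ?addr0; first by rewrite mxE !eqxx scale1r.
    by move=> j ji; rewrite mxE (negPf ji) andbF scale0r.
  by exists v.
have fe (c : 'rV_n) : f (\sum_i c 0 i *: e i) = \sum_i c 0 i *: d i.
  by rewrite -[f]/(g : V -> W) linear_sum; apply: eq_bigr => i _; rewrite linearZ /= -(eE i).2.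
have Pe (c : 'rV_n) : P (\sum_i c 0 i *: e i).
  by apply: subspace_sum => // i _; apply: subspace_scale => //; case: (eE i).
exists (fun i => match split i with inl j => b j | inr j => e j end); split.
  move=> v; split.
    move=> Pv; have /dP[c cE] : exists2 v', P v' & f v' = f v by exists v.
    have /bP[a aE] : P (v - \sum_i c 0 i *: e i) /\ f (v - \sum_i c 0 i *: e i) = 0.
      split; last by rewrite fB fe cE subrr.
      by rewrite addrC -scaleN1r; apply: subspace_lin.
    exists (row_mx a c); rewrite lincomb_split row_mxKl row_mxKr -aE.
    by rewrite subrK.
  move=> [c ->]; rewrite lincomb_split; apply: subspace_add => //.
  by have [] := (bP _).2 (ex_intro _ (lsubmx c) erefl).
move=> c; rewrite lincomb_split => c0.
have [_ fb] : P (\sum_i lsubmx c 0 i *: b i) /\ f (\sum_i lsubmx c 0 i *: b i) = 0.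
  by apply/bP; exists (lsubmx c).
have r0 : rsubmx c = 0.
  by apply: dI; rewrite -fe -[LHS]add0r -[X in X + _]fb -fD c0 f0.
have l0 : lsubmx c = 0.
  apply: bI; rewrite -[RHS]c0 r0 [X in _ + X]big1 ?addr0 // => i _.
  by rewrite mxE scale0r.
by rewrite -[c]hsubmxK l0 r0 row_mx0.
Qed.

Lemma image_subspace (V W : lmodType F) (f : V -> W) (P : V -> Prop) :
  linear f -> subspace P -> subspace (fun w => exists2 v, P v & f v = w).
Proof.
move=> lf sP; split.
  exists 0; first by case: sP.
  have := lf (-1) 0 0; rewrite scaler0 addr0 => ->.
  by rewrite scaleN1r addNr.
move=> a _ _ [u Pu <-] [v Pv <-]; exists (a *: u + v); last exact: lf.
exact: subspace_lin.
Qed.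

Lemma has_dim0 (V : lmodType F) (P : V -> Prop) :
  (forall v, P v <-> v = 0) -> has_dim P 0.
Proof.
move=> P0; exists (fun _ => 0); split; last by move=> c _; apply/rowP => -[].
move=> v; rewrite P0; split=> [->|[c ->]]; last by rewrite big_ord0.
by exists 0; rewrite big_ord0.
Qed.

Lemma has_dim_image (V W : lmodType F) (f : V -> W) (P : V -> Prop) n :
    linear f -> (forall v, P v -> f v = 0 -> v = 0) -> has_dim P n ->
  has_dim (fun w => exists2 v, P v & f v = w) n.
Proof.
move=> lf finj [b [bP bI]]; exists (fun i => f (b i)).
pose g : {linear V -> W} := HB.pack f (GRing.isLinear.Build F V W *:%R f lf).
have fE (c : 'rV_n) : g (\sum_i c 0 i *: b i) = \sum_i c 0 i *: g (b i).
  by rewrite linear_sum; apply: eq_bigr => i _; rewrite linearZ.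
split=> [w|c c0]; last first.
  by apply: bI; apply: finj; [apply/bP; exists c | rewrite -[f]/(g : V -> W) fE].
split; first by move=> [v /bP[c ->] <-]; exists c.
by move=> [c ->]; exists (\sum_i c 0 i *: b i); [apply/bP; exists c | exact: fE].
Qed.

Lemma has_dim_prod (V W : lmodType F) (P : V -> Prop) (Q : W -> Prop) m n :
  has_dim P m -> has_dim Q n -> has_dim (fun v : V * W => P v.1 /\ Q v.2) (m + n).
Proof.
move=> Pm Qn; have sP := has_dim_subspace Pm; have sQ := has_dim_subspace Qn.
apply: (@rank_nullity (V * W)%type W snd) => //.
- split=> [|a u v [Pu Qu] [Pv Qv]]; first by case: sP; case: sQ.
  by split; apply: subspace_lin.
- move: Pm => [b [bP bI]]; exists (fun i => (b i, 0)).
  have E (c : 'rV_m) : \sum_i c 0 i *: ((b i, 0) : V * W) = (\sum_i c 0 i *: b i, 0).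
    rewrite [LHS]surjective_pairing !raddf_sum /=; congr (_, _).
    by rewrite big1 // => i _; rewrite scaler0.
  split=> [[x y]|c]; rewrite ?E; last by case=> /bI.
  split=> /= [[[/bP[c ->] _] ->]|[c]]; first by exists c; rewrite E.
  by rewrite E => -[-> ->]; do 2?split=> //; [apply/bP; exists c | case: sQ].
- apply: has_dim_ext Qn => w; split=> [Qw|[[x y] [_ Qy] <-]//].
  by exists (0, w) => //; split=> //; case: sP.
Qed.

Lemma has_dim_poly n : has_dim (fun p : {poly F} => (size p <= n)%N) n.
Proof.
exists (fun i : 'I_n => 'X^i); split.
  move=> p; split=> [pn|[c ->]].
    exists (\row_i p`_i); rewrite [LHS](_ : p = \poly_(i < n) p`_i); last first.
      apply/polyP => i; rewrite coef_poly; case: ltnP => // ni.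
      by rewrite nth_default // (leq_trans pn).
    by rewrite poly_def; apply: eq_bigr => i _; rewrite mxE.
  apply: (big_ind (fun p : {poly F} => (size p <= n)%N)); first by rewrite size_poly0.
    by move=> q r qn rn; rewrite (leq_trans (size_polyD _ _)) // geq_max qn.
  by move=> i _; rewrite (leq_trans (size_scale_leq _ _)) // size_polyXn.
move=> c c0; apply/rowP => i; rewrite mxE.
have := congr1 (fun p : {poly F} => p`_i) c0; rewrite coef_sum coef0.
rewrite (bigD1 i) //= coefZ coefXn eqxx mulr1 big1 ?addr0 // => j ji.
by rewrite coefZ coefXn eq_sym (negPf (ji : (j != i :> nat))) mulr0.
Qed.

End Dimension.

(** * Bivariate polynomials filtered by total degree *)

Lemma root_prod_factor (R : idomainType) (rs : seq R) (p : {poly R}) :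
  uniq rs -> (forall u, u \in rs -> p.[u] = 0) ->
  exists q, p = q * \prod_(u <- rs) ('X - u%:P).
Proof.
elim: rs p => [|u rs IH] p /=; first by exists p; rewrite big_nil mulr1.
case/andP=> urs Urs p0.
have /factor_theorem[q pE] : root p u by apply/eqP/p0; rewrite mem_head.
have [v vrs|r qE] := IH q Urs.
  have /eqP := p0 v (mem_behead (s := u :: rs) vrs).
  rewrite pE hornerM hornerXsubC mulf_eq0 subr_eq0 => /orP[/eqP //|/eqP vu].
  by rewrite -vu vrs in urs.
by exists r; rewrite big_cons pE qE mulrAC mulrA.
Qed.

(** Polynomials in x over F[y], under a name of their own: {poly {poly F}} is by
    default a module over {poly F}, and dimensions over F are needed here. *)
Definition bipoly (F : fieldType) : Type := {poly {poly F}}.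

Section Bipoly.
Variable F : fieldType.

HB.instance Definition _ := GRing.IntegralDomain.on (bipoly F).

Definition bipoly_scale (c : F) (p : bipoly F) : bipoly F := c%:P%:P * p.

Fact bipoly_scaleA a b p : bipoly_scale a (bipoly_scale b p) = bipoly_scale (a * b) p.
Proof. by rewrite /bipoly_scale mulrA -!polyCM. Qed.
Fact bipoly_scale1 : left_id 1 bipoly_scale.
Proof. by move=> p; rewrite /bipoly_scale mul1r. Qed.
Fact bipoly_scaleDr : right_distributive bipoly_scale +%R.
Proof. by move=> c p q; rewrite /bipoly_scale mulrDr. Qed.
Fact bipoly_scaleDl p : {morph bipoly_scale^~ p : a b / a + b}.
Proof. by move=> a b; rewrite /bipoly_scale !polyCD mulrDl. Qed.

HB.instance Definition _ := GRing.Zmodule_isLmodule.Build F (bipoly F)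
  bipoly_scaleA bipoly_scale1 bipoly_scaleDr bipoly_scaleDl.

Lemma bipoly_scaleE (c : F) (p : bipoly F) : c *: p = c%:P%:P * p.
Proof. by []. Qed.

(** The substitution x := t s, y := s, with values in F[t][s]. The coefficient of
    s^k is the component of degree k of p with y set to 1, and the size in s is
    the total degree plus one: this encodes the filtration by total degree and
    the leading forms at the same time. *)
Definition slope_sub (p : bipoly F) : {poly {poly F}} :=
  (map_poly (map_poly polyC) p).['X%:P * 'X].

Local Notation kap := slope_sub.
Local Notation tsize p := (size (slope_sub p%R)).

Lemma slope_subD p q : kap (p + q) = kap p + kap q.
Proof. by rewrite /slope_sub rmorphD hornerD. Qed.
Lemma slope_subB p q : kap (p - q) = kap p - kap q.
Proof. by rewrite /slope_sub rmorphB hornerD hornerN. Qed.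
Lemma slope_subM p q : kap (p * q) = kap p * kap q.
Proof. by rewrite /slope_sub rmorphM hornerM. Qed.
Lemma slope_sub0 : kap 0 = 0.
Proof. by rewrite /slope_sub rmorph0 horner0. Qed.
Lemma slope_sub1 : kap 1 = 1.
Proof. by rewrite /slope_sub rmorph1 hornerC. Qed.
Lemma slope_subC (q : {poly F}) : kap q%:P = map_poly polyC q.
Proof. by rewrite /slope_sub map_polyC hornerC. Qed.
Lemma slope_subX : kap 'X = 'X%:P * 'X.
Proof. by rewrite /slope_sub map_polyX hornerX. Qed.

Lemma coef_slope_sub p k i :
  (kap p)`_k`_i = if (i <= k)%N then p`_i`_(k - i) else 0.
Proof.
rewrite /slope_sub horner_coef size_map_inj_poly ?rmorph0 //; last first.
  by apply: map_inj_poly => //; apply: polyC_inj.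
rewrite coef_sum coef_sum.
have termE (j : nat) : ((map_poly (map_poly polyC) p)`_j * ('X%:P * 'X) ^+ j)`_k`_i =
    if (k < j)%N then 0 else if (i < j)%N then 0 else ((p`_j`_(k - j))%:P)`_(i - j).
  rewrite coef_map /= exprMn -polyC_exp mulrA mulrAC coefMC coefMXn.
  case: (ltnP i j) => _; first by rewrite if_same.
  by rewrite coefMXn; case: (ltnP k j) => _; rewrite ?coef0 // coef_map.
under eq_bigr => j _ do rewrite termE coefC.
case: (ltnP i (size p)) => ip.
  rewrite (bigD1 (Ordinal ip)) //= big1 => [|j ji].
    by rewrite addr0 subnn eqxx ltnn ltnNge; case: leqP.
  have {}ji : (j != i :> nat) by exact: ji.
  case: ltnP => // _; case: ltnP => // li.
  by rewrite subn_eq0 leqNgt ltn_neqAle ji li.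
rewrite [p`_i]nth_default // coef0 if_same big1 // => j _.
case: ltnP => // _; case: ltnP => // _.
by rewrite subn_eq0 leqNgt (leq_trans (ltn_ord j) ip).
Qed.

Lemma size_slope_coef p k : (size ((kap p)`_k)%R <= k.+1)%N.
Proof.
apply/leq_sizeP => i ik; rewrite coef_slope_sub.
by rewrite leqNgt ik.
Qed.

Lemma slope_sub_inj : injective kap.
Proof.
move=> p q pq; apply/polyP => i; apply/polyP => j.
have := congr1 (fun r : {poly {poly F}} => r`_(i + j)`_i) pq.
by rewrite !coef_slope_sub !leq_addr !addKn => pqij; exact: pqij.
Qed.

Lemma slope_sub_eq0 p : (kap p == 0) = (p == 0).
Proof.
apply/eqP/eqP => [p0|->]; last exact: slope_sub0.
by apply: slope_sub_inj; rewrite p0 slope_sub0.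
Qed.

Lemma slope_sub_scale (c : F) (p : bipoly F) : kap (c *: p) = c%:P%:P * kap p.
Proof. by rewrite bipoly_scaleE slope_subM slope_subC map_polyC. Qed.

Lemma size_slope_scale (c : F) (p : bipoly F) : (tsize (c *: p) <= tsize p)%N.
Proof. by rewrite slope_sub_scale mul_polyC size_scale_leq. Qed.

Lemma size_slopeC (q : {poly F}) : tsize q%:P = size q.
Proof. by rewrite slope_subC size_map_polyC. Qed.

Lemma size_slopeM p q : (tsize (p * q) <= (tsize p + tsize q).-1)%N.
Proof. by rewrite slope_subM size_polyMleq. Qed.

(** The pair (t, c) stands for the affine line x = t y + c, the slope t being
    its point at infinity. *)
Definition line_root (h : F * F) : {poly F} := h.1 *: 'X + h.2%:P.
Definition line_poly (h : F * F) : bipoly F := 'X - (line_root h)%:P.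

Lemma line_root_inj : injective line_root.
Proof.
move=> [t c] [t' c'] E; have := congr1 (fun p : {poly F} => p`_0) E.
have := congr1 (fun p : {poly F} => p`_1) E.
rewrite /line_root !coefD !coefZ !coefX !coefC /= !mulr1 !addr0 !mulr0 !add0r.
by move=> -> ->.
Qed.

Lemma slope_line h : kap (line_poly h) = ('X - h.1%:P)%:P * 'X - h.2%:P%:P.
Proof.
rewrite slope_subB slope_subX slope_subC /line_root rmorphD /= map_polyZ map_polyX /= map_polyC /=.
by rewrite polyCB mulrBl -!mul_polyC opprD addrA.
Qed.

Lemma size_slope_line h : tsize (line_poly h) = 2%N.
Proof.
rewrite slope_line -[- h.2%:P%:P]polyCN size_MXaddC polyC_eq0 polyXsubC_eq0 /=.
by rewrite size_polyC polyXsubC_eq0.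
Qed.

Lemma lead_slope_line h : lead_coef (kap (line_poly h)) = 'X - h.1%:P.
Proof.
rewrite /lead_coef size_slope_line slope_line /= coefB coefMX coefC /=.
by rewrite coefC subr0.
Qed.

Lemma slope_prod_lines (L : seq (F * F)) :
  tsize (\prod_(h <- L) line_poly h) = (size L).+1 /\
  lead_coef (kap (\prod_(h <- L) line_poly h)) = \prod_(h <- L) ('X - h.1%:P).
Proof.
elim: L => [|h L [IHs IHl]].
  by rewrite !big_nil slope_sub1 size_poly1 lead_coef1.
rewrite !big_cons slope_subM lead_coefM lead_slope_line IHl; split=> //.
by rewrite size_mul ?IHs ?size_slope_line //; rewrite -size_poly_eq0 ?IHs ?size_slope_line.
Qed.

Lemma size_slope_mul_lines (q : bipoly F) (L : seq (F * F)) : q != 0 ->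
  tsize (q * \prod_(h <- L) line_poly h) = (tsize q + size L)%N.
Proof.
move=> q0; rewrite slope_subM size_mul ?slope_sub_eq0 //; last first.
  by rewrite -slope_sub_eq0 -size_poly_eq0 (slope_prod_lines L).1.
by rewrite (slope_prod_lines L).1 addnS.
Qed.

Lemma line_poly_rootM (L : seq (F * F)) (p : bipoly F) :
  uniq L -> (forall h, h \in L -> p.[line_root h] = 0) ->
  exists q : bipoly F, p = q * \prod_(h <- L) line_poly h.
Proof.
move=> UL p0.
have [||q ->] := @root_prod_factor _ (map line_root L) p.
- by rewrite map_inj_uniq //; apply: line_root_inj.
- by move=> u /mapP[h hL ->]; apply: p0.
by exists q; rewrite big_map.
Qed.

(** Substituting t y + c for x does not raise the total degree. *)
Lemma size_restrict (p : bipoly F) h : (size p.[line_root h]%R <= tsize p)%N.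
Proof.
rewrite horner_coef.
apply: (big_ind (fun q : {poly F} => (size q <= tsize p)%N)); first by rewrite size_poly0.
  by move=> q r qn rn; rewrite (leq_trans (size_polyD _ _)) // geq_max qn.
move=> [i /= _] _; have [->|pi0] := eqVneq p`_i 0; first by rewrite mul0r size_poly0.
have si : (size (p`_i)%R + i <= tsize p)%N.
  have /prednK <- : (0 < size (p`_i)%R)%N by rewrite size_poly_gt0.
  rewrite addnC addnS ltnNge.
  apply/negP => /leq_sizeP/(_ _ (leqnn _)) /(congr1 (fun q : {poly F} => q`_i)).
  rewrite coef_slope_sub coef0 leq_addr addKn => /eqP.
  by rewrite -/(lead_coef _) lead_coef_eq0 (negPf pi0).
apply: leq_trans (size_polyMleq _ _) _; rewrite -subn1 leq_subLR.
have : (size (line_root h ^+ i)%R <= i.+1)%N.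
  apply: leq_trans (size_poly_exp_leq _ _) _; rewrite ltnS.
  have : ((size (line_root h)).-1 <= 1)%N.
    rewrite -subn1 leq_subLR (leq_trans (size_polyD _ _)) // geq_max size_polyC.
    by rewrite (leq_trans (size_scale_leq _ _)) ?size_polyX //=; case: eqP.
  by move=> sh; rewrite -[X in (_ <= X)%N](mul1n i) leq_mul2r sh orbT.
by move=> su; rewrite (leq_trans (leq_add (leqnn _) su)) // addnS add1n ltnS.
Qed.

End Bipoly.

(** * Multiarrangements on the projective line and their exponents *)

Fact cancel_bound a b k d : ((a + b).-1 <= k -> k - d < a -> b <= d)%N.
Proof. by lia. Qed.

Fact cancel_bound2 a b d : (0 < a -> (a + b).-1 <= d.+1 -> b <= d.+2 - a)%N.
Proof. by lia. Qed.

Fact sum_exponents x n d1 d2 :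
  (0 < x -> (x + n.+1).-1 <= (d1.+1 + d2.+1).-1 -> d1 + d2 <= n -> x = 1 /\ d1 + d2 = n)%N.
Proof. by lia. Qed.

Section Multi.
Variable F : fieldType.
Implicit Types (s : seq F) (t : F) (k : nat) (v w u : {poly F} * {poly F}).

Lemma prod_powers_dvd (E : seq F) (m : F -> nat) (h : {poly F}) :
  uniq E -> (forall t, t \in E -> ('X - t%:P) ^+ m t %| h) ->
  \prod_(t <- E) ('X - t%:P) ^+ m t %| h.
Proof.
elim: E => [|t E IH] /=; first by rewrite big_nil dvd1p.
move=> /andP[tE UE] hE; rewrite big_cons Gauss_dvdp.
  by rewrite hE ?mem_head // IH // => x xE; rewrite hE // mem_behead.
apply: coprimep_expl; rewrite coprimep_sym coprimep_XsubC rootE horner_prod big_seq.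
rewrite prodf_seq_neq0; apply/allP => x xE; apply/implyP => _.
rewrite horner_exp hornerXsubC expf_neq0 // subr_eq0.
by apply: contraNneq tE => ->.
Qed.

Lemma prod_count (s : seq F) :
  \prod_(t <- s) ('X - t%:P) = \prod_(t <- undup s) ('X - t%:P) ^+ count_mem t s.
Proof. by rewrite -(big_undup_iterop_count _ s). Qed.

Lemma prod_XsubC_dvd s h :
  (forall t, t \in s -> ('X - t%:P) ^+ count_mem t s %| h) ->
  \prod_(t <- s) ('X - t%:P) %| h.
Proof.
move=> sh; rewrite prod_count prod_powers_dvd ?undup_uniq // => t.
by rewrite mem_undup; apply: sh.
Qed.

Lemma dvd_prod_XsubC s t : ('X - t%:P) ^+ count_mem t s %| \prod_(x <- s) ('X - x%:P).
Proof.
elim: s => [|x s IH]; first by rewrite big_nil dvd1p.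
rewrite big_cons /= exprD; apply: dvdp_mul => //.
by case: eqP => [->|_]; rewrite ?expr1 // expr0 dvd1p.
Qed.

(** Homogeneous derivations of degree less than k of the multiarrangement s on
    the projective line, with the second coordinate set to 1: the pair (f, g)
    is f d/dx + g d/dy, and its value on the form x - t y must be divisible by
    a power of this form. Listing a point of s several times gives its
    multiplicity. The point at infinity of the projective line does not occur. *)
Definition in_multi s k v : Prop :=
  [/\ (size v.1 <= k)%N, (size v.2 <= k)%N
    & forall t, ('X - t%:P) ^+ count_mem t s %| v.1 - t *: v.2].

Definition pdet v w : {poly F} := v.1 * w.2 - v.2 * w.1.

Lemma in_multi_subspace s k : subspace (in_multi s k).
Proof.
split; first by split=> [||t]; rewrite ?size_poly0 // scaler0 subrr dvdp0.
move=> a u v [u1 u2 ud] [v1 v2 vd]; split=> [||t] /=.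
- by rewrite (leq_trans (size_polyD _ _)) // geq_max v1 (leq_trans (size_scale_leq _ _)).
- by rewrite (leq_trans (size_polyD _ _)) // geq_max v2 (leq_trans (size_scale_leq _ _)).
- rewrite [X in _ %| X](_ : _ = a *: (u.1 - t *: u.2) + (v.1 - t *: v.2)).
    by rewrite dvdp_add // -mul_polyC dvdp_mull.
  by rewrite scalerBr scalerDr opprD !scalerA (mulrC t a) addrACA.
Qed.

Lemma has_dim_pair_poly k :
  has_dim (fun v => (size v.1 <= k)%N /\ (size v.2 <= k)%N) (k + k).
Proof. exact: (has_dim_prod (has_dim_poly F k) (has_dim_poly F k)). Qed.

Lemma in_multi_finite s k : exists d, has_dim (in_multi s k) d.
Proof.
apply: has_dim_sub (has_dim_pair_poly k); first exact: in_multi_subspace.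
by move=> v [].
Qed.

Lemma in_multiW s k l v : (k <= l)%N -> in_multi s k v -> in_multi s l v.
Proof. by move=> kl [v1 v2 vd]; split=> //; apply: leq_trans kl. Qed.

(** Each unit of multiplicity imposes a single linear condition. *)
Lemma in_multi_dim_geq s k d : has_dim (in_multi s k) d -> (k + k <= d + size s)%N.
Proof.
elim: s d => [|t s IH] d dP.
  rewrite addn0; apply: (has_dim_incl _ (has_dim_pair_poly k) dP).1 => v [v1 v2].
  by split=> // t; rewrite dvd1p.
have [d' d'P] := in_multi_finite s k.
pose f v : {poly F} := (((v.1 - t *: v.2) %/ ('X - t%:P) ^+ count_mem t s).[t])%:P.
have lf : linear f.
  move=> a u v; rewrite /f /=.
  rewrite (_ : _ - _ = a *: (u.1 - t *: u.2) + (v.1 - t *: v.2)); last first.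
    by rewrite scalerBr scalerDr opprD !scalerA (mulrC t a) addrACA.
  rewrite [LHS](_ : _ = ((a *: ((u.1 - t *: u.2) %/ ('X - t%:P) ^+ count_mem t s) + (v.1 - t *: v.2) %/ ('X - t%:P) ^+ count_mem t s).[t])%:P).
    by rewrite hornerD hornerZ polyCD polyCM mul_polyC.
  by rewrite -divpZl -divpD.
have sI := image_subspace lf (in_multi_subspace s k).
have [e eP] : exists e, has_dim (fun p : {poly F} => exists2 v, in_multi s k v & f v = p) e.
  apply: has_dim_sub (has_dim_poly F 1) => //.
  by move=> _ [v _ <-]; rewrite size_polyC leq_b1.
have e1 : (e <= 1)%N.
  apply: (has_dim_incl _ eP (has_dim_poly F 1)).1.
  by move=> _ [v _ <-]; rewrite size_polyC leq_b1.
have : has_dim (in_multi s k) (d + e).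
  apply: rank_nullity lf (in_multi_subspace s k) _ eP.
  apply: has_dim_ext dP => v; split.
    move=> [v1 v2 vd].
    have vs x : ('X - x%:P) ^+ count_mem x s %| v.1 - x *: v.2.
      by apply: dvdp_trans (vd x); rewrite dvdp_exp2l //= leq_addl.
    split=> //; have := vd t; rewrite /= eqxx add1n exprS => /dvdpP[q qE].
    rewrite /f qE mulrA mulpK ?expf_neq0 ?polyXsubC_eq0 //.
    by rewrite hornerM hornerXsubC subrr mulr0.
  move=> [[v1 v2 vd] /eqP]; rewrite /f polyC_eq0 => fv; split=> // x /=.
  case: eqP => [<-|_]; last by rewrite add0n.
  rewrite -[v.1 - _](divpK (vd t)) add1n exprS dvdp_mul //.
  by rewrite dvdp_XsubCl.
move/(has_dim_uniq d'P) => d'E; have := IH _ d'P.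
by rewrite d'E /= => IH'; lia.
Qed.

Lemma pdet_dvd s k l v w : in_multi s k v -> in_multi s l w ->
  \prod_(t <- s) ('X - t%:P) %| pdet v w.
Proof.
move=> [_ _ vd] [_ _ wd]; apply: prod_XsubC_dvd => t _.
rewrite /pdet (_ : v.1 * w.2 - _ = (v.1 - t *: v.2) * w.2 - (w.1 - t *: w.2) * v.2).
  by apply: dvdp_sub; apply: dvdp_mulr; rewrite ?vd ?wd.
by rewrite !mulrBl -!scalerAl [w.2 * v.2]mulrC opprB addrA subrK [w.1 * _]mulrC.
Qed.

Lemma size_pdet k l v w : (size v.1 <= k)%N -> (size v.2 <= k)%N ->
  (size w.1 <= l)%N -> (size w.2 <= l)%N -> (size (pdet v w) <= (k + l).-1)%N.
Proof.
move=> v1 v2 w1 w2; rewrite /pdet (leq_trans (size_polyD _ _)) // size_polyN.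
by rewrite geq_max; apply/andP; split; apply: leq_trans (size_polyMleq _ _) _;
  by rewrite -!subn1 leq_sub2r // leq_add.
Qed.

(** Elements of degrees d1 and d2 with d1 + d2 equal to the total multiplicity and
    with determinant the defining polynomial form a basis, by Saito's criterion;
    see [exponents_decomp]. *)
Definition exponents s (d1 d2 : nat) v w : Prop :=
  [/\ (d1 <= d2)%N, (d1 + d2 = size s)%N, in_multi s d1.+1 v, in_multi s d2.+1 w
    & exists2 c, c != 0 & pdet v w = c *: \prod_(t <- s) ('X - t%:P)].

(** Take v of minimal degree d1 and w of minimal degree d2 outside the multiples
    of v. The dimension bound [in_multi_dim_geq] gives d1 + d2 <= |s|, while the
    determinant of v and w is divisible by the defining polynomial, which has
    degree |s|. Hence both are equal up to a constant. *)
Lemma exponents_exist s : exists d1 d2 v w, exponents s d1 d2 v w.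
Proof.
have nz1 : exists k, `[< exists2 v, in_multi s k.+1 v & v != 0 >].
  exists (size s); apply/asboolP; apply: contrapT => no.
  have [[|d] dP] := in_multi_finite s (size s).+1; first by have := in_multi_dim_geq dP; lia.
  have /(has_dim_uniq dP) // : has_dim (in_multi s (size s).+1) 0.
  apply: has_dim0 => v; split=> [vM|->]; last by case: (in_multi_subspace s (size s).+1).
  by apply/eqP/negPn/negP => v0; apply: no; exists v.
have [d1 /asboolP[v vM v0] d1min] := ex_minnP nz1.
have d1P k u : in_multi s k u -> u != 0 -> (d1 < k)%N.
  case: k => [[u1 u2 _]|k uM u0]; last by apply: d1min; apply/asboolP; exists u.
  move/negP=> []; apply/eqP; apply: injective_projections => /=; apply/eqP.
    by rewrite -size_poly_eq0 -leqn0.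
  by rewrite -size_poly_eq0 -leqn0.
pose smul (a : {poly F}) : {poly F} * {poly F} := (a * v.1, a * v.2).
have smulK k a : in_multi s k (smul a) -> (size a <= k - d1)%N.
  move=> [/= a1 a2 _]; have [->|a0] := eqVneq a 0; first by rewrite size_poly0.
  rewrite leqNgt; apply/negP => sa.
  have v1d : (size v.1 <= d1)%N.
    have [->|v10] := eqVneq v.1 0; first by rewrite size_poly0.
    by apply: cancel_bound sa; rewrite -size_mul.
  have v2d : (size v.2 <= d1)%N.
    have [->|v20] := eqVneq v.2 0; first by rewrite size_poly0.
    by apply: cancel_bound sa; rewrite -size_mul.
  have /d1P/(_ v0) : in_multi s d1 v by case: vM.
  by rewrite ltnn.
have smul_lin : linear smul.
  by move=> c a b; rewrite /smul !mulrDl -!scalerAl.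
have smulI a : smul a = 0 -> a = 0.
  move=> [/eqP]; rewrite mulf_eq0 => /orP[/eqP //|/eqP v10 /eqP].
  rewrite mulf_eq0 => /orP[/eqP //|/eqP v20].
  by case/negP: v0; apply/eqP; apply: injective_projections.
have colbound k : (forall u, in_multi s k u -> exists a, u = smul a) -> (k + d1 <= size s \/ k <= d1)%N.
  move=> col; have [d dP] := in_multi_finite s k.
  have : (d <= k - d1)%N.
    have H := has_dim_image smul_lin (fun a _ => @smulI a) (has_dim_poly F (k - d1)).
    apply: (has_dim_incl _ dP H).1 => u uM; have [a uE] := col u uM.
    by exists a => //; apply: smulK; rewrite -uE.
  by have := in_multi_dim_geq dP; lia.
have nz2 : exists k, `[< exists2 u, in_multi s k.+1 u & forall a, u <> smul a >].
  exists (size s + d1)%N; apply/asboolP; apply: contrapT => no.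
  case: (colbound (size s + d1).+1); [|lia|lia].
  move=> u uM; apply: contrapT => nu; apply: no; exists u => // a uE.
  by apply: nu; exists a.
have [d2 /asboolP[w wM wN] d2min] := ex_minnP nz2.
have d12 : (d1 <= d2)%N.
  rewrite -ltnS; apply: (d1P _ w) => //; apply/eqP => w0.
  by apply: (wN 0); rewrite w0 /smul !mul0r.
have sum_le : (d1 + d2 <= size s)%N.
  case: (colbound d2); [|lia|].
    move=> u uM; apply: contrapT => nu.
    case: d2 {d12 wM} d2min uM => [|d2] d2min uM; last first.
      have : (d2.+1 <= d2)%N; last by rewrite ltnn.
      by apply: d2min; apply/asboolP; exists u => // a uE; apply: nu; exists a.
    have [u0|] := eqVneq u 0; last by move/(d1P _ _ uM).
    by apply: nu; exists 0; rewrite u0 /smul !mul0r.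
  move=> d21; have dE : d2 = d1 by apply/eqP; rewrite eqn_leq d21 d12.
  have [d dP] := in_multi_finite s d1.
  have := in_multi_dim_geq dP; rewrite (has_dim_uniq dP (n := 0)) ?dE //.
  apply: has_dim0 => u; split=> [uM|->]; last by case: (in_multi_subspace s d1).
  by apply/eqP/negPn/negP => /(d1P _ _ uM); rewrite ltnn.
(* If v and w were proportional, dividing v by the denominator of their ratio
   would give an element of smaller degree. *)
have det0 : pdet v w != 0.
  apply/eqP => d0.
  have [f [g [f0 fw]]] : exists f g, f != 0 /\ (f * w.1 = g * v.1 /\ f * w.2 = g * v.2).
    move/eqP: d0; rewrite subr_eq0 => /eqP d0.
    have [v10|v10] := eqVneq v.1 0.
      exists v.2, w.2; split; first by apply: contraNneq v0 => v20; apply/eqP; apply: injective_projections.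
      by split; [rewrite -d0 mulrC | rewrite mulrC].
    by exists v.1, w.1; split=> //; split; [rewrite mulrC | rewrite d0 mulrC].
  pose h := gcdp f g.
  have h0 : h != 0 by rewrite gcdp_eq0 negb_and f0.
  pose q := f %/ h; pose p := g %/ h.
  have fE : f = q * h by rewrite divpK // dvdp_gcdl.
  have gE : g = p * h by rewrite divpK // dvdp_gcdr.
  have q0 : q != 0 by apply: contraNneq f0 => q0; rewrite fE q0 mul0r.
  have cop : coprimep q p by rewrite coprimep_div_gcd // f0.
  have qw i j : f * i = g * j -> q * i = p * j.
    by rewrite fE gE ![_ * h]mulrC -!mulrA => /(mulfI h0).
  case: fw => /qw qw1 /qw qw2.
  have div i j : q * i = p * j -> exists2 x, j = q * x & i = p * x.
    move=> E; have : q %| p * j by rewrite -E dvdp_mulr.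
    rewrite Gauss_dvdpr // => /dvdpP[x jE]; exists x; first by rewrite mulrC.
    by apply: (mulfI q0); rewrite E jE; ring.
  have [x vx wx] := div _ _ qw1; have [y vy wy] := div _ _ qw2.
  have xyM : in_multi s (d1.+2 - size q) (x, y).
    have szq : (0 < size q)%N by rewrite size_poly_gt0.
    case: (vM) (wM) => /= v1 v2 vd [_ _ wd]; split=> [||t] /=.
    - have [->|x0] := eqVneq x 0; first by rewrite size_poly0.
      by apply: cancel_bound2 => //; rewrite -size_mul // -vx.
    - have [->|y0] := eqVneq y 0; first by rewrite size_poly0.
      by apply: cancel_bound2 => //; rewrite -size_mul // -vy.
    have := vd t; rewrite vx vy scalerAr -mulrBr => dq.
    have := wd t; rewrite wx wy scalerAr -mulrBr => dp.
    have [[a b] /= ab] := Bezout_eq1_coprimepP _ _ cop.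
    rewrite -[x - _]mul1r -ab mulrDl -!mulrA.
    by apply: dvdp_add; apply: dvdp_mull.
  have xy0 : (x, y) != 0.
    apply: contraNneq v0 => -[x0 y0]; apply/eqP.
    by apply: injective_projections; rewrite ?vx ?vy ?x0 ?y0 mulr0.
  have := d1P _ _ xyM xy0; have : (0 < size q)%N by rewrite size_poly_gt0.
  move=> sq dq; have /size_poly1P[c c0 qc] : size q == 1 by apply/eqP; lia.
  apply: (wN (c^-1 *: p)); rewrite /smul vx vy qc; apply: injective_projections => /=.
    by rewrite wx mul_polyC -scalerAl -scalerAr scalerA mulVf // scale1r.
  by rewrite wy mul_polyC -scalerAl -scalerAr scalerA mulVf // scale1r.
have /dvdpP[q qE] := pdet_dvd vM wM.
have q0 : q != 0 by apply: contraNneq det0 => q0; rewrite qE q0 mul0r.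
have szd : (size (pdet v w) <= (d1.+1 + d2.+1).-1)%N.
  by case: vM => ? ? _; case: wM => ? ? _; apply: size_pdet.
have szq : (0 < size q)%N by rewrite size_poly_gt0.
move: szd; rewrite qE size_mul // ?monic_neq0 ?monic_prod_XsubC // size_prod_XsubC => szd.
have [/eqP/size_poly1P[c c0 qc] d12E] := sum_exponents szq szd sum_le.
exists d1, d2, v, w; split=> //.
by exists c => //; rewrite qE qc mul_polyC.
Qed.

End Multi.

(** * Exponents determined by the multiplicities *)

Fact cramer_bound x n d1 d2 k :
  (d1 + d2 = n -> x + n <= (k + d2.+1).-1 -> x <= k - d1)%N.
Proof. by lia. Qed.

Fact lift_bound a b d k : (0 < a -> a <= k - d -> b <= d.+1 -> (a + b).-1 <= k)%N.
Proof. by lia. Qed.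

Fact wronskian_expand (R : comRingType) (q p z c g g' q' n : R) :
  (q * (p * z) + c * g) * g' - (q' * (p * z) + q * (z * n) + c * g') * g =
  z * (q * p * g' - (q' * p + q * n) * g).
Proof. by ring. Qed.

Fact three_bound n : (3 <= n -> (n - 3).+1 <= (2 * (n./2).-1).-1 -> False)%N.
Proof. by lia. Qed.

Fact half_bound n c : (2 * c <= n -> n./2 <= n - c)%N.
Proof. by lia. Qed.

Section Exponents.
Variable F : fieldType.
Implicit Types (s : seq F) (t : F) (k : nat) (u v w : {poly F} * {poly F}).

Lemma pdet_neq0 s d1 d2 v w : exponents s d1 d2 v w -> pdet v w != 0.
Proof.
case=> _ _ _ _ [c c0 ->].
by rewrite scaler_eq0 negb_or c0 monic_neq0 // monic_prod_XsubC.
Qed.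

(** Cramer's rule, the two determinants being divisible by the determinant of v
    and w. *)
Lemma exponents_decomp s d1 d2 v w k u :
  exponents s d1 d2 v w -> in_multi s k u ->
  exists a b : {poly F}, [/\ (size a <= k - d1)%N, (size b <= k - d2)%N,
    u.1 = a * v.1 + b * w.1 & u.2 = a * v.2 + b * w.2].
Proof.
move=> ex uM; have D0 := pdet_neq0 ex.
case: ex => _ dE vM wM [c c0 DE].
have P0 : \prod_(t <- s) ('X - t%:P) != 0 by rewrite monic_neq0 // monic_prod_XsubC.
have ex_q x k1 y k2 : in_multi s k1 x -> in_multi s k2 y ->
  exists2 q, pdet x y = q * pdet v w & q != 0 -> (size q + size s <= (k1 + k2).-1)%N.
  move=> xM yM; have /dvdpP[q qE] := pdet_dvd xM yM.
  exists (c^-1 *: q).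
    by rewrite DE -scalerAr -scalerAl scalerA divff // scale1r.
  rewrite scaler_eq0 negb_or => /andP[ci q0]; rewrite size_scale //.
  case: xM => x1 x2 _; case: yM => y1 y2 _.
  have := size_pdet x1 x2 y1 y2.
  by rewrite qE size_mul // size_prod_XsubC addnS.
have [a aE sa] := ex_q _ _ _ _ uM wM; have [b bE sb] := ex_q _ _ _ _ vM uM.
exists a, b; split.
- have [->|a0] := eqVneq a 0; first by rewrite size_poly0.
  exact: cramer_bound dE (sa a0).
- have [->|b0] := eqVneq b 0; first by rewrite size_poly0.
  apply: (@cramer_bound _ (size s) d2 d1); first by rewrite addnC.
  by rewrite addnC (addnC k) addnC; apply: sb.
- apply: (mulIf D0); rewrite mulrDl mulrAC [X in _ + X]mulrAC -aE -bE.
  by rewrite /pdet; ring.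
- apply: (mulIf D0); rewrite mulrDl mulrAC [X in _ + X]mulrAC -aE -bE.
  by rewrite /pdet; ring.
Qed.

Lemma in_multi_mul s d v (a : {poly F}) k :
  in_multi s d.+1 v -> (size a <= k - d)%N -> in_multi s k (a * v.1, a * v.2).
Proof.
move=> [v1 v2 vd] ad; have [->|a0] := eqVneq a 0.
  by rewrite !mul0r; apply: (in_multi_subspace s k).1.
have sa : (0 < size a)%N by rewrite size_poly_gt0.
split=> [||t] /=.
- by apply: leq_trans (size_polyMleq _ _) _; apply: lift_bound ad v1.
- by apply: leq_trans (size_polyMleq _ _) _; apply: lift_bound ad v2.
- by rewrite scalerAr -mulrBr dvdp_mull.
Qed.

Lemma exponents_dim s d1 d2 v w k :
  exponents s d1 d2 v w -> has_dim (in_multi s k) ((k - d1) + (k - d2)).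
Proof.
move=> ex; have D0 := pdet_neq0 ex.
pose f (p : {poly F} * {poly F}) : {poly F} * {poly F} :=
  (p.1 * v.1 + p.2 * w.1, p.1 * v.2 + p.2 * w.2).
have lf : linear f.
  move=> a p q; rewrite /f /=; congr (_, _).
    by rewrite /= scalerDr !mulrDl -!scalerAl addrACA.
  by rewrite /= scalerDr !mulrDl -!scalerAl addrACA.
have H := has_dim_prod (has_dim_poly F (k - d1)) (has_dim_poly F (k - d2)).
apply: has_dim_ext (has_dim_image lf _ H) => [u|[a b] _ [E1 E2]]; first last.
  have a0 : a * pdet v w = 0.
    rewrite (_ : _ * _ = (a * v.1 + b * w.1) * w.2 - (a * v.2 + b * w.2) * w.1).
      by rewrite E1 E2 !mul0r subrr.
    by rewrite /pdet; ring.
  have b0 : b * pdet v w = 0.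
    rewrite (_ : _ * _ = (a * v.2 + b * w.2) * v.1 - (a * v.1 + b * w.1) * v.2).
      by rewrite E1 E2 !mul0r subrr.
    by rewrite /pdet; ring.
  move/eqP: a0; rewrite mulf_eq0 (negPf D0) orbF => /eqP ->.
  by move/eqP: b0; rewrite mulf_eq0 (negPf D0) orbF => /eqP ->.
split=> [[[a b] /= [sa sb] <-]|uM].
  case: ex => _ _ vM wM _.
  exact: subspace_add (in_multi_subspace s k) (in_multi_mul vM sa) (in_multi_mul wM sb).
have [a [b [sa sb u1 u2]]] := exponents_decomp ex uM.
by exists (a, b) => //; rewrite /f /= -u1 -u2; case: (u).
Qed.

Lemma exponents_ge s d1 d2 v w k : exponents s d1 d2 v w ->
  (forall u, in_multi s k u -> u = 0) -> (k <= d1)%N.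
Proof.
move=> ex u0; rewrite leqNgt; apply/negP => dk.
have := pdet_neq0 ex; case: ex => _ _ vM _ _.
by rewrite (u0 v (in_multiW dk vM)) /pdet !mul0r subrr eqxx.
Qed.

Lemma exponents_le s d1 d2 v w k u : exponents s d1 d2 v w ->
  in_multi s k.+1 u -> u != 0 -> (d1 <= k)%N.
Proof.
move=> ex uM; apply: contraR; rewrite -ltnNge => kd.
have [d12 _ _ _ _] := ex.
have [a [b [sa sb u1 u2]]] := exponents_decomp ex uM.
have a0 : a = 0 by apply/eqP; rewrite -size_poly_eq0; lia.
have b0 : b = 0 by apply/eqP; rewrite -size_poly_eq0; lia.
by apply/eqP; apply: injective_projections; rewrite ?u1 ?u2 a0 b0 !mul0r addr0.
Qed.

Lemma prod_size_eq0 s (g : {poly F}) : (size g <= size s)%N ->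
  \prod_(t <- s) ('X - t%:P) %| g -> g = 0.
Proof.
move=> sg dg; apply/eqP/negPn/negP => g0.
by have := dvdp_leq g0 dg; rewrite size_prod_XsubC leqNgt ltnS sg.
Qed.

Lemma count_filter_neq s t x :
  count_mem x [seq y <- s | y != t] = if x == t then 0%N else count_mem x s.
Proof.
rewrite count_filter; case: eqP => [->|/eqP xt].
  by rewrite (eq_count (a2 := pred0)) ?count_pred0 // => y /=; case: eqP.
by apply: eq_count => y /=; case: (eqVneq y x) => // ->.
Qed.

Lemma size_filter_neq s t : size [seq y <- s | y != t] = (size s - count_mem t s)%N.
Proof. by rewrite size_filter -(count_predC (pred1 t) s) addKn. Qed.

(** Let t carry at least half of the multiplicity and let g be the product of the
    remaining forms. The constant field (t, 1) kills x - t y, so g times this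
    field is tangent; a tangent field of smaller degree is a multiple of
    (t, 1), for degree reasons, and then its coefficient is divisible by g. *)
Lemma exponents_heavy s d1 d2 v w t : exponents s d1 d2 v w ->
  (size s <= 2 * count_mem t s)%N -> d1 = (size s - count_mem t s)%N.
Proof.
move=> ex st; set k := (_ - _)%N; set s' := [seq y <- s | y != t].
have ss' : size s' = k by rewrite size_filter_neq.
have dv g : (forall x, ('X - x%:P) ^+ count_mem x s %| (t - x) *: g) ->
    \prod_(x <- s') ('X - x%:P) %| g.
  move=> gd; apply: prod_XsubC_dvd => x; rewrite count_filter_neq mem_filter.
  case: eqP => //= /eqP xt _; rewrite -(dvdpZr _ _ (c := t - x)) ?gd //.
  by rewrite subr_eq0 eq_sym.
apply/eqP; rewrite eqn_leq; apply/andP; split.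
  pose g := \prod_(x <- s') ('X - x%:P).
  apply: (exponents_le (u := (t *: g, g)) ex); last first.
    apply/eqP => -[_ /eqP]; apply/negP.
    by rewrite monic_neq0 // monic_prod_XsubC.
  split=> [||x] /=.
  - by rewrite (leq_trans (size_scale_leq _ _)) // size_prod_XsubC ss'.
  - by rewrite size_prod_XsubC ss'.
  rewrite -scalerBl; have [->|xt] := eqVneq x t.
    by rewrite subrr scale0r dvdp0.
  rewrite -mul_polyC dvdp_mull //; apply: dvdp_trans (dvd_prod_XsubC s' x).
  by rewrite count_filter_neq (negPf xt).
apply: exponents_ge ex _ => -[f g] [/= fk gk fgd].
have kt : (k <= count_mem t s)%N by rewrite /k leq_subLR addnn -mul2n.
have fE : f = t *: g.
  apply/eqP; rewrite -subr_eq0; apply/negPn/negP => fg0.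
  have := dvdp_leq fg0 (fgd t); rewrite size_exp_XsubC leqNgt ltnS.
  rewrite (leq_trans _ kt) // (leq_trans (size_polyD _ _)) // size_polyN geq_max fk.
  by rewrite (leq_trans (size_scale_leq _ _)).
suff g0 : g = 0 by rewrite fE g0 scaler0.
apply: (@prod_size_eq0 s'); first by rewrite ss'.
by apply: dv => x; have := fgd x; rewrite fE -scalerBl.
Qed.

(** The Euler field times a polynomial h is tangent to the multiarrangement s if
    and only if h is a multiple of this product. *)
Definition excess s : {poly F} := \prod_(t <- undup s) ('X - t%:P) ^+ (count_mem t s).-1.

Lemma excess_dvd s h :
  (forall t, t \in s -> ('X - t%:P) ^+ (count_mem t s).-1 %| h) -> excess s %| h.
Proof.
move=> sh; apply: prod_powers_dvd (undup_uniq s) _ => t.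
by rewrite mem_undup; apply: sh.
Qed.

Lemma prod_undup_excess s :
  \prod_(t <- undup s) ('X - t%:P) * excess s = \prod_(t <- s) ('X - t%:P).
Proof.
rewrite prod_count -big_split /= big_seq [RHS]big_seq; apply: eq_bigr => t.
by rewrite mem_undup -exprS -has_pred1 has_count => /prednK ->.
Qed.

Lemma monic_excess s : excess s \is monic.
Proof. by apply: monic_prod => t _; rewrite monic_exp // monicXsubC. Qed.

Lemma size_excess s : size (excess s) = (size s - size (undup s)).+1.
Proof.
have := congr1 (fun p : {poly F} => size p) (prod_undup_excess s).
rewrite size_mul ?monic_neq0 ?monic_excess ?monic_prod_XsubC // !size_prod_XsubC.
by move=> /= /(congr1 (fun m => m - size (undup s)))%N; rewrite addKn subSn ?size_undup.
Qed.

Lemma dvd_excess s t : t \in s -> ('X - t%:P) ^+ (count_mem t s).-1 %| excess s.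
Proof.
rewrite -mem_undup => ts; rewrite /excess (bigD1_seq t) ?undup_uniq //=.
exact: dvdp_mulr.
Qed.

(** The field (f, g) and the Euler field (X, 1) are both tangent to all points,
    so their wedge vanishes at each of them. *)
Lemma euler_wedge_dvd s k f g : in_multi s k (f, g) ->
  \prod_(t <- undup s) ('X - t%:P) %| f - 'X * g.
Proof.
move=> [_ _ /= fgd].
under eq_bigr => t _ do rewrite -['X - _]expr1.
apply: (prod_powers_dvd (m := fun=> 1%N) (undup_uniq s)) => t; rewrite mem_undup => ts.
rewrite expr1 (_ : f - _ = (f - t *: g) - ('X - t%:P) * g).
  apply: dvdp_sub; last exact: dvdp_mulr.
  apply: dvdp_trans (fgd t); rewrite -{1}['X - _]expr1 dvdp_exp2l //.
  by rewrite -has_count has_pred1.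
by rewrite mulrBl -mul_polyC opprB addrA subrK.
Qed.

Lemma euler_multiple s k g : in_multi s k ('X * g, g) ->
  (k <= (size s - size (undup s)).+1)%N -> g = 0.
Proof.
move=> [/= Xg _ fgd] sk; apply/eqP/negPn/negP => g0.
move: Xg; rewrite mulrC size_mulX // => Xg.
have : excess s %| g.
  apply: excess_dvd => t ts; have := fgd t.
  rewrite -mul_polyC -mulrBl -{1}(prednK (n := count_mem t s)); last by rewrite -has_count has_pred1.
  by rewrite exprS dvdp_mul2l // polyXsubC_eq0.
move/(dvdp_leq g0); rewrite size_excess => sg.
by have := leq_trans sg (leq_trans Xg sk); rewrite ltnn.
Qed.

(** The smallest tangent multiple of the Euler field has degree |s| - n + 1. A
    field of degree less than n - 1 is a multiple of the Euler field, because
    its wedge with the Euler field has fewer than n zeros. *)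
Lemma exponents_many s d1 d2 v w : exponents s d1 d2 v w ->
  (size s < 2 * size (undup s))%N ->
  d1 = minn (size s - size (undup s)).+1 (size (undup s)).-1.
Proof.
move=> ex sn; set n := size (undup s) in sn *.
have ns : (n <= size s)%N by rewrite size_undup.
apply/eqP; rewrite eqn_leq; apply/andP; split.
  rewrite leq_min; apply/andP; split; last by case: ex => d12 dE _ _ _; lia.
  apply: (exponents_le (u := ('X * excess s, excess s)) ex); last first.
    by apply/eqP => -[_ /eqP]; apply/negP; rewrite monic_neq0 // monic_excess.
  split=> [||t] /=.
  - by rewrite mulrC size_mulX ?monic_neq0 ?monic_excess // size_excess.
  - by rewrite size_excess.
  - have [ts|ts] := boolP (t \in s); last by rewrite (count_memPn ts) dvd1p.
    rewrite -mul_polyC -mulrBl -(prednK (n := count_mem t s)); last by rewrite -has_count has_pred1.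
    by rewrite exprS dvdp_mul // dvd_excess.
apply: (exponents_ge ex) => -[f g] fgM.
have fE : f = 'X * g.
  apply/eqP; rewrite -subr_eq0; apply/negPn/negP => fg0.
  have := dvdp_leq fg0 (euler_wedge_dvd fgM); rewrite size_prod_XsubC -/n leqNgt ltnS => /negP; apply.
  case: fgM => /= fk gk _; rewrite (leq_trans (size_polyD _ _)) // size_polyN geq_max.
  move: fk gk; rewrite !leq_min => /andP[_ fk] /andP[_ gk].
  rewrite (leq_trans fk) ?leq_pred //= (leq_trans (size_polyMleq _ _)) // size_polyX /=.
  by rewrite (leq_ltn_trans gk) // prednK //; lia.
have g0 : g = 0.
  by move: fgM; rewrite fE => /euler_multiple; apply; rewrite geq_minl.
by rewrite fE g0 mulr0.
Qed.

End Exponents.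

Section CharZero.
Variable F : numFieldType.
Implicit Types (s : seq F) (t : F) (k : nat) (u v w : {poly F} * {poly F}).

(** Let Q be the reduced equation of the n points. The wedge of a field (f, g) of
    degree less than n with the Euler field is c Q; differentiating at the
    points gives g = - c Q', and then the coefficient of X^n yields n c = c. The
    conclusion c = 0 would fail in a characteristic dividing n - 1. *)
Lemma exponents_double s d1 d2 v w : exponents s d1 d2 v w ->
  (1 < size (undup s))%N -> (forall t, t \in s -> count_mem t s = 2%N) ->
  d1 = size (undup s).
Proof.
move=> ex n1 c2; set n := size (undup s) in n1 *.
have sE : size s = (2 * n)%N.
  have := size_excess s; rewrite /excess.
  under eq_big_seq => t do rewrite mem_undup => /c2 ->.
  rewrite /= (eq_bigr (fun t => 'X - t%:P)) => [|t _]; last by rewrite expr1.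
  rewrite size_prod_XsubC => -[nE]; have nE' : n = (size s - n)%N by exact: nE.
  by have ns : (n <= size s)%N := size_undup s; lia.
apply/eqP; rewrite eqn_leq; apply/andP; split; first by case: ex => d12 + _ _ _; rewrite sE; lia.
apply: (exponents_ge ex) => -[f g] fgM.
have [/= fn gn fgd] := fgM.
pose Q := \prod_(t <- undup s) ('X - t%:P).
have sQ : size Q = n.+1 by rewrite size_prod_XsubC.
have [c cE] : exists c, f - 'X * g = c *: Q.
  have /dvdpP[q qE] := euler_wedge_dvd fgM.
  have [q0|q0] := eqVneq q 0; first by exists 0; rewrite qE q0 mul0r scale0r.
  have : (size (f - 'X * g)%R <= n.+1)%N.
    rewrite (leq_trans (size_polyD _ _)) // size_polyN geq_max (leq_trans fn) //=.
    by rewrite (leq_trans (size_polyMleq _ _)) // size_polyX /= ltnS.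
  rewrite qE size_mul // ?monic_neq0 ?monic_prod_XsubC // -/Q sQ addnS /= => sq.
  have /size_poly1P[c _ ->] : size q == 1.
    by rewrite eqn_leq size_poly_gt0 q0 andbT -(leq_add2r n) add1n.
  by exists c; rewrite mul_polyC.
have gE : g = - c *: Q^`().
  apply/eqP; rewrite -subr_eq0; apply/eqP.
  apply: (@roots_geq_poly_eq0 _ _ (undup s)) (undup_uniq s) _; last first.
    rewrite (leq_trans (size_polyD _ _)) // size_polyN geq_max gn /=.
    rewrite (leq_trans (size_scale_leq _ _)) // -ltnS -sQ lt_size_deriv //.
    by rewrite -size_poly_eq0 sQ.
  apply/allP => t; rewrite mem_undup => ts; rewrite rootE.
  have : (f - 'X * g)^`().[t] = (c *: Q)^`().[t] by rewrite cE.
  have : (f - t *: g)^`().[t] = 0.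
    have := fgd t; rewrite (c2 t ts) => /dvdpP[q ->].
    rewrite expr2 mulrA derivM derivXsubC mulr1 hornerD !hornerM hornerXsubC.
    by rewrite subrr !mulr0 addr0.
  rewrite !derivB derivM derivX !derivZ !hornerE => fg fXg.
  rewrite mulNr opprK -fXg (_ : g.[t] + _ = f^`().[t] - t * g^`().[t]); last by ring.
  by rewrite fg.
have c0 : c = 0.
  have := congr1 (fun p : {poly F} => p`_n) cE.
  rewrite coefB coefXM coefZ (nth_default _ fn) gE coefZ coef_deriv.
  have -> : Q`_n = 1.
    have := monic_prod_XsubC (undup s) xpredT id.
    by rewrite monicE -/Q /lead_coef sQ => /eqP.
  have -> : (n == 0)%N = false by lia.
  rewrite prednK ?(ltnW n1) // -/Q.
  have -> : Q`_n = 1.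
    have := monic_prod_XsubC (undup s) xpredT id.
    by rewrite monicE -/Q /lead_coef sQ => /eqP.
  rewrite sub0r mulNr opprK mulr1 => /eqP.
  rewrite -subr_eq0 -{2}[c]mulr1 -mulrBr mulf_eq0 => /orP[/eqP //|].
  by rewrite subr_eq0 pnatr_eq1 => /eqP nE; rewrite nE in n1.
have fE : f = 'X * g by apply/eqP; rewrite -subr_eq0 cE c0 scale0r.
by rewrite fE gE c0 oppr0 scale0r mulr0.
Qed.

Lemma coprime_deriv_const (p q : {poly F}) :
  coprimep p q -> q %| p * q^`() -> q^`() = 0.
Proof.
rewrite coprimep_sym => cop; rewrite Gauss_dvdpr // => qd.
apply/eqP/negPn/negP => q0; have := dvdp_leq q0 qd.
by rewrite leqNgt lt_size_deriv //; apply: contraNneq q0 => ->; rewrite deriv0.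
Qed.

Lemma deriv_eq0_const (p : {poly F}) : p^`() = 0 -> exists c, p = c%:P.
Proof.
move=> p0; exists p`_0; apply/polyP => -[|i]; rewrite coefC //=.
have := congr1 (fun q : {poly F} => q`_i) p0; rewrite coef_deriv coef0 => /eqP.
by rewrite mulrn_eq0 /= => /eqP.
Qed.

Definition wronskian (f g : {poly F}) := f * g^`() - f^`() * g.

Lemma wronskian_eq0 f g : wronskian f g = 0 ->
  exists a b (q : {poly F}), f = a *: q /\ g = b *: q.
Proof.
have [->|f0 W0] := eqVneq f 0; first by exists 0, 1, g; rewrite scale0r scale1r.
pose h := gcdp f g; pose p := f %/ h; pose q := g %/ h.
have h0 : h != 0 by rewrite gcdp_eq0 negb_and f0.
have fE : f = p * h by rewrite divpK // dvdp_gcdl.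
have gE : g = q * h by rewrite divpK // dvdp_gcdr.
have cop : coprimep p q by rewrite coprimep_div_gcd // f0.
have pq : p * q^`() = p^`() * q.
  apply: (mulIf (mulf_neq0 h0 h0)); apply/eqP; rewrite -subr_eq0; apply/eqP.
  by rewrite -[RHS]W0 /wronskian fE gE !derivM; ring.
have [b bE] : exists b, q = b%:P.
  apply/deriv_eq0_const/(coprime_deriv_const cop).
  by rewrite pq dvdp_mull.
have [a aE] : exists a, p = a%:P.
  apply/deriv_eq0_const/(coprime_deriv_const (p := q)); first by rewrite coprimep_sym.
  by rewrite mulrC -pq dvdp_mulr.
by exists a, b, h; rewrite fE gE aE bE !mul_polyC.
Qed.

(** The leading terms cancel after subtracting from f a multiple of g, which does
    not change the Wronskian; this gains one degree over the naive bound. *)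
Lemma size_wronskian (f g : {poly F}) k : (size f <= k.+1)%N -> (size g <= k.+1)%N ->
  (size (wronskian f g) <= (2 * k).-1)%N.
Proof.
move=> fk gk.
have sd (p : {poly F}) m : (size p <= m.+1)%N -> (size p^`()%R <= m)%N.
  have [->|p0] := eqVneq p 0; first by rewrite deriv0 size_poly0.
  by move=> pm; rewrite -ltnS (leq_trans (lt_size_deriv p0)).
have aux (f' g' : {poly F}) : (size f' <= k)%N -> (size g' <= k.+1)%N -> (size (wronskian f' g') <= (2 * k).-1)%N.
  move=> fk' gk'; have gd := sd _ _ gk'.
  rewrite (leq_trans (size_polyD _ _)) // size_polyN geq_max; apply/andP; split.
    by apply: leq_trans (size_polyMleq _ _) _; rewrite -!subn1 leq_sub2r // mul2n -addnn leq_add.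
  case: k {fk gk} fk' gk' gd => [|k] fk' gk' gd.
    move: fk'; rewrite leqn0 size_poly_eq0 => /eqP ->.
    by rewrite deriv0 mul0r size_poly0.
  apply: leq_trans (size_polyMleq _ _) _.
  rewrite -!subn1 leq_sub2r // mul2n -addnn (leq_trans (leq_add (sd _ _ fk') gk')) //.
  by rewrite addnS.
have [gk0|gk0] := eqVneq g`_k 0.
  have -> : wronskian f g = - wronskian g f by rewrite /wronskian; ring.
  rewrite size_polyN; apply: aux => //; apply/leq_sizeP => i.
  by rewrite leq_eqVlt => /orP[/eqP <- //|ki]; rewrite nth_default // (leq_trans gk).
pose a := f`_k / g`_k.
have -> : wronskian f g = wronskian (f - a *: g) g.
  by rewrite /wronskian derivB derivZ -!mul_polyC; ring.
apply: aux => //; apply/leq_sizeP => i.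
rewrite leq_eqVlt coefB coefZ => /orP[/eqP <- //|ki]; last first.
  by rewrite !nth_default ?(leq_trans fk) ?(leq_trans gk) // mulr0 subrr.
by rewrite /a divfK // subrr.
Qed.

(** f is a multiple of g up to an m-fold zero at t, and differentiation lowers the
    order of a zero by one. *)
Lemma wronskian_dvd t m f g : ('X - t%:P) ^+ m %| f - t *: g ->
  ('X - t%:P) ^+ m.-1 %| wronskian f g.
Proof.
case: m => [|m]; first by move=> _; rewrite /= expr0 dvd1p.
move=> /dvdpP[q qE]; have fE : f = q * ('X - t%:P) ^+ m.+1 + t *: g by rewrite -qE subrK.
rewrite /wronskian fE derivD derivM deriv_exp derivXsubC derivZ mul1r /= -!mul_polyC.
rewrite [X in _ %| X](_ : _ = ('X - t%:P) ^+ m *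
  (q * ('X - t%:P) * g^`() - (q^`() * ('X - t%:P) + q *+ m.+1) * g)).
  exact: dvdp_mulr.
rewrite exprS -(mulr_natr (_ ^+ m)) -(mulr_natr q).
exact: wronskian_expand.
Qed.

(** With three points the exponents are as close to each other as possible,
    by the Mason--Stothers argument: the Wronskian of the two components
    vanishes to high order at each point, and has small degree. *)
Lemma exponents_three s d1 d2 v w : exponents s d1 d2 v w ->
  size (undup s) = 3%N -> (forall t, 2 * count_mem t s <= size s)%N ->
  d1 = (size s)./2.
Proof.
move=> ex n3 c2; apply/eqP; rewrite eqn_leq; apply/andP; split.
  by case: ex => d12 <- _ _ _; lia.
apply: (exponents_ge ex) => -[f g] fgM; have [/= fk gk fgd] := fgM.
have s3 : (3 <= size s)%N by rewrite -n3 size_undup.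
set k := (size s)./2 in fk gk.
have k1 : (0 < k)%N by rewrite /k; lia.
have W0 : wronskian f g = 0.
  apply/eqP/negPn/negP => W0.
  have : excess s %| wronskian f g by apply: excess_dvd => t _; apply: wronskian_dvd.
  move/(dvdp_leq W0); rewrite size_excess n3.
  have := size_wronskian (f := f) (g := g) (k := k.-1); rewrite prednK // => /(_ fk gk) sW.
  by move=> /leq_trans /(_ sW) /(three_bound s3).
have [a [b [q [fE gE]]]] := wronskian_eq0 W0.
have [/andP[/eqP a0 /eqP b0]|] := boolP ((a == 0) && (b == 0)).
  by rewrite fE gE a0 b0 !scale0r.
rewrite negb_and => ab; suff q0 : q = 0 by rewrite fE gE q0 !scaler0.
have qk : (size q <= k)%N.
  by case/orP: ab => c0; rewrite -(size_scale q c0) -?fE -?gE.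
have nz t : t != a / b -> a - t * b != 0.
  have [b0 _|b0] := eqVneq b 0.
    by move: ab; rewrite b0 eqxx orbF mulr0 subr0.
  by apply: contraNneq => /eqP; rewrite subr_eq0 => /eqP ->; rewrite mulfK.
apply: (@prod_size_eq0 _ [seq y <- s | y != a / b]).
  by rewrite size_filter_neq (leq_trans qk) // half_bound.
apply: prod_XsubC_dvd => t; rewrite count_filter_neq mem_filter.
case: eqP => //= /eqP tt _; rewrite -(dvdpZr _ _ (nz t tt)).
by rewrite scalerBl -scalerA -fE -gE.
Qed.

End CharZero.

(** * Multiplicities up to relabelling of the points *)

Section Patterns.
Local Open Scope nat_scope.

(** The four conditions of the theorem for the list of the points of the
    restricted multiarrangement, each listed as often as its multiplicity. *)
Definition tame (T : eqType) (s : seq T) : Prop :=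
  [\/ size (undup s) <= 3, forall x, count_mem x s <= 2,
      exists x, size s <= 2 * count_mem x s | size s < 2 * size (undup s)].

Lemma sum_count_undup (T : eqType) (s : seq T) :
  \sum_(x <- undup s) count_mem x s = size s.
Proof.
under eq_bigr => x _ do rewrite -sum1_count big_mkcond.
rewrite exchange_big /= big_seq -sum1_size [RHS]big_seq; apply: eq_bigr => y ys.
rewrite (bigD1_seq y) ?undup_uniq ?mem_undup //= eqxx big1 // => x.
by rewrite eq_sym => /negPf ->.
Qed.

Lemma few_heavy (T : eqType) (s : seq T) : size (undup s) <= 2 ->
  s = [::] \/ exists2 x, x \in s & size s <= 2 * count_mem x s.
Proof.
have := sum_count_undup s; have := mem_undup s.
case: (undup s) => [|x [|y []]] //= sU.
- by rewrite big_nil => /esym/size0nil -> _; left.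
- rewrite big_seq1 => <- _; right; exists x; first by rewrite -sU mem_head.
  by rewrite mul2n -addnn leq_addr.
- rewrite !big_cons big_nil addn0 => <- _; right.
  case: (leqP (count_mem x s) (count_mem y s)) => xy.
    by exists y; [rewrite -sU !inE eqxx orbT | lia].
  by exists x; [rewrite -sU mem_head | lia].
Qed.

Lemma light_many (T : eqType) (s : seq T) x : x \in s -> count_mem x s = 1 ->
  (forall y, count_mem y s <= 2) -> size s < 2 * size (undup s).
Proof.
move=> xs x1 s2; have xU : x \in undup s by rewrite mem_undup.
have -> : 2 * size (undup s) = \sum_(y <- undup s) 2.
  by rewrite big_const_seq count_predT iter_addn_0.
rewrite -(sum_count_undup s) !(bigD1_seq x xU (undup_uniq s)) /= x1 add1n add2n !ltnS.
by apply: leq_sum.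
Qed.

Variables (T A B : eqType) (s : seq T) (f : T -> A) (g : T -> B).
Hypothesis same : {in s &, forall x y, (f x == f y) = (g x == g y)}.

Lemma count_pattern x : x \in s -> count_mem (f x) (map f s) = count_mem (g x) (map g s).
Proof.
by move=> xs; rewrite !count_map; apply: eq_in_count => y ys /=; apply: same.
Qed.

Lemma size_undup_pattern : size (undup (map f s)) = size (undup (map g s)).
Proof.
elim: s same => //= x r IH sm.
have E : (f x \in map f r) = (g x \in map g r).
  have ryx y : y \in r -> (f x == f y) = (g x == g y).
    by move=> yr; rewrite sm ?mem_head // mem_behead.
  apply/mapP/mapP => -[y yr /eqP]; first by rewrite ryx // => /eqP; exists y.
  by rewrite -ryx // => /eqP; exists y.
rewrite E; have {}IH := IH (sub_in2 (mem_behead (s := x :: r)) sm).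
by case: ifP => _ //=; rewrite IH.
Qed.

Lemma tame_pattern : tame (map f s) -> tame (map g s).
Proof.
case; rewrite -1?size_undup_pattern.
- by constructor 1; rewrite -size_undup_pattern.
- move=> c2; constructor 2 => y; have [/mapP[x xs ->]|/count_memPn -> //] := boolP (y \in map g s).
  by rewrite -count_pattern.
- move=> [y]; have [/mapP[x xs ->]|/count_memPn ->] := boolP (y \in map f s).
    by rewrite count_pattern // size_map => h; constructor 3; exists (g x); rewrite size_map.
  rewrite muln0 leqn0 size_map => /eqP/size0nil ->.
  by constructor 1.
- by rewrite size_map => h; constructor 4; rewrite size_map -size_undup_pattern.
Qed.

End Patterns.

Definition heavy (T : eqType) (s : seq T) : Prop :=
  exists2 x, x \in s & (size s <= 2 * count_mem x s)%N.

(** Without a point carrying half of the multiplicity, the remaining tame cases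
    are: many points, three points, all points double. *)
Lemma exponents_light (F : numFieldType) (s : seq F) d1 d2 v w :
  exponents s d1 d2 v w -> tame s -> ~ heavy s ->
  let n := size (undup s) in
  d1 = if (size s < 2 * n)%N then minn (size s - n).+1 n.-1
       else if n == 3%N then (size s)./2 else n.
Proof.
move=> ex tm light n; case: ifP => [|many]; first exact: exponents_many ex.
have lightP t : (2 * count_mem t s <= size s)%N.
  have [ts|/count_memPn -> //] := boolP (t \in s).
  by apply: contrapT => /negP; rewrite -ltnNge => /ltnW h; apply: light; exists t.
case: eqP => [n3|n3]; first exact: exponents_three ex n3 lightP.
have nil0 : s = [::] -> d1 = n.
  by rewrite /n; case: ex => + + _ _ _; move=> + + s0; rewrite s0 /=; case: (d1).
have [n2|n2] := leqP n 2; first by case: (few_heavy n2) => [/nil0 //|/light].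
case: tm => [sn|c2|[x hx]|sn].
- by case: n3; apply/eqP; rewrite eqn_leq sn.
- apply: (exponents_double ex) => [|t ts]; first exact: ltnW.
  apply/eqP; rewrite eqn_leq c2 /=; case: leqP => // c1.
  have : (size s < 2 * n)%N; last by rewrite many.
  apply: (light_many ts) c2; apply/eqP.
  by rewrite eqn_leq -has_count has_pred1 ts andbT -ltnS.
- have [xs|/count_memPn xs] := boolP (x \in s); first by case: light; exists x.
  by move: hx; rewrite xs muln0 leqn0 => /eqP/size0nil/nil0.
- by rewrite sn in many.
Qed.

Lemma exponents_pattern (F : numFieldType) (T : eqType) (s : seq T) (f g : T -> F)
    d1 d2 v w e1 e2 x y :
  {in s &, forall x y, (f x == f y) = (g x == g y)} -> tame (map f s) ->
  exponents (map f s) d1 d2 v w -> exponents (map g s) e1 e2 x y -> d1 = e1.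
Proof.
move=> same tm exf exg.
have U := size_undup_pattern same.
have same' : {in s &, forall x y, (g x == g y) = (f x == f y)} by move=> a b /same h /h ->.
have [[t tf hv]|light] := pselect (heavy (map f s)).
  rewrite (exponents_heavy exf hv); case/mapP: tf hv => z zs -> hv.
  rewrite (count_pattern same zs) (exponents_heavy (t := g z) exg) ?size_map //.
  by move: hv; rewrite (count_pattern same zs) !size_map.
have light' : ~ heavy (map g s).
  move=> [_ /mapP[z zs ->] hv]; apply: light; exists (f z); first exact: map_f.
  by move: hv; rewrite (count_pattern same zs) !size_map.
rewrite (exponents_light exf tm light) (exponents_light exg (tame_pattern same tm) light').
by rewrite !size_map U.
Qed.

(** * Polynomial fields tangent to affine lines *)

Local Notation tsize p := (size (slope_sub p%R)).

Fact image_bound b e n l k :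
  (n <= e -> e <= l -> l <= k -> b + (e - n) <= k - (l - e) -> b <= k - l + n)%N.
Proof. by lia. Qed.

Section Affine.
Variable F : fieldType.
Implicit Types (L : seq (F * F)) (g h : F * F) (k : nat) (u v w : bipoly F * bipoly F).

(** The normal component along x = t y + c of the field f d/dx + g d/dy, that is,
    the restriction of f - t g to this line, as a polynomial in y. *)
Definition on_line h v : {poly F} := (v.1 - h.1 *: v.2).[line_root h].

(** Fields f d/dx + g d/dy of degree less than k tangent to the lines of L. *)
Definition in_aff L k v : Prop :=
  [/\ (tsize v.1 <= k)%N, (tsize v.2 <= k)%N & forall h, h \in L -> on_line h v = 0].

(** The Ziegler restriction: the part of degree k, with y set to 1. *)
Definition top k v : {poly F} * {poly F} := ((slope_sub v.1)`_k, (slope_sub v.2)`_k).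

Lemma on_line_linear h : linear (on_line h).
Proof.
move=> a u v; rewrite /on_line /=.
rewrite (_ : _ - _ = a *: (u.1 - h.1 *: u.2) + (v.1 - h.1 *: v.2)); last first.
  by rewrite scalerBr scalerDr opprD !scalerA (mulrC h.1 a) addrACA.
have H (p q : bipoly F) x : (a *: p + q).[x] = a *: p.[x] + q.[x].
  by rewrite hornerD bipoly_scaleE hornerM hornerC mul_polyC.
exact: H.
Qed.

Lemma top_linear k : linear (top k).
Proof.
move=> a u v; rewrite /top /=; congr (_, _).
  by rewrite slope_subD slope_sub_scale coefD coefCM mul_polyC.
by rewrite slope_subD slope_sub_scale coefD coefCM mul_polyC.
Qed.

Lemma in_aff_subspace L k : subspace (in_aff L k).
Proof.
split.
  split=> [||h _] /=; rewrite ?slope_sub0 ?size_poly0 //.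
  by rewrite /on_line /= bipoly_scaleE mulr0 subr0 horner0.
move=> a u v [u1 u2 uL] [v1 v2 vL]; split=> [||h hL] /=.
- rewrite slope_subD (leq_trans (size_polyD _ _)) // geq_max v1.
  by rewrite (leq_trans (size_slope_scale _ _)).
- rewrite slope_subD (leq_trans (size_polyD _ _)) // geq_max v2.
  by rewrite (leq_trans (size_slope_scale _ _)).
- by rewrite on_line_linear uL // vL // scaler0 addr0.
Qed.

Lemma in_aff_cons h L k v : in_aff (h :: L) k v <-> in_aff L k v /\ on_line h v = 0.
Proof.
split=> [[v1 v2 vL]|[[v1 v2 vL] vh]].
  by do 2?split=> //; [move=> g gL; apply: vL; rewrite mem_behead | apply: vL; rewrite mem_head].
by split=> // g; rewrite inE => /orP[/eqP -> //|]; apply: vL.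
Qed.

Lemma size_coef0 (p : {poly {poly F}}) k : (size p <= k.+1)%N -> p`_k = 0 -> (size p <= k)%N.
Proof.
move=> pk p0; apply/leq_sizeP => i; rewrite leq_eqVlt => /orP[/eqP <- //|ki].
by rewrite nth_default // (leq_trans pk).
Qed.

Lemma in_aff_top0 L k v : in_aff L k.+1 v /\ top k v = 0 <-> in_aff L k v.
Proof.
split=> [[[v1 v2 vL] [t1 t2]]|[v1 v2 vL]]; first by split=> //; apply: size_coef0.
split; first by split=> //; apply: leqW.
by rewrite /top !nth_default.
Qed.

Lemma in_aff0 L v : in_aff L 0 v <-> v = 0.
Proof.
split=> [[v1 v2 _]|->]; last by case: (in_aff_subspace L 0).
by apply: injective_projections; apply/eqP;
  rewrite -slope_sub_eq0 -size_poly_eq0 -leqn0.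
Qed.

Lemma tsize_on L k v h : in_aff L k v -> (tsize (v.1 - h.1 *: v.2) <= k)%N.
Proof.
move=> [v1 v2 _]; rewrite slope_subB (leq_trans (size_polyD _ _)) // size_polyN geq_max v1.
by rewrite (leq_trans (size_slope_scale _ _)).
Qed.

(** Ziegler's restriction: the leading form of a field tangent to the lines of
    slope t is divisible by the product of the m linear forms of slope t. *)
Lemma top_in_multi L k v : uniq L -> in_aff L k.+1 v ->
  in_multi (map fst L) k.+1 (top k v).
Proof.
move=> UL vL; split=> [||t] /=; rewrite ?size_slope_coef //.
set f := v.1 - t *: v.2.
have -> : (slope_sub v.1)`_k - t *: (slope_sub v.2)`_k = (slope_sub f)`_k.
  by rewrite slope_subB slope_sub_scale coefB coefCM mul_polyC.
have fk : (tsize f <= k.+1)%N by apply: (@tsize_on _ _ _ (t, 0)) vL.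
have [->|fk0] := eqVneq (slope_sub f)`_k 0; first by rewrite dvdp0.
have sf : tsize f = k.+1.
  apply/eqP; rewrite eqn_leq fk ltnNge; apply: contra fk0 => sf.
  by rewrite nth_default.
have [q fE] : exists q : bipoly F, f = q * \prod_(h <- [seq h <- L | h.1 == t]) line_poly h.
  apply: line_poly_rootM; first by rewrite filter_uniq.
  move=> h; rewrite mem_filter => /andP[/eqP ht hL].
  by case: vL => _ _ /(_ h hL); rewrite /on_line ht.
have -> : (slope_sub f)`_k = lead_coef (slope_sub f) by rewrite /lead_coef sf.
rewrite fE slope_subM lead_coefM (slope_prod_lines _).2 big_filter.
rewrite (eq_bigr (fun=> 'X - t%:P)) => [|h /eqP -> //].
by rewrite big_const_seq iter_mulr_1 count_map dvdp_mull.
Qed.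

(** The form of degree k whose value at y = 1 is p. *)
Definition lift_top k (p : {poly F}) : bipoly F :=
  \poly_(i < k.+1) (p`_i *: 'X^(k - i)).

Lemma coef_lift_top k (p : {poly F}) l : (size p <= k.+1)%N ->
  (slope_sub (lift_top k p))`_l = if l == k then p else 0.
Proof.
move=> pk; apply/polyP => i; rewrite coef_slope_sub coef_poly (fun_if (fun r : {poly F} => r`_i)) coef0.
rewrite (fun_if (fun r : {poly F} => r`_(l - i))) coef0 coefZ coefXn.
case: (ltnP i k.+1) => ik; last first.
  by rewrite [p`_i]nth_default ?(leq_trans pk) // !if_same.
case: (leqP i l) => il; last first.
  by case: eqP => // lk; move: il ik; rewrite lk ltnS ltnNge => /negPf ->.
rewrite (eqn_sub2rE _ _) //.
by case: eqP => _; rewrite ?mulr1 ?mulr0.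
Qed.

Lemma size_lift_top k (p : {poly F}) : (size p <= k.+1)%N -> (tsize (lift_top k p) <= k.+1)%N.
Proof.
move=> pk; apply/leq_sizeP => l kl; rewrite coef_lift_top //.
by case: eqP kl => // ->; rewrite ltnn.
Qed.

Lemma top_in_aff_nil k (u : {poly F} * {poly F}) :
  (exists2 v, in_aff [::] k.+1 v & top k v = u) <-> (size u.1 <= k.+1)%N /\ (size u.2 <= k.+1)%N.
Proof.
split=> [[v _ <-]|[u1 u2]]; first by split; apply: size_slope_coef.
exists (lift_top k u.1, lift_top k u.2); first by split=> //; apply: size_lift_top.
by rewrite /top /= !coef_lift_top // eqxx; case: (u).
Qed.

Lemma dim_aff_succ L k d r : has_dim (in_aff L k) d ->
  has_dim (fun u : {poly F} * {poly F} => exists2 v, in_aff L k.+1 v & top k v = u) r ->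
  has_dim (in_aff L k.+1) (d + r).
Proof.
move=> dP rP; apply: rank_nullity (top_linear k) (in_aff_subspace L k.+1) _ rP.
by apply: has_dim_ext dP => v; apply: iff_sym; apply: in_aff_top0.
Qed.

Lemma dim_aff_nil_succ k d : has_dim (in_aff [::] k) d ->
  has_dim (in_aff [::] k.+1) (d + (k.+1 + k.+1)).
Proof.
move=> dP; apply: dim_aff_succ dP _.
apply: has_dim_ext (has_dim_pair_poly F k.+1) => u.
by apply: iff_sym; apply: top_in_aff_nil.
Qed.

Lemma in_aff_finite L k : exists d, has_dim (in_aff L k) d.
Proof.
have [d dP] : exists d, has_dim (in_aff [::] k) d.
  elim: k => [|k [d dP]]; first by exists 0%N; apply: has_dim0; apply: in_aff0.
  by exists (d + (k.+1 + k.+1))%N; apply: dim_aff_nil_succ.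
by apply: has_dim_sub (in_aff_subspace L k) _ dP => v [].
Qed.

(** The ordinates of the points where the lines of L that are not parallel to h
    meet h, with repetitions. *)
Definition meeting_points h L : seq F :=
  [seq (g.2 - h.2) / (h.1 - g.1) | g <- L & g.1 != h.1].

Lemma line_root_sub h g : (line_poly g).[line_root h] = (h.1 - g.1) *: 'X + (h.2 - g.2)%:P.
Proof.
rewrite /line_poly hornerXsubC /line_root polyCB scalerBl opprD.
by rewrite addrACA.
Qed.

Lemma restrict_lines h L : h \notin L ->
  exists2 c, c != 0 & (\prod_(g <- L) line_poly g).[line_root h] =
                      c *: \prod_(y <- meeting_points h L) ('X - y%:P).
Proof.
elim: L => [|g L IH]; first by exists 1; rewrite ?oner_neq0 // !big_nil hornerC scale1r.
rewrite inE negb_or => /andP[hg /IH[c c0 cE]].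
rewrite big_cons hornerM cE line_root_sub /meeting_points /=.
case: (eqVneq g.1 h.1) => [gh|gh] /=.
  exists ((h.2 - g.2) * c); last by rewrite gh subrr scale0r add0r mul_polyC scalerA.
  rewrite mulf_neq0 // subr_eq0; apply: contraNneq hg => h2.
  by case: h g gh h2 {IH cE} => [? ?] [? ?] /= -> ->.
exists ((h.1 - g.1) * c); first by rewrite mulf_neq0 // subr_eq0 eq_sym.
rewrite big_cons -scalerAr [_ * c]mulrC -scalerA; congr (c *: _).
rewrite scalerAl; congr (_ * _).
rewrite scalerBr; congr (_ + _); rewrite -mul_polyC -polyCM -polyCN; congr (_%:P).
by field; rewrite subr_eq0 eq_sym.
Qed.

Lemma meeting_points_filter h L (p : pred (F * F)) :
  meeting_points h [seq g <- L | p g] =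
  [seq (g.2 - h.2) / (h.1 - g.1) | g <- L & (g.1 != h.1) && p g].
Proof. by rewrite /meeting_points -filter_predI. Qed.

(** f - t g is divisible by the equations of the lines of L parallel to h, which
    are constant along h. *)
Lemma size_restrict_tangent L k v h : uniq L -> h \notin L -> in_aff L k v ->
  (size (on_line h v) <= k - (size L - size (meeting_points h L)))%N.
Proof.
move=> UL hL vL.
have [q qE] : exists q : bipoly F, v.1 - h.1 *: v.2 =
    q * \prod_(g <- [seq g <- L | g.1 == h.1]) line_poly g.
  apply: line_poly_rootM; first by rewrite filter_uniq.
  move=> g; rewrite mem_filter => /andP[/eqP gh gL].
  by case: vL => _ _ /(_ g gL); rewrite /on_line gh.
have [q0|q0] := eqVneq q 0; first by rewrite /on_line qE q0 mul0r horner0 size_poly0.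
have hL' : h \notin [seq g <- L | g.1 == h.1] by rewrite mem_filter (negPf hL) andbF.
have [c c0 cE] := restrict_lines hL'.
have pts0 : meeting_points h [seq g <- L | g.1 == h.1] = [::].
  by rewrite meeting_points_filter (eq_filter (a2 := pred0)) ?filter_pred0 // => g /=; case: eqP.
rewrite /on_line qE hornerM cE pts0 big_nil -[c *: 1]/(c%:A) alg_polyC mulrC mul_polyC.
rewrite size_scale //; apply: leq_trans (size_restrict q h) _.
have := tsize_on h vL; rewrite qE size_slope_mul_lines //.
rewrite /meeting_points size_map !size_filter -(count_predC (fun g => g.1 != h.1) L) addKn.
rewrite (eq_count (a2 := predC (fun g : F * F => g.1 != h.1))); last by move=> g /=; rewrite negbK.
by move=> H; rewrite -[X in (X <= _)%N](addnK (count (predC (fun g : F * F => g.1 != h.1)) L)) leq_sub2r.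
Qed.

(** Wedging with the Euler field centred at a point of the line h turns
    tangency to the r lines through that point into divisibility by all their
    equations; the Euler field itself contributes a simple zero along h. *)
Lemma restrict_tangent_dvd L k v h : uniq L -> h \notin L -> in_aff L k v ->
  excess (meeting_points h L) %| on_line h v.
Proof.
move=> UL hL [_ _ vL]; apply: excess_dvd => y yp.
pose through g := (g.2 - h.2) / (h.1 - g.1) == y.
pose Ly := [seq g <- L | (g.1 != h.1) && through g].
pose x := h.1 * y + h.2.
pose psi : bipoly F := ('X - y%:P)%:P * v.1 - ('X - x%:P%:P) * v.2.
have psiE g : g.1 * y + g.2 = x -> psi.[line_root g] = ('X - y%:P) * on_line g v.
  move=> gy; rewrite /psi /on_line bipoly_scaleE !(hornerD, hornerN, hornerM, hornerC, hornerX).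
  rewrite mulrBr; congr (_ - _); rewrite mulrA; congr (_ * _).
  rewrite /line_root -gy polyCD polyCM -!mul_polyC; ring.
have [q qE] : exists q : bipoly F, psi = q * \prod_(g <- Ly) line_poly g.
  apply: line_poly_rootM; first by rewrite filter_uniq.
  move=> g; rewrite mem_filter => /andP[/andP[gh /eqP gy] gL].
  rewrite psiE ?vL ?mulr0 // -gy /x -gy; field.
  by rewrite subr_eq0 eq_sym.
have hLy : h \notin Ly by rewrite mem_filter (negPf hL) andbF.
have [c c0 cE] := restrict_lines hLy.
have ptsE : meeting_points h Ly = nseq (count_mem y (meeting_points h L)) y.
  rewrite /Ly meeting_points_filter /meeting_points.
  elim: (L) => //= g r IH; rewrite andbA andbb.
  case: (g.1 == h.1) => //=; rewrite /through.
  by case: eqP => [gy|_] //=; rewrite IH gy.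
have := psiE h erefl; rewrite qE hornerM cE ptsE big_nseq iter_mulr_1.
move: yp; rewrite -has_pred1 has_count => /prednK <- /=; rewrite exprS.
rewrite -scalerAr mulrCA scalerAr.
move/(mulfI _)=> <-; last by rewrite polyXsubC_eq0.
by rewrite -mul_polyC !dvdp_mull.
Qed.

(** The Lagrange polynomials of n points generate, in degree N, all
    polynomials of degree n - 1 + N. *)
Lemma lagrange_span (E : seq F) N (b : {poly F}) : uniq E -> E != [::] ->
  (size b <= N + size E)%N ->
  exists a : F -> {poly F}, (forall y, size (a y) <= N.+1)%N /\
    b = \sum_(y <- E) a y * \prod_(z <- E | z != y) ('X - z%:P).
Proof.
elim: E b => // y E IH b /= /andP[yE UE] _ sb.
have [E1|E0] := eqVneq E [::].
  rewrite E1 in sb *; exists (fun=> b); split; first by rewrite -addn1.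
  by rewrite big_seq1 big_cons eqxx /= big_nil mulr1.
pose P := \prod_(z <- E) ('X - z%:P).
have P0 : P.[y] != 0.
  rewrite horner_prod prodf_seq_neq0; apply/allP => z zE /=.
  by rewrite hornerXsubC subr_eq0; apply: contraNneq yE => ->.
pose c := b.[y] / P.[y].
have /factor_theorem[b' bE] : root (b - c *: P) y.
  by rewrite rootE !hornerE divfK // subrr.
have sb' : (size b' <= N + size E)%N.
  have [->|b'0] := eqVneq b' 0; first by rewrite size_poly0.
  rewrite -ltnS; have <- : size (b' * ('X - y%:P)) = (size b').+1.
    by rewrite size_mul ?polyXsubC_eq0 // size_XsubC addn2.
  rewrite -bE (leq_trans (size_polyD _ _)) // size_polyN geq_max -addnS sb.
  by rewrite (leq_trans (size_scale_leq _ _)) // size_prod_XsubC leq_addl.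
have [a [sa b'E]] := IH b' UE E0 sb'.
exists (fun z => if z == y then c%:P else a z); split.
  by move=> z; case: eqP => // _; rewrite size_polyC; case: (c != 0).
rewrite big_cons eqxx big_cons eqxx /= (_ : \prod_(z <- E | z != y) _ = P); last first.
  rewrite big_seq_cond /P [RHS]big_seq; apply: eq_bigl => z.
  by case: eqP => [->|] /=; rewrite ?andbF ?andbT // (negPf yE).
rewrite mul_polyC -[LHS](subrK (c *: P)) addrC; congr (_ + _).
rewrite bE b'E mulr_suml big_seq [RHS]big_seq; apply: eq_bigr => z zE.
have zy : z != y by apply: contraNneq yE => <-.
by rewrite (negPf zy) big_cons eq_sym zy -mulrA [X in _ * X]mulrC.
Qed.

Lemma excess_undup (E : seq F) y : y \in E ->
  \prod_(z <- E) ('X - z%:P) =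
  ('X - y%:P) * (excess E * \prod_(z <- undup E | z != y) ('X - z%:P)).
Proof.
move=> yE; rewrite -prod_undup_excess (bigD1_seq y) ?mem_undup ?undup_uniq //=.
by rewrite -mulrA; congr (_ * _); rewrite mulrC.
Qed.

Lemma tangent_mul L (a : {poly F}) k : (size a + size L <= k)%N ->
  (tsize (a%:P * \prod_(g <- L) line_poly g) <= k)%N.
Proof.
move=> ak; apply: leq_trans (size_slopeM _ _) _.
by rewrite size_slopeC (slope_prod_lines _).1 addnS.
Qed.

(** The necessary conditions [restrict_tangent_dvd] and [size_restrict_tangent]
    are sufficient. Let g be a line of L meeting h at y. The product of the
    lines of L other than g, times the constant field along g, is tangent to L.
    Its normal component along h is, up to a scalar, the excess times the
    Lagrange polynomial vanishing at the meeting points other than y; now apply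
    [lagrange_span]. *)
Lemma restrict_image L k h p : uniq L -> h \notin L -> (size L <= k)%N ->
  (exists2 v, in_aff L k v & on_line h v = p) <->
  (exists2 b : {poly F}, (size b <= k - size L + size (undup (meeting_points h L)))%N
    & excess (meeting_points h L) * b = p).
Proof.
move=> UL hL Lk; set E := meeting_points h L.
have EL : (size E <= size L)%N by rewrite size_map size_filter count_size.
have UE : (size (undup E) <= size E)%N by apply: size_undup.
split=> [[v vL <-]|[b sb <-]].
  have := size_restrict_tangent UL hL vL; rewrite -/E.
  have /dvdpP[b ->] := restrict_tangent_dvd UL hL vL; rewrite -/E => sv.
  exists b; last exact: mulrC.
  have [->|b0] := eqVneq b 0; first by rewrite size_poly0.
  move: sv; rewrite size_mul // ?(monic_neq0 (monic_excess _)) // size_excess addnS /=.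
  exact: image_bound UE EL Lk.
have sI := image_subspace (on_line_linear h) (in_aff_subspace L k).
have [E0|E0] := eqVneq (undup E) [::].
  have [c c0 cE] := restrict_lines hL.
  have {}E0 : E = [::] by case: (E) E0 => // y r /(congr1 (fun s => y \in s)); rewrite mem_undup mem_head.
  exists ((c^-1 *: b)%:P * \prod_(g <- L) line_poly g, 0).
    split=> [||g gL] /=.
    - apply: tangent_mul; rewrite size_scale ?invr_eq0 //.
      by move: sb; rewrite E0 /= addn0 leq_subRL // addnC.
    - by rewrite slope_sub0 size_poly0.
    rewrite /on_line /= bipoly_scaleE mulr0 subr0 hornerM (big_rem g) //= hornerM.
    by rewrite /line_poly hornerXsubC subrr mul0r mulr0.
  rewrite /on_line /= bipoly_scaleE mulr0 subr0 hornerM hornerC cE -/E E0 /excess !big_nil.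
  by rewrite mul1r -scalerAl -scalerAr mulr1 scalerA mulVf // scale1r.
have [a [sa ->]] := lagrange_span (undup_uniq E) E0 sb.
rewrite mulr_sumr big_seq; apply: subspace_sum sI _ => y; rewrite mem_undup => yE.
have /mapP[g] := yE; rewrite mem_filter => /andP[gh gL] yg.
have hg : h.1 - g.1 != 0 by rewrite subr_eq0 eq_sym.
pose w : bipoly F := \prod_(g' <- rem g L) line_poly g'.
have [c c0 cE] := restrict_lines hL.
have wE : ((h.1 - g.1) *: w.[line_root h] =
    c *: (excess E * \prod_(z <- undup E | z != y) ('X - z%:P))).
  apply: (mulfI (x := 'X - y%:P)); first by rewrite polyXsubC_eq0.
  rewrite -[RHS]scalerAr -(excess_undup yE) -cE (big_rem g) //= hornerM -scalerAr scalerAl.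
  congr (_ * _); rewrite line_root_sub scalerBr; congr (_ + _).
  by rewrite -mul_polyC -polyCM -polyCN yg; congr (_%:P); field.
pose r := (- c^-1) *: a y.
pose rw : bipoly F := r%:P * w.
exists (g.1 *: rw, rw); rewrite /on_line /in_aff /=.
  have sr : (tsize rw <= k)%N.
    apply: tangent_mul; rewrite size_rem // (leq_trans (leq_add (size_scale_leq _ _) (leqnn _))) //.
    rewrite (leq_trans (leq_add (sa y) (leqnn _))) //.
    by case: (L) gL Lk => //= ? ? _; lia.
  split=> [||g' gL'] //=; first by rewrite (leq_trans (size_slope_scale _ _)).
  rewrite /on_line /= -scalerBl bipoly_scaleE /rw !hornerM !hornerC.
  have [->|gg] := eqVneq g' g; first by rewrite subrr polyC0 mul0r.
  have g'r : g' \in rem g L by rewrite mem_rem_uniq // inE gg.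
  by rewrite /w (big_rem g') //= hornerM /line_poly hornerXsubC subrr mul0r !mulr0.
rewrite -scalerBl bipoly_scaleE /rw !hornerM !hornerC /r.
move: wE; rewrite -!mul_polyC => wE.
rewrite [LHS](_ : _ = (c^-1)%:P * a y * ((h.1 - g.1)%:P * w.[line_root h])).
  by rewrite wE mulrACA -polyCM mulVf // mul1r mulrCA.
by rewrite !polyCB polyCN; ring.
Qed.

End Affine.

(** * Dimension counts and transfer of surjectivity *)

Section Dimensions.
Variable F : fieldType.
Implicit Types (L : seq (F * F)) (g h : F * F) (k : nat) (v w : bipoly F * bipoly F)
  (u : {poly F} * {poly F}).

Definition npoints h L : nat := size (undup (meeting_points h L)).

Lemma restrict_dim h L k : uniq L -> h \notin L -> (size L <= k)%N ->
  has_dim (fun p => exists2 v, in_aff L k v & on_line h v = p) (k - size L + npoints h L).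
Proof.
move=> UL hL Lk.
pose f (b : {poly F}) := excess (meeting_points h L) * b.
have lf : linear f by move=> a b c; rewrite /f mulrDr scalerAr.
apply: has_dim_ext (has_dim_image lf _ (has_dim_poly F _)) => [p|b _].
  exact: iff_sym (restrict_image _ UL hL Lk).
by move/eqP; rewrite mulf_eq0 (negPf (monic_neq0 (monic_excess _))) => /eqP.
Qed.

Lemma dim_aff_cons h L k d : uniq L -> h \notin L -> (size L <= k)%N ->
  has_dim (in_aff (h :: L) k) d -> has_dim (in_aff L k) (d + (k - size L + npoints h L)).
Proof.
move=> UL hL Lk dP.
apply: rank_nullity (on_line_linear h) (in_aff_subspace L k) _ (restrict_dim UL hL Lk).
by apply: has_dim_ext dP => v; apply: in_aff_cons.
Qed.

(** Rank and nullity for the restriction to each line in turn: fields tangent to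
    one more line are the kernel of a map whose image has known dimension. *)
Lemma dim_aff_pattern (T : eqType) (s : seq T) (a b : T -> F * F) k d :
  uniq (map a s) -> uniq (map b s) -> (size s <= k)%N ->
  (forall x r, suffix (x :: r) s -> npoints (a x) (map a r) = npoints (b x) (map b r)) ->
  has_dim (in_aff (map a s) k) d -> has_dim (in_aff (map b s) k) d.
Proof.
elim: s d => //= x s IH d /andP[axs Ua] /andP[bxs Ub] sk E dP.
have {}IH d' : has_dim (in_aff (map a s) k) d' -> has_dim (in_aff (map b s) k) d'.
  apply: IH => //; first exact: ltnW.
  by move=> y r /suffixP[t sE]; apply: E; apply/suffixP; exists (x :: t); rewrite sE.
have [e eP] := in_aff_finite (map b (x :: s)) k.
have sa : (size (map a s) <= k)%N by rewrite size_map ltnW.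
have sb : (size (map b s) <= k)%N by rewrite size_map ltnW.
have := has_dim_uniq (IH _ (dim_aff_cons Ua axs sa dP)) (dim_aff_cons Ub bxs sb eP).
rewrite !size_map (E x s) ?suffix_refl //.
by move/eqP; rewrite eqn_add2r => /eqP ->.
Qed.

(** Both sides change by the same amount when a line is added, and without lines
    the difference of the dimensions is 2 (k + 1). *)
Lemma dim_aff_large L k d e : uniq L -> (size L <= k)%N ->
  has_dim (in_aff L k) d -> has_dim (in_aff L k.+1) e ->
  (e + size L = d + (k.+1 + k.+1))%N.
Proof.
elim: L d e => [|h L IH] d e /=.
  by move=> _ _ dP eP; rewrite addn0 (has_dim_uniq eP (dim_aff_nil_succ dP)).
move=> /andP[hL UL] Lk dP eP.
have := IH _ _ UL (ltnW Lk) (dim_aff_cons UL hL (ltnW Lk) dP)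
  (dim_aff_cons UL hL (leqW (ltnW Lk)) eP).
by move: (npoints h L) => n; move: (size L) Lk => l; clear; lia.
Qed.

Definition top_surjective L k : Prop :=
  forall u, in_multi (map fst L) k.+1 u -> exists2 v, in_aff L k.+1 v & top k v = u.

Lemma top_image_dim L k d e : uniq L ->
  has_dim (in_aff L k) d -> has_dim (in_multi (map fst L) k.+1) e ->
  exists2 r, has_dim (in_aff L k.+1) (d + r) &
    (r <= e)%N /\ (r = e <-> top_surjective L k).
Proof.
move=> UL dP eP.
have sub u : (exists2 v, in_aff L k.+1 v & top k v = u) -> in_multi (map fst L) k.+1 u.
  by move=> [v vL <-]; apply: top_in_multi.
have sI := image_subspace (top_linear k) (in_aff_subspace L k.+1).
have [r rP] := has_dim_sub sI sub eP.
exists r; first exact: dim_aff_succ dP rP.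
have [re eqP] := has_dim_incl sub rP eP; split=> //; split=> [|surj]; first exact: eqP.
apply: (has_dim_uniq rP); apply: has_dim_ext eP => u; split; first exact: surj.
exact: sub.
Qed.

(** By [dim_aff_large] the image of [top] has dimension 2 (k + 1) - |L|, which is
    the dimension of the target as soon as k + 1 is at least both exponents. *)
Lemma top_surjective_large L k : uniq L -> (size L <= k)%N -> top_surjective L k.
Proof.
move=> UL Lk.
have [d1 [d2 [v [w ex]]]] := exponents_exist (map fst L).
have [d dP] := in_aff_finite L k.
have eP := exponents_dim k.+1 ex.
have [r rP [_ <-]] := top_image_dim UL dP eP.
have := dim_aff_large UL Lk dP rP.
case: ex => d12; rewrite size_map => dE _ _ _.
by move: dE Lk d12; move: (size L) => l; clear; lia.
Qed.

(** The space of fields is filtered by the degree, with graded pieces the images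
    of [top]. *)
Lemma dim_aff_sum L (m : nat -> nat) k : uniq L ->
  (forall k, has_dim (in_multi (map fst L) k.+1) (m k)) ->
  exists2 d, has_dim (in_aff L k) d & (d <= \sum_(i < k) m i)%N /\
    (d = \sum_(i < k) m i <-> forall i, (i < k)%N -> top_surjective L i).
Proof.
move=> UL mP; elim: k => [|k [d dP [dm IH]]].
  exists 0%N; first by apply: has_dim0; apply: in_aff0.
  by rewrite big_ord0; split=> //; split.
have [r rP [re rE]] := top_image_dim UL dP (mP k).
exists (d + r)%N => //; rewrite big_ord_recr /=; split; first exact: leq_add.
split=> [E i|surj].
  have [dE rmE] : d = \sum_(i < k) m i /\ r = m k.
    by move: E re dm; move: (\sum_(i < k) _) => S; lia.
  by rewrite ltnS leq_eqVlt => /orP[/eqP ->|]; [exact: rE.1 | exact: IH.1].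
rewrite (rE.2 (surj k (ltnSn k))) IH.2 // => i ik.
by apply: surj; apply: ltnW.
Qed.

End Dimensions.

(** For K large the spaces of tangent fields of degree less than K have the same
    dimension for a and b, and the targets of [top] agree in every degree.
    Surjectivity for a makes the bound of [dim_aff_sum] an equality, hence an
    equality for b as well. *)
Lemma top_surjective_pattern (F : numFieldType) (T : eqType) (s : seq T) (a b : T -> F * F) :
  uniq (map a s) -> uniq (map b s) ->
  (forall x r, suffix (x :: r) s -> npoints (a x) (map a r) = npoints (b x) (map b r)) ->
  {in s &, forall x y, ((a x).1 == (a y).1) = ((b x).1 == (b y).1)} ->
  tame (map (fst \o a) s) ->
  (forall k, top_surjective (map a s) k) -> forall k, top_surjective (map b s) k.
Proof.
move=> Ua Ub E same tm surj k.
have [d1 [d2 [v [w exa]]]] := exponents_exist (map (fst \o a) s).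
have [e1 [e2 [x [y exb]]]] := exponents_exist (map (fst \o b) s).
have de1 := exponents_pattern same tm exa exb.
have de2 : d2 = e2.
  case: exa exb => _ + _ _ _ [_ + _ _ _]; rewrite !size_map de1 => <- /eqP.
  by rewrite eqn_add2l => /eqP.
pose m i := ((i.+1 - d1) + (i.+1 - d2))%N.
have ma i : has_dim (in_multi (map fst (map a s)) i.+1) (m i).
  by rewrite -map_comp; apply: exponents_dim exa.
have mb i : has_dim (in_multi (map fst (map b s)) i.+1) (m i).
  by rewrite -map_comp /m de1 de2; apply: exponents_dim exb.
pose K := maxn (size s) k.+1.
have [d dP [_ dE]] := dim_aff_sum K Ua ma.
have [e eP [_ eE]] := dim_aff_sum K Ub mb.
apply: (eE.1 _ k); last by rewrite /K leq_maxr.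
rewrite -(dE.2 (fun i _ => surj i)); apply: has_dim_uniq eP _.
by apply: dim_aff_pattern dP => //; rewrite leq_maxl.
Qed.

(** * Homogeneous coordinates and restriction to the line at infinity *)

Lemma mpoly_alg_ind n (R : comNzRingType) (P : {mpoly R[n]} -> Prop) :
  (forall c, P c%:MP) -> (forall i, P 'X_i) ->
  (forall p q, P p -> P q -> P (p + q)) -> (forall p q, P p -> P q -> P (p * q)) ->
  forall p, P p.
Proof.
move=> PC PX PD PM; have P1 : P 1 by rewrite -mpolyC1.
have PXm (m : 'X_{1..n}) : P 'X_[m].
  rewrite mpolyXE_id; apply: (big_ind P) => // i _.
  by elim: (m i) => [|k IH]; rewrite ?expr0 // exprS; apply: PM.
elim/mpolyind; first by rewrite -mpolyC0.
move=> c m p _ _ Pp; apply: PD => //; rewrite -mul_mpolyC; exact: PM.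
Qed.

Fact lift_term (R : comNzRingType) (c x y : R) i j l :
  c%:P * (((x%:P * 'X) ^+ i * (y%:P * 'X) ^+ j) * 'X ^+ l) =
  (c * (x ^+ i * y ^+ j))%:P * 'X^(i + j + l).
Proof.
rewrite !exprMn !polyCM -!polyC_exp !exprD -!mulrA; congr (_ * (_ * _)).
by rewrite mulrCA; congr (_ * _); rewrite mulrCA.
Qed.

Section Coordinates.
Variables (F : fieldType) (E : 'M[F]_3).
Hypothesis Eunit : E \in unitmx.

Local Notation S := {mpoly F[3]}.
Local Notation T := {poly {poly {poly F}}}.

(** The linear forms dual to the rows e0, e1, e2 of E; they are called x, y, z
    below. *)
Definition coord (a : 'I_3) : S := \sum_i invmx E i a *: 'X_i.

(** The coordinates on the chart z = 1. *)
Definition affine_coord (a : 'I_3) : {poly {poly F}} :=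
  if a == ord0 then 'X else if a == ord_max then 1 else 'X%:P.

Definition rees_const : {rmorphism F -> T} := polyC \o polyC \o polyC.

Definition rees_var (i : 'I_3) : T :=
  (\sum_a (E a i)%:P%:P * affine_coord a)%:P * 'X.

(** f |-> f (s (x e0 + y e1 + e2)), with values in F[y][x][s]: the coefficient of
    s^k is the homogeneous component of degree k of f, dehomogenized at z = 1.
    This identifies S with the Rees algebra of the filtration of F[x, y] by
    total degree ([rees_in], [rees_surj], [rees_inj]). *)
Definition rees : S -> T := mmap rees_const rees_var.

HB.instance Definition _ := GRing.RMorphism.on rees.

Lemma reesM f g : rees (f * g) = rees f * rees g.
Proof. exact: (rmorphM rees). Qed.

Lemma reesD f g : rees (f + g) = rees f + rees g.
Proof. exact: (rmorphD rees). Qed.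

Lemma reesB f g : rees (f - g) = rees f - rees g.
Proof. exact: (rmorphB rees). Qed.

Lemma rees0 : rees 0 = 0.
Proof. exact: (rmorph0 rees). Qed.

Lemma rees_sum (I : Type) (r : seq I) (p : pred I) (f : I -> S) :
  rees (\sum_(i <- r | p i) f i) = \sum_(i <- r | p i) rees (f i).
Proof. exact: (rmorph_sum rees). Qed.

Lemma reesX_n f n : rees (f ^+ n) = rees f ^+ n.
Proof. exact: (rmorphXn rees). Qed.

Lemma rees_scale c f : rees (c *: f) = c%:P%:P%:P * rees f.
Proof. by rewrite /rees mmapZ. Qed.

Lemma reesC c : rees c%:MP = c%:P%:P%:P.
Proof. by rewrite /rees mmapC. Qed.

Lemma reesX i : rees 'X_i = rees_var i.
Proof. by rewrite /rees mmapX mmap1U. Qed.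

Lemma rees_coord a : rees (coord a) = (affine_coord a)%:P * 'X.
Proof.
rewrite /coord rees_sum.
under eq_bigr => i _ do rewrite rees_scale reesX /rees_var mulrA -polyCM mulr_sumr.
rewrite -mulr_suml -rmorph_sum /= exchange_big /=; congr (_%:P * _).
under eq_bigr => b _ do under eq_bigr => i _ do rewrite mulrA -!polyCM mulrC.
under eq_bigr => b _.
  rewrite -mulr_sumr -!rmorph_sum /=.
  under eq_bigr => i _ do rewrite mulrC.
  rewrite (_ : \sum_i _ = (E *m invmx E) b a); last by rewrite mxE.
  rewrite mulmxV // mxE.
over.
rewrite (bigD1 a) //= eqxx mulr1 big1 ?addr0 // => b /negPf ->.
by rewrite mulr0.
Qed.

Lemma rees_coord0 : rees (coord ord0) = 'X%:P * 'X.
Proof. by rewrite rees_coord. Qed.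

Lemma rees_coord1 : rees (coord 1) = 'X%:P%:P * 'X.
Proof. by rewrite rees_coord. Qed.

Lemma rees_coord2 : rees (coord ord_max) = 'X.
Proof. by rewrite rees_coord polyC1 mul1r. Qed.

Lemma coordK i : 'X_i = \sum_a E a i *: coord a.
Proof.
rewrite /coord; under eq_bigr => a _ do rewrite scaler_sumr.
rewrite exchange_big /= (bigD1 i) //= -[LHS]addr0; congr (_ + _).
  under eq_bigr => a _ do rewrite scalerA mulrC.
  rewrite -scaler_suml (_ : \sum_a _ = (invmx E *m E) i i); last by rewrite mxE.
  by rewrite mulVmx // mxE eqxx scale1r.
rewrite big1 // => j ji; under eq_bigr => a _ do rewrite scalerA mulrC.
rewrite -scaler_suml (_ : \sum_a _ = (invmx E *m E) j i); last by rewrite mxE.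
by rewrite mulVmx // mxE (negPf ji) scale0r.
Qed.

Lemma coord_alg_ind (P : S -> Prop) :
  (forall c, P c%:MP) -> (forall a, P (coord a)) ->
  (forall p q, P p -> P q -> P (p + q)) -> (forall p q, P p -> P q -> P (p * q)) ->
  forall p, P p.
Proof.
move=> PC Pc PD PM; apply: mpoly_alg_ind => // i.
rewrite coordK; apply: (big_ind P) => // [|a _]; first by rewrite -mpolyC0.
by rewrite -mul_mpolyC; apply: PM.
Qed.

(** The coefficient of s^k has total degree at most k. *)
Definition in_rees (P : T) : Prop := forall k, (tsize (P`_k) <= k.+1)%N.

Lemma in_rees_sub (P Q : T) : in_rees P -> in_rees Q -> in_rees (P + Q).
Proof.
move=> RP RQ k; rewrite coefD slope_subD (leq_trans (size_polyD _ _)) // geq_max.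
by rewrite RP RQ.
Qed.

Lemma tsize_sum (I : Type) (r : seq I) (p : pred I) (f : I -> bipoly F) k :
  (forall i, p i -> (tsize (f i) <= k)%N) -> (tsize (\sum_(i <- r | p i) f i) <= k)%N.
Proof.
move=> fk; apply: (big_ind (fun q : bipoly F => (tsize q <= k)%N)) => //.
  by rewrite slope_sub0 size_poly0.
by move=> q1 q2 h1 h2; rewrite slope_subD (leq_trans (size_polyD _ _)) // geq_max h1.
Qed.

Lemma in_rees_mul (P Q : T) : in_rees P -> in_rees Q -> in_rees (P * Q).
Proof.
move=> RP RQ k; rewrite coefM; apply: tsize_sum => i _.
apply: leq_trans (size_slopeM _ _) _.
have ik : (i <= k)%N by rewrite -ltnS.
rewrite -subn1 leq_subLR (leq_trans (leq_add (RP i) (RQ (k - i)%N))) //.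
by rewrite addSn addnS subnKC.
Qed.

Lemma tsize_const (c : F) : (tsize (c%:P%:P) <= 1)%N.
Proof. by rewrite size_slopeC size_polyC; case: (c != 0). Qed.

Lemma tsize_affine a : (tsize (affine_coord a) <= 2)%N.
Proof.
rewrite /affine_coord; case: ifP => _; last case: ifP => _.
- by rewrite slope_subX mul_polyC (leq_trans (size_scale_leq _ _)) // size_polyX.
- by rewrite slope_sub1 size_poly1.
- by rewrite size_slopeC size_polyX.
Qed.

Lemma rees_in f : in_rees (rees f).
Proof.
move: f; apply: coord_alg_ind => [c|a|p q|p q].
- rewrite reesC => -[|k]; rewrite coefC /= ?tsize_const //.
  by rewrite slope_sub0 size_poly0.
- rewrite rees_coord => -[|[|k]]; rewrite coefMX coefC /= ?slope_sub0 ?size_poly0 //.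
  exact: tsize_affine.
- by rewrite reesD; apply: in_rees_sub.
- by rewrite reesM; apply: in_rees_mul.
Qed.

Lemma bipoly_expand (p : bipoly F) k : (tsize p <= k.+1)%N ->
  p = \sum_(i < k.+1) \sum_(j < k.+1 - i) (p`_i`_j)%:P%:P * ('X ^+ i * 'X%:P ^+ j).
Proof.
move=> pk; have c0 i j : (k < i + j)%N -> p`_i`_j = 0.
  move=> kij; have := congr1 (fun q : {poly F} => q`_i) (nth_default 0 (leq_trans pk kij)).
  by rewrite coef_slope_sub leq_addr addKn coef0.
rewrite [LHS](_ : p = \poly_(i < k.+1) p`_i).
  rewrite poly_def; apply: eq_bigr => i _.
  rewrite -[LHS]mul_polyC; under eq_bigr => j _ do rewrite mulrCA -polyC_exp -polyCM mulrC.
  rewrite -mulr_suml -rmorph_sum /=; congr (_%:P * _).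
  rewrite [LHS](_ : p`_i = \poly_(j < k.+1 - i) p`_i`_j).
    by rewrite poly_def; apply: eq_bigr => j _; rewrite mul_polyC.
  apply/polyP => j; rewrite coef_poly; case: ltnP => // ij.
  by apply: c0; rewrite -ltnS -addSn -leq_subLR.
apply/polyP => i; rewrite coef_poly; case: ltnP => // ki.
by apply/polyP => j; rewrite coef0 c0 // (leq_trans ki) // leq_addr.
Qed.

(** The homogenization in degree k. *)
Definition homog_lift k (p : bipoly F) : S :=
  \sum_(i < k.+1) \sum_(j < k.+1 - i) (p`_i`_j) *:
     (coord ord0 ^+ i * coord 1 ^+ j * coord ord_max ^+ (k - i - j)).

Lemma rees_lift k (p : bipoly F) : (tsize p <= k.+1)%N ->
  rees (homog_lift k p) = p%:P * 'X^k.
Proof.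
move=> pk; rewrite {2}(bipoly_expand pk) rees_sum rmorph_sum mulr_suml /=.
apply: eq_bigr => i _; rewrite rees_sum rmorph_sum mulr_suml /=; apply: eq_bigr => j _.
have kE : k = (i + j + (k - i - j))%N by move: (ltn_ord i) (ltn_ord j); clear; lia.
rewrite rees_scale !reesM !reesX_n rees_coord0 rees_coord1 rees_coord2.
rewrite [in 'X^k]kE; exact: lift_term.
Qed.

Lemma rees_surj (P : T) : in_rees P -> exists f, rees f = P.
Proof.
move=> RP; exists (\sum_(k < size P) homog_lift k P`_k).
rewrite rees_sum -[RHS]coefK poly_def /=; apply: eq_bigr => k _.
by rewrite rees_lift // mul_polyC.
Qed.

Local Notation FS := {fraction S}.
Local Notation tofrac_S := (@tofrac S).

Definition unrees_const : {rmorphism F -> FS} := tofrac_S \o @mpolyC 3 F.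
Definition unrees1 : {rmorphism {poly F} -> FS} :=
  horner_eval (tofrac_S (coord 1) / tofrac_S (coord ord_max)) \o map_poly unrees_const.
Definition unrees2 : {rmorphism {poly {poly F}} -> FS} :=
  horner_eval (tofrac_S (coord ord0) / tofrac_S (coord ord_max)) \o map_poly unrees1.
(** Homogenization as a map into the fraction field, s |-> z, x |-> x / z and
    y |-> y / z; it is a left inverse of [rees]. *)
Definition unrees : {rmorphism T -> FS} :=
  horner_eval (tofrac_S (coord ord_max)) \o map_poly unrees2.

Lemma coord_neq0 a : coord a != 0.
Proof.
apply/eqP => /(congr1 rees); rewrite rees_coord rees0 => /eqP.
rewrite mulf_eq0 polyX_eq0 orbF polyC_eq0 /affine_coord.
by case: ifP => _; last case: ifP => _; rewrite ?polyX_eq0 ?oner_eq0 // polyC_eq0 polyX_eq0.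
Qed.

Lemma unrees_rees f : unrees (rees f) = tofrac_S f.
Proof.
have unreesC (q : {poly {poly F}}) : unrees q%:P = unrees2 q.
  by rewrite /unrees /= map_polyC /horner_eval hornerC.
have unrees2C (q : {poly F}) : unrees2 q%:P = unrees1 q.
  by rewrite /unrees2 /= map_polyC /horner_eval hornerC.
have unrees1C c : unrees1 c%:P = unrees_const c.
  by rewrite /unrees1 /= map_polyC /horner_eval hornerC.
have unreesX : unrees 'X = tofrac_S (coord ord_max).
  by rewrite /unrees /= map_polyX /horner_eval hornerX.
have unrees2X : unrees2 'X = tofrac_S (coord ord0) / tofrac_S (coord ord_max).
  by rewrite /unrees2 /= map_polyX /horner_eval hornerX.
have unrees1X : unrees1 'X = tofrac_S (coord 1) / tofrac_S (coord ord_max).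
  by rewrite /unrees1 /= map_polyX /horner_eval hornerX.
have z0 : tofrac_S (coord ord_max) != 0 by rewrite tofrac_eq0 coord_neq0.
move: f; apply: coord_alg_ind => [c|a|p q pE qE|p q pE qE].
- by rewrite reesC unreesC unrees2C unrees1C.
- rewrite rees_coord (rmorphM unrees) unreesC unreesX /affine_coord.
  have [->|a0] := eqVneq a ord0; first by rewrite unrees2X divfK.
  have [->|a2] := eqVneq a ord_max; first by rewrite rmorph1 mul1r.
  rewrite unrees2C unrees1X divfK //; congr (tofrac_S (coord _)).
  by apply/val_inj; case: a a0 a2 => [[|[|[|]]]].
- by rewrite reesD (rmorphD unrees) pE qE (rmorphD tofrac_S).
- by rewrite reesM (rmorphM unrees) pE qE (rmorphM tofrac_S).
Qed.

Lemma rees_inj : injective rees.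
Proof.
move=> f g fg; apply/eqP; rewrite -subr_eq0 -tofrac_eq0 -unrees_rees.
by rewrite reesB fg subrr (rmorph0 unrees).
Qed.

Lemma rees_eq0 f : (rees f == 0) = (f == 0).
Proof. by rewrite -(inj_eq rees_inj) rees0. Qed.

(** f |-> f (s (t e0 + e1)), with values in F[t][s]: the restriction to the line
    z = 0. *)
Definition at_infinity (f : S) : {poly {poly F}} :=
  locked (\poly_(k < size (rees f)) (slope_sub (rees f)`_k)`_k).

Lemma coef_at_infinity f k : (at_infinity f)`_k = (slope_sub (rees f)`_k)`_k.
Proof.
rewrite /at_infinity -lock coef_poly; case: ltnP => // fk.
by rewrite [(rees f)`_k]nth_default // slope_sub0 coef0.
Qed.

Lemma coefM_top (p q : {poly {poly F}}) a b : (size p <= a.+1)%N -> (size q <= b.+1)%N ->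
  (p * q)`_(a + b) = p`_a * q`_b.
Proof.
move=> pa qb; rewrite coefM (bigD1 (inord a)) //= inordK ?ltnS ?leq_addr // addKn.
rewrite big1 ?addr0 // => i; rewrite -val_eqE /= inordK ?ltnS ?leq_addr // => ia.
have [ai|ai] := leqP a i; last by rewrite [q`__]nth_default ?mulr0 // (leq_trans qb) // ltn_subRL ltn_add2r.
by rewrite [p`__]nth_default ?mul0r // (leq_trans pa) // ltn_neqAle eq_sym ia.
Qed.

Lemma slope_sub_sum (I : Type) (r : seq I) (p : pred I) (f : I -> bipoly F) :
  slope_sub (\sum_(i <- r | p i) f i) = \sum_(i <- r | p i) slope_sub (f i).
Proof. exact: (big_morph _ (@slope_subD F) (slope_sub0 F)). Qed.

Lemma at_infinityM f g : at_infinity (f * g) = at_infinity f * at_infinity g.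
Proof.
apply/polyP => k; rewrite coef_at_infinity reesM coefM slope_sub_sum coef_sum coefM.
apply: eq_bigr => i _.
rewrite slope_subM.
have ik : (i <= k)%N by rewrite -ltnS.
have := coefM_top (rees_in f i) (rees_in g (k - i)%N); rewrite subnKC // => ->.
by congr (_ * _); symmetry; apply: coef_at_infinity.
Qed.

Lemma at_infinityD f g : at_infinity (f + g) = at_infinity f + at_infinity g.
Proof.
apply/polyP => k; rewrite [LHS]coef_at_infinity reesD coefD slope_subD [RHS]coefD coefD.
by congr (_ + _); symmetry; apply: coef_at_infinity.
Qed.

Lemma at_infinity0 : at_infinity 0 = 0.
Proof. by apply/polyP => k; rewrite coef_at_infinity rees0 !coef0 slope_sub0 coef0. Qed.

Lemma at_infinity_sum (I : Type) (r : seq I) (p : pred I) (f : I -> S) :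
  at_infinity (\sum_(i <- r | p i) f i) = \sum_(i <- r | p i) at_infinity (f i).
Proof. exact: (big_morph _ at_infinityD at_infinity0). Qed.

Lemma at_infinity_lift k (p : bipoly F) : (tsize p <= k.+1)%N ->
  at_infinity (homog_lift k p) = ((slope_sub p)`_k)%:P * 'X^k.
Proof.
move=> pk; apply/polyP => l; rewrite coef_at_infinity rees_lift // coefCM coefXn.
rewrite coefCM coefXn; case: eqP => [->|_]; first by rewrite !mulr1.
by rewrite !mulr0 slope_sub0 coef0.
Qed.

Lemma at_infinity_coord a : at_infinity (coord a) =
  if a == ord0 then 'X%:P * 'X else if a == ord_max then 0 else 'X.
Proof.
apply/polyP => k; rewrite coef_at_infinity rees_coord coefMX coefC.
case: k => [|[|k]] /=; rewrite ?slope_sub0 ?coef0.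
- by case: ifP => _; last case: ifP => _; rewrite ?coefMX ?coefX ?coef0.
- rewrite /affine_coord; case: ifP => _; last case: ifP => _.
  + by rewrite slope_subX.
  + by rewrite slope_sub1 coefC coef0.
  + by rewrite slope_subC map_polyX.
- by case: ifP => _; last case: ifP => _; rewrite ?coefMX ?coefX ?coefC ?coef0.
Qed.

Lemma size_at_infinity f k : (size ((at_infinity f)`_k)%R <= k.+1)%N.
Proof. by rewrite coef_at_infinity size_slope_coef. Qed.

Lemma at_infinity_surj (P : {poly {poly F}}) :
  (forall k, (size (P`_k)%R <= k.+1)%N) -> exists f, at_infinity f = P.
Proof.
move=> RP; exists (\sum_(k < size P) homog_lift k (lift_top k P`_k)).
rewrite at_infinity_sum -[RHS]coefK poly_def; apply: eq_bigr => k _.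
rewrite at_infinity_lift; last exact: size_lift_top.
by rewrite coef_lift_top // eqxx mul_polyC.
Qed.

End Coordinates.

(** * Tangent derivations and affine fields *)

Fact comb_linear_form (R : comRingType) (c x y z x' y' z' a b : R) :
  c * x + x' - a * (c * y + y') - b * (c * z + z') =
  c * (x - a * y - b * z) + (x' - a * y' - b * z').
Proof. by ring. Qed.

Fact residue_linear_form (R : comRingType) (w x y z tx ty a b : R) :
  tx - w * x - a * (ty - w * y) =
  tx - a * ty - b * (z * w) - (x - a * y - b * z) * w.
Proof. by ring. Qed.

Fact line_product (R : comNzRingType) (x y a b : R) :
  x%:P * 'X - a%:P * (y%:P * 'X) - b%:P * 'X = (x - (a * y + b))%:P * 'X.
Proof. by rewrite polyCB polyCD polyCM; ring. Qed.

Fact shift_product (R : comNzRingType) (a b : R) d : (0 < d)%N ->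
  (a * b)%:P * 'X^d = b%:P * 'X * (a%:P * 'X^(d.-1)).
Proof. by case: d => // d _; rewrite mulrACA -exprS -polyCM [b * a]mulrC. Qed.

Section Derivations.
Variables (F : fieldType) (E : 'M[F]_3).
Hypothesis Eunit : E \in unitmx.

Local Notation S := {mpoly F[3]}.
Local Notation T := {poly {poly {poly F}}}.
Local Notation crd := (coord E).
Local Notation hx := (coord E ord0).
Local Notation hy := (coord E 1).
Local Notation hz := (coord E ord_max).
Local Notation rees := (rees E).
Implicit Types (L : seq (F * F)) (theta eta : S -> S).

Lemma derivationD theta f g : is_derivation theta -> theta (f + g) = theta f + theta g.
Proof. by move=> [lin _]; rewrite -[f]scale1r lin !scale1r. Qed.

Lemma derivation0 theta : is_derivation theta -> theta 0 = 0.
Proof.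
by move=> dt; apply: (addrI (theta 0)); rewrite -(derivationD _ _ dt) !addr0.
Qed.

Lemma derivationZ theta c f : is_derivation theta -> theta (c *: f) = c *: theta f.
Proof. by move=> dt; rewrite -[c *: f]addr0 dt.1 (derivation0 dt) addr0. Qed.

Lemma derivationB theta f g : is_derivation theta -> theta (f - g) = theta f - theta g.
Proof.
by move=> dt; rewrite -scaleN1r (derivationD _ _ dt) (derivationZ _ _ dt) scaleN1r.
Qed.

Lemma derivationC theta c : is_derivation theta -> theta c%:MP = 0.
Proof.
move=> dt; have d1 : theta 1 = 0.
  apply: (addrI (theta 1)); rewrite addr0 -{3}[1]mulr1 dt.2 mulr1 mul1r //.
by rewrite -[c%:MP]mulr1 mul_mpolyC (derivationZ _ _ dt) d1 scaler0.
Qed.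

Lemma derivation_eq theta eta : is_derivation theta -> is_derivation eta ->
  (forall a, theta (crd a) = eta (crd a)) -> forall f, theta f = eta f.
Proof.
move=> dt de te; apply: (coord_alg_ind Eunit) => [c|//|p q pE qE|p q pE qE].
- by rewrite !derivationC.
- by rewrite (derivationD _ _ dt) (derivationD _ _ de) pE qE.
- by rewrite dt.2 de.2 pE qE.
Qed.

Lemma derivation_comb (c : S) theta eta : is_derivation theta -> is_derivation eta ->
  is_derivation (fun f => c * theta f + eta f).
Proof.
move=> [tl tM] [el eM]; split=> [a u v|f g].
  by rewrite tl el scalerDr mulrDr -scalerAr addrACA.
by rewrite tM eM !mulrDr !mulrDl; ring.
Qed.

Lemma mderivU i j : ('X_j : S)^`M(i) = (i == j)%:R.
Proof.
rewrite mderivX mnm1E eq_sym; case: eqP => [<-|_]; last by rewrite scale0r.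
have -> : (U_(i) - U_(i))%MM = 0%MM :> 'X_{1..3}; last by rewrite scale1r mpolyX0.
by apply/mnmP => k; rewrite mnmBE subnn mnm0E.
Qed.

(** The derivations d/dx, d/dy and d/dz in the coordinates of E. *)
Definition dual_derivation (a : 'I_3) (f : S) : S := \sum_i E a i *: f^`M(i).

Lemma dual_coord a b : dual_derivation a (crd b) = (a == b)%:R.
Proof.
rewrite /dual_derivation /coord.
have dE i : (\sum_j invmx E j b *: 'X_j : S)^`M(i) = (invmx E i b)%:MP.
  rewrite linear_sum /=; under eq_bigr => j _ do rewrite mderivZ mderivU.
  rewrite (bigD1 i) //= eqxx big1 ?addr0; first by rewrite -mul_mpolyC mulr1.
  by move=> j; rewrite eq_sym => /negPf ->; rewrite scaler0.
under eq_bigr => i _ do rewrite dE -mul_mpolyC -mpolyCM.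
rewrite -raddf_sum /= (_ : \sum_i _ = (E *m invmx E) a b); last by rewrite mxE.
by rewrite mulmxV // mxE mpolyC_nat.
Qed.

Definition der (w : 'I_3 -> S) (f : S) : S := \sum_a w a * dual_derivation a f.

Lemma der_derivation w : is_derivation (der w).
Proof.
split=> [c f g|f g]; rewrite /der /dual_derivation.
  rewrite scaler_sumr -big_split; apply: eq_bigr => a _ /=.
  rewrite scalerAr -mulrDr scaler_sumr -big_split; congr (_ * _).
  apply: eq_bigr => i _ /=.
  by rewrite mderivD mderivZ scalerDr !scalerA mulrC.
rewrite mulr_suml mulr_sumr -big_split; apply: eq_bigr => a _ /=.
rewrite -mulrA [f * (_ * _)]mulrCA -mulrDr; congr (_ * _).
rewrite mulr_suml mulr_sumr -big_split /=.
by apply: eq_bigr => i _ /=; rewrite mderivM scalerDr scalerAl scalerAr.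
Qed.

Lemma der_coord w a : der w (crd a) = w a.
Proof.
rewrite /der (bigD1 a) //= dual_coord eqxx mulr1 big1 ?addr0 // => b ba.
by rewrite dual_coord (negPf ba) mulr0.
Qed.

Lemma I3_case (P : 'I_3 -> Prop) : P ord0 -> P 1 -> P ord_max -> forall a, P a.
Proof.
move=> P0 P1 P2 [[|[|[|m]]] lm] //.
- by rewrite (_ : Ordinal lm = ord0) //; apply/val_inj.
- by rewrite (_ : Ordinal lm = 1) //; apply/val_inj.
- by rewrite (_ : Ordinal lm = ord_max) //; apply/val_inj.
Qed.

Definition line_form (h : F * F) : S := hx - h.1 *: hy - h.2 *: hz.

Lemma rees_line h : rees (line_form h) = (line_poly h)%:P * 'X.
Proof.
rewrite /line_form !reesB !rees_scale rees_coord0 // rees_coord1 // rees_coord2 //.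
rewrite line_product /line_poly /line_root -mul_polyC; congr (('X - _)%:P * _).
by rewrite polyCD polyCM.
Qed.

(** Derivations tangent to z = 0 and to the lines x = t y + c z for (t, c) in L. *)
Definition in_DL L theta : Prop :=
  [/\ is_derivation theta, exists w, theta hz = hz * w
    & forall h, h \in L -> exists q,
        theta hx - h.1 *: theta hy - h.2 *: theta hz = line_form h * q].

Lemma in_DL_comb L (c : S) theta eta : in_DL L theta -> in_DL L eta ->
  in_DL L (fun f => c * theta f + eta f).
Proof.
move=> [dt [w tw] tL] [de [v ev] eL]; split; first exact: derivation_comb.
  by exists (c * w + v); rewrite tw ev; ring.
move=> h hL; have [q qE] := tL h hL; have [r rE] := eL h hL.
exists (c * q + r); rewrite mulrDr mulrCA -qE -rE -!mul_mpolyC.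
exact: comb_linear_form.
Qed.

Lemma in_DL0 L : in_DL L (fun=> 0).
Proof.
split; first by split=> [a u v|f g]; rewrite ?scaler0 ?mul0r ?mulr0 addr0.
  by exists 0; rewrite mulr0.
by move=> h _; exists 0; rewrite !scaler0 !subr0 mulr0.
Qed.

Lemma in_DL_sum L (I : Type) (r : seq I) (c : I -> S) (b : I -> S -> S) :
  (forall i, in_DL L (b i)) -> in_DL L (fun f => \sum_(i <- r) c i * b i f).
Proof.
move=> bL; elim: r => [|i r IH].
  by under eq_fun => f do rewrite big_nil; apply: in_DL0.
by under eq_fun => f do rewrite big_cons; apply: in_DL_comb.
Qed.

(** If theta z = z w, then theta - w times the Euler field kills z; the residue is
    the component of degree k of this field on the chart z = 1. *)
Definition residue theta (w : S) (k : nat) : bipoly F * bipoly F :=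
  ((rees (theta hx - w * hx))`_k, (rees (theta hy - w * hy))`_k).

Lemma residue_in_aff L theta w k : in_DL L theta -> theta hz = hz * w ->
  in_aff L k.+1 (residue theta w k).
Proof.
move=> [dt _ tL] tw; split=> [||h hL]; [exact: rees_in | exact: rees_in |].
have [q qE] := tL h hL.
have fE : theta hx - w * hx - h.1 *: (theta hy - w * hy) = line_form h * (q - w).
  rewrite mulrBr -qE tw /line_form -!mul_mpolyC.
  exact: residue_linear_form.
rewrite /on_line /= bipoly_scaleE -coefCM -rees_scale -coefB -reesB fE.
rewrite reesM rees_line -mulrA coefCM.
by rewrite hornerM /line_poly hornerXsubC subrr mul0r.
Qed.

(** The field homogenized in degree d, with value 0 on z. *)
Definition homog_field d (v : bipoly F * bipoly F) : S -> S :=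
  der (fun a => if a == ord0 then homog_lift E d v.1
                else if a == ord_max then 0 else homog_lift E d v.2).

Lemma homog_field_x d v : homog_field d v hx = homog_lift E d v.1.
Proof. by rewrite /homog_field der_coord. Qed.

Lemma homog_field_y d v : homog_field d v hy = homog_lift E d v.2.
Proof. by rewrite /homog_field der_coord. Qed.

Lemma homog_field_z d v : homog_field d v hz = 0.
Proof. by rewrite /homog_field der_coord. Qed.

Lemma homog_field_in L d v : in_aff L d.+1 v -> in_DL L (homog_field d v).
Proof.
move=> vL; have [v1 v2 _] := vL; split; first exact: der_derivation.
  by exists 0; rewrite homog_field_z mulr0.
move=> h hL; rewrite homog_field_x homog_field_y homog_field_z scaler0 subr0.
have /factor_theorem[q qE] : root (v.1 - h.1 *: v.2) (line_root h).
  by apply/eqP; case: vL => _ _ /(_ h hL).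
have reesE : rees (homog_lift E d v.1 - h.1 *: homog_lift E d v.2) =
    (q * line_poly h)%:P * 'X^d.
  rewrite reesB rees_scale !rees_lift // mulrA -mulrBl -polyCM -polyCB.
  by rewrite -qE bipoly_scaleE.
have [q0|q0] := eqVneq q 0.
  exists 0; apply: (rees_inj Eunit).
  by rewrite reesE q0 mul0r mul0r mulr0 rees0.
have sq : (tsize q < d.+1)%N.
  have := tsize_on h vL; rewrite qE slope_subM size_mul ?slope_sub_eq0 ?polyXsubC_eq0 //.
  by rewrite -/(line_poly h) size_slope_line addn2.
have d0 : (0 < d)%N.
  rewrite -ltnS (leq_ltn_trans _ sq) // size_poly_gt0.
  by rewrite slope_sub_eq0.
exists (homog_lift E d.-1 q); apply: (rees_inj Eunit).
rewrite reesE reesM rees_line rees_lift //; last by rewrite prednK.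
exact: shift_product.
Qed.

Definition euler : S -> S := der crd.

Lemma euler_in L : in_DL L euler.
Proof.
split; first exact: der_derivation.
  by exists 1; rewrite /euler der_coord mulr1.
by move=> h _; exists 1; rewrite /euler !der_coord mulr1.
Qed.

Definition free_DL L : Prop :=
  exists (I : Type) (b : I -> S -> S),
    [/\ forall i, in_DL L (b i),
        forall theta, in_DL L theta ->
          exists (n : nat) (s : 'I_n -> I) (c : 'I_n -> S),
            forall f, theta f = \sum_(j < n) c j * b (s j) f
      & forall (n : nat) (s : 'I_n -> I) (c : 'I_n -> S), injective s ->
          (forall f, \sum_(j < n) c j * b (s j) f = 0) ->
          forall j, c j = 0].

End Derivations.

(** * Freeness implies surjectivity of the Ziegler restriction *)

Fact cancel_shift_X (R : idomainType) (c : R) (a b : {poly R}) N :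
  'X ^+ N * a = (c%:P * 'X) ^+ N * b -> a = (c ^+ N)%:P * b.
Proof.
move=> E; have XN0 : ('X^N : {poly R}) != 0 by rewrite monic_neq0 // monicXn.
by apply: (mulfI XN0); rewrite E exprMn -polyC_exp -mulrA mulrCA.
Qed.

Fact size_shift_coef (R : idomainType) (p q : {poly {poly R}}) N m :
  p = ('X^N)%:P * q -> q`_m != 0 -> size (p`_m) = (size ((q`_m)%R) + N)%N.
Proof. by move=> -> q0; rewrite coefCM mulrC size_mulXn // addnC. Qed.

Fact lift_relation (R : comNzRingType) (x y a b : R) k N : (0 < k + N)%N ->
  (y%:P * 'X) ^+ N * (a%:P * 'X^k) - (x%:P * 'X) ^+ N * (b%:P * 'X^k) =
  'X * ((y ^+ N * a - x ^+ N * b)%:P * 'X^((k + N).-1)).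
Proof.
move=> kN; rewrite [RHS]mulrCA -[in RHS]exprS prednK // !exprMn addnC exprD.
by rewrite polyCB !polyCM mulrBl !rmorphXn /=; congr (_ - _); rewrite mulrACA.
Qed.

Section FiniteSupport.
Variables (R : comNzRingType) (X : Type) (I : Type) (b : I -> X -> R).

(** A combination of members of a family with arbitrary indices is rewritten over
    a common list of distinct indices. *)
Lemma gather n (s : 'I_n -> I) (c : 'I_n -> R) (r : seq {classic I}) :
  uniq r -> (forall j, (s j : {classic I}) \in r) ->
  exists C : I -> R, forall f,
    \sum_(j < n) c j * b (s j) f = \sum_(i <- r) C i * b i f.
Proof.
move=> Ur sr; exists (fun i => \sum_(j | (s j : {classic I}) == i) c j) => f.
under [RHS]eq_bigr => i _ do rewrite mulr_suml big_mkcond.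
rewrite exchange_big /=; apply: eq_bigr => j _.
rewrite (bigD1_seq (s j : {classic I})) //= eqxx big1 ?addr0 // => i.
by rewrite eq_sym => /negPf ->.
Qed.

Lemma independent_seq (r : seq {classic I}) (C : I -> R) :
  (forall (n : nat) (s : 'I_n -> I) (c : 'I_n -> R), injective s ->
          (forall f, \sum_(j < n) c j * b (s j) f = 0) -> forall j, c j = 0) ->
  uniq r -> (forall f, \sum_(i <- r) C i * b i f = 0) ->
  forall i, i \in r -> C i = 0.
Proof.
move=> ind Ur C0 i ir.
pose s (j : 'I_(size r)) : I := nth i r j.
have sI : injective s.
  move=> j k sjk; apply/val_inj/eqP.
  by rewrite -(nth_uniq i (ltn_ord j) (ltn_ord k) Ur); apply/eqP.
have ji : (index i r < size r)%N by rewrite index_mem.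
have : C (s (Ordinal ji)) = 0; last by rewrite /s /= nth_index.
apply: (ind _ s (fun j => C (s j)) sI) => f.
by rewrite -[RHS](C0 f) (big_nth i) big_mkord.
Qed.

End FiniteSupport.

Section Freeness.
Variables (F : fieldType) (E : 'M[F]_3).
Hypothesis Eunit : E \in unitmx.

Local Notation S := {mpoly F[3]}.
Local Notation T := {poly {poly {poly F}}}.
Local Notation crd := (coord E).
Local Notation hx := (coord E ord0).
Local Notation hy := (coord E 1).
Local Notation hz := (coord E ord_max).
Local Notation rees := (rees E).
Local Notation inf := (at_infinity E).
Implicit Types (L : seq (F * F)) (theta eta : S -> S).

Lemma inf_x : inf hx = 'X%:P * 'X.
Proof. by rewrite at_infinity_coord. Qed.
Lemma inf_y : inf hy = 'X.
Proof. by rewrite at_infinity_coord. Qed.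
Lemma inf_z : inf hz = 0.
Proof. by rewrite at_infinity_coord. Qed.

Lemma inf_modz (f g : S) : inf (f + hz * g) = inf f.
Proof.
rewrite at_infinityD.
have -> : inf (hz * g) = 0 by rewrite (at_infinityM Eunit) inf_z mul0r.
exact: addr0.
Qed.

Lemma inf_shiftM (c u p : S) N :
  inf c = 'X^N * inf u -> inf (c * p) = 'X^N * inf (u * p).
Proof.
move=> H.
rewrite (at_infinityM Eunit c p).
rewrite (at_infinityM Eunit u p).
rewrite H.
exact/esym/mulrA.
Qed.

Lemma inf_X (f : S) n : inf (f ^+ n) = inf f ^+ n.
Proof.
elim: n => [|n IH]; last by rewrite !exprS at_infinityM // IH.
apply/polyP => k; rewrite coef_at_infinity !expr0 -mpolyC1 reesC coefC.
case: k => [|k] /=; rewrite ?slope_sub0 ?coef0 ?coefC //.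
by rewrite slope_sub1 coefC.
Qed.

(** On z = 0 the forms x^N and y^N are coprime, so y^N divides c' there. With y
    set to 1 this reads as a drop of degree: x^N times the component of degree
    m of c' has degree at most m, by [size_at_infinity]. *)
Lemma shift_at_infinity N (c c' : S) :
  inf (hy ^+ N * c) = inf (hx ^+ N * c') -> exists u, inf c' = 'X^N * inf u.
Proof.
rewrite (at_infinityM Eunit) (at_infinityM Eunit) (inf_X hy) (inf_X hx) inf_x inf_y.
move=> cE0; have cE : inf c = ('X^N)%:P * inf c'.
  exact: cancel_shift_X cE0.
have size_c' m : (inf c')`_m != 0 -> (size ((inf c')`_m)%R + N <= m.+1)%N.
  by move=> c0; rewrite -(size_shift_coef cE c0) size_at_infinity.
have small m : (m < N)%N -> (inf c')`_m = 0.
  move=> mN; apply/eqP/negPn/negP => c0; have := size_c' m c0.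
  by have := c0; rewrite -size_poly_gt0; move: (size _) => z; lia.
have RP k : (size ((drop_poly N (inf c'))`_k)%R <= k.+1)%N.
  rewrite coef_drop_poly; have [->|c0] := eqVneq ((inf c')`_(k + N)) 0.
    by rewrite size_poly0.
  by have := size_c' _ c0; rewrite -addSn leq_add2r.
have [u uE] := at_infinity_surj Eunit RP.
exists u; rewrite uE; apply/polyP => m; rewrite coefXnM coef_drop_poly.
by case: ltnP => [/small //|Nm]; rewrite subnK.
Qed.

Definition vmul (a : bipoly F) (v : bipoly F * bipoly F) : bipoly F * bipoly F :=
  (a * v.1, a * v.2).

(** At infinity x^N becomes t^N and y^N becomes 1. *)
Lemma top_shift_x N k (v : bipoly F * bipoly F) L : in_aff L k.+1 v ->
  in_aff L (k + N).+1 (vmul ('X ^+ N) v) /\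
  top (k + N) (vmul ('X ^+ N) v) = ('X^N * (top k v).1, 'X^N * (top k v).2).
Proof.
move=> [v1 v2 vL]; have kX (p : bipoly F) : slope_sub ('X ^+ N * p) = ('X^N)%:P * (slope_sub p * 'X^N).
  elim: N => [|N IH]; first by rewrite !expr0 !mul1r mulr1.
  by rewrite exprS -mulrA slope_subM slope_subX IH !exprS polyCM; ring.
have sX (p : bipoly F) : (tsize p <= k.+1)%N -> (tsize ('X ^+ N * p) <= (k + N).+1)%N.
  move=> pk; rewrite kX mul_polyC (leq_trans (size_scale_leq _ _)) //.
  have [->|p0] := eqVneq (slope_sub p) 0; first by rewrite mul0r size_poly0.
  by rewrite size_mulXn // addnC -addSn leq_add2r.
split; first split=> [||h hL] /=; try exact: sX.
  rewrite /on_line /= bipoly_scaleE mulrCA -mulrBr hornerM.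
  by have := vL h hL; rewrite /on_line bipoly_scaleE => ->; rewrite mulr0.
by rewrite /top /= !kX !coefCM !coefMXn ltnNge leq_addl /= addnK.
Qed.

Lemma top_shift_y N k (v : bipoly F * bipoly F) L : in_aff L k.+1 v ->
  in_aff L (k + N).+1 (vmul ('X%:P ^+ N) v) /\
  top (k + N) (vmul ('X%:P ^+ N) v) = top k v.
Proof.
move=> [v1 v2 vL]; have kX (p : bipoly F) : slope_sub ('X%:P ^+ N * p) = slope_sub p * 'X^N.
  elim: N => [|N IH]; first by rewrite !expr0 mul1r mulr1.
  by rewrite exprS -mulrA slope_subM slope_subC map_polyX IH !exprS; ring.
have sX (p : bipoly F) : (tsize p <= k.+1)%N -> (tsize ('X%:P ^+ N * p) <= (k + N).+1)%N.
  move=> pk; rewrite kX.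
  have [->|p0] := eqVneq (slope_sub p) 0; first by rewrite mul0r size_poly0.
  by rewrite size_mulXn // addnC -addSn leq_add2r.
split; first split=> [||h hL] /=; try exact: sX.
  rewrite /on_line /= bipoly_scaleE mulrCA -mulrBr hornerM.
  by have := vL h hL; rewrite /on_line bipoly_scaleE => ->; rewrite mulr0.
by rewrite /top /= !kX !coefMXn ltnNge leq_addl /= addnK.
Qed.

Lemma in_multi_shift (s : seq F) N k u : in_multi s k.+1 u ->
  in_multi s (k + N).+1 ('X^N * u.1, 'X^N * u.2).
Proof.
move=> [u1 u2 ud].
have sX (p : {poly F}) : (size p <= k.+1)%N -> (size ('X^N * p)%R <= (k + N).+1)%N.
  move=> pk; have [->|p0] := eqVneq p 0; first by rewrite mulr0 size_poly0.
  by rewrite mulrC size_mulXn // addnC -addSn leq_add2r.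
split=> [||t] /=; try exact: sX.
by rewrite scalerAr -mulrBr dvdp_mull.
Qed.

(** If y^N times the leading form of v equals x^N times that of v', the difference
    y^N v - x^N v' has smaller degree; homogenized in degree k + N it is
    divisible by z. *)
Lemma shift_relation N k (v v' : bipoly F * bipoly F) L :
  in_aff L k.+1 v -> in_aff L k.+1 v' -> (0 < k + N)%N ->
  in_aff L (k + N).-1.+1 (vmul ('X%:P ^+ N) v - vmul ('X ^+ N) v') ->
  forall f, hy ^+ N * homog_field E k v f - hx ^+ N * homog_field E k v' f
    = hz * homog_field E (k + N).-1 (vmul ('X%:P ^+ N) v - vmul ('X ^+ N) v') f.
Proof.
move=> [v1 v2 _] [v'1 v'2 _] kN [z1 z2 _] f; set z := _ - _ in z1 z2 *.
have d0 : is_derivation (fun=> 0 : S) by have [] := in_DL0 (F := F) E [::].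
have dH w d : is_derivation (homog_field E d w) := der_derivation _ _.
have dl := derivation_comb (hy ^+ N) (dH v k) (derivation_comb (- hx ^+ N) (dH v' k) d0).
have dr := derivation_comb hz (dH z (k + N).-1) d0.
have lift_eq (p p' : bipoly F) : (tsize p <= k.+1)%N -> (tsize p' <= k.+1)%N ->
    (tsize ('X%:P ^+ N * p - 'X ^+ N * p') <= (k + N).-1.+1)%N ->
    hy ^+ N * homog_lift E k p + ((- hx ^+ N) * homog_lift E k p' + 0) =
    hz * homog_lift E (k + N).-1 ('X%:P ^+ N * p - 'X ^+ N * p') + 0.
  move=> sp sp' sz; rewrite !addr0 mulNr; apply: (rees_inj Eunit).
  rewrite reesB !reesM !reesX_n !rees_lift // rees_coord0 // rees_coord1 // rees_coord2 //.
  exact: lift_relation.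
have E3 : forall a, hy ^+ N * homog_field E k v (crd a) +
    ((- hx ^+ N) * homog_field E k v' (crd a) + 0) =
    hz * homog_field E (k + N).-1 z (crd a) + 0.
  apply: I3_case; first by rewrite !homog_field_x //; apply: lift_eq.
    by rewrite !homog_field_y //; apply: lift_eq.
  by rewrite !homog_field_z // !mulr0 !addr0.
by have := derivation_eq Eunit dl dr E3 f; rewrite !addr0 mulNr.
Qed.

(** Depth: let u be in the target of the restriction. For N large x^N u and
    y^N u lift to fields v and v'; the difference y^N v - x^N v' is z times a
    tangent field. On coordinates in a basis of the module of tangent fields
    this forces those of v' to be divisible by y^N at infinity, by
    [shift_at_infinity]. The field mu with the quotients as coordinates
    restricts to u, up to the Euler field. *)
Lemma free_top_surjective L : uniq L -> free_DL E L -> forall k, top_surjective L k.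
Proof.
(* N > |L| puts the degree k + N in the range of top_surjective_large. *)
move=> UL [I [b [bD gen ind]]] k u uM; set N := (size L).+1.
have large m : top_surjective L (m + N).
  by apply: top_surjective_large => //; rewrite /N addnS leqW // leq_addl.
have [v vL vT] := large k _ (in_multi_shift N uM).
have [v' v'L v'T] : exists2 v, in_aff L (k + N).+1 v & top (k + N) v = u.
  by apply: large; apply: in_multiW uM; rewrite ltnS leq_addr.
have [yL yT] := top_shift_y N vL; have [xL xT] := top_shift_x N v'L.
set yv := vmul _ _ in yL yT; set xv := vmul _ _ in xL xT.
have kNN : (0 < k + N + N)%N by rewrite /N addnS.
have zL : in_aff L (k + N + N).-1.+1 (yv - xv).
  rewrite prednK //; apply/in_aff_top0; rewrite addrC -scaleN1r; split.
    exact: subspace_lin (in_aff_subspace L _) xL yL.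
  by rewrite top_linear xT yT v'T vT scaleN1r addNr.
have [n1 [s1 [c1 E1]]] := gen _ (homog_field_in Eunit vL).
have [n2 [s2 [c2 E2]]] := gen _ (homog_field_in Eunit v'L).
have [n3 [s3 [c3 E3]]] := gen _ (homog_field_in Eunit zL).
pose r : seq {classic I} := undup (codom (s1 : _ -> {classic I}) ++
  codom (s2 : _ -> {classic I}) ++ codom (s3 : _ -> {classic I})).
have Ur : uniq r := undup_uniq _.
have [|C1 C1E] := gather b c1 (s := s1) Ur.
  by move=> j; rewrite mem_undup mem_cat codom_f.
have [|C2 C2E] := gather b c2 (s := s2) Ur.
  by move=> j; rewrite mem_undup ! mem_cat codom_f orbT.
have [|C3 C3E] := gather b c3 (s := s3) Ur.
  by move=> j; rewrite mem_undup ! mem_cat codom_f !orbT.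
have rel f : hy ^+ N * homog_field E (k + N) v f - hx ^+ N * homog_field E (k + N) v' f
    = hz * homog_field E (k + N + N).-1 (yv - xv) f.
  exact: (shift_relation vL v'L kNN zL).
have Crel i : i \in r -> hy ^+ N * C1 i = hx ^+ N * C2 i + hz * C3 i.
  move=> ir; apply/eqP; rewrite -subr_eq0 opprD addrA; apply/eqP.
  apply: (independent_seq (C := fun i => hy ^+ N * C1 i - hx ^+ N * C2 i - hz * C3 i) ind Ur _ ir).
  move=> f; under eq_bigr => j _ do rewrite !mulrBl -!mulrA.
  rewrite !sumrB -!mulr_sumr -C1E -C2E -C3E -E1 -E2 -E3.
  by apply/eqP; rewrite subr_eq0; apply/eqP; apply: rel.
have Cu i : i \in r -> exists ui, inf (C2 i) = 'X^N * inf ui.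
  move=> ir; apply: (shift_at_infinity (c := C1 i)).
  rewrite (Crel i ir); exact: inf_modz.
have /choice[U UE] : forall i : {classic I}, exists u, i \in r -> inf (C2 i) = 'X^N * inf u.
  move=> i; have [ir|_] := boolP (i \in r); last by exists 0.
  by have [ui uiE] := Cu i ir; exists ui.
have /choice[w wE] : forall i, exists w, b i hz = hz * w by move=> i; have [_] := bD i.
pose mu f := \sum_(i <- r) U i * b i f.
have muD : in_DL E L mu by apply: in_DL_sum.
pose wm := \sum_(i <- r) U i * w i.
have muz : mu hz = hz * wm.
  by rewrite /mu mulr_sumr; apply: eq_bigr => i _; rewrite wE mulrCA.
have w0 : \sum_(i <- r) C2 i * w i = 0.
  have z0 : hz != 0 := coord_neq0 Eunit _.
  have C2z : \sum_(i <- r) C2 i * b i hz = 0 by rewrite -C2E -E2 homog_field_z.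
  apply: (mulfI z0); rewrite mulr0 mulr_sumr -[RHS]C2z.
  by apply: eq_bigr => i _; rewrite wE mulrCA.
exists (residue E mu wm k); first exact: residue_in_aff.
have key (h : S) : inf (homog_field E (k + N) v' h) = 'X^N * inf (mu h - wm * h).
  rewrite E2 C2E (_ : \sum_(i <- r) _ = \sum_(i <- r) C2 i * (b i h - w i * h)); last first.
    under [RHS]eq_bigr => i _ do rewrite mulrBr mulrA.
    by rewrite sumrB -mulr_suml w0 mul0r subr0.
  rewrite (_ : mu h - _ = \sum_(i <- r) U i * (b i h - w i * h)); last first.
    under [RHS]eq_bigr => i _ do rewrite mulrBr mulrA.
    by rewrite sumrB -mulr_suml.
  rewrite !at_infinity_sum mulr_sumr big_seq [RHS]big_seq; apply: eq_bigr => i ir.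
  exact: inf_shiftM (UE i ir).
have [v'1 v'2 _] := v'L.
have coefE (h : S) (p : bipoly F) : homog_field E (k + N) v' h = homog_lift E (k + N) p ->
    (tsize p <= (k + N).+1)%N ->
    (slope_sub (rees (mu h - wm * h))`_k)`_k = (slope_sub p)`_(k + N).
  move=> hE sp; rewrite -coef_at_infinity.
  have := congr1 (fun P : {poly {poly F}} => P`_(k + N)) (key h).
  rewrite hE (at_infinity_lift Eunit sp) coefCM coefXn eqxx mulr1 coefXnM.
  by rewrite ltnNge leq_addl addnK => ->.
rewrite -v'T /top /residue /=; congr (_, _).
  by apply: coefE => //; apply: homog_field_x.
by apply: coefE => //; apply: homog_field_y.
Qed.

End Freeness.

(** * Surjectivity of the Ziegler restriction implies freeness *)

Fact det_line (R : comNzRingType) (h x y z w : R) :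
  x * w - y * z = (x - h * y) * w - (z - h * w) * y.
Proof. by ring. Qed.

Fact cramer_x (R : comNzRingType) (x y a b c d : R) :
  (a * d - b * c) * x = (x * d - y * c) * a + (a * y - b * x) * c.
Proof. by ring. Qed.

Fact cramer_y (R : comNzRingType) (x y a b c d : R) :
  (a * d - b * c) * y = (x * d - y * c) * b + (a * y - b * x) * d.
Proof. by ring. Qed.

Fact det_lift (R : comNzRingType) (a b c d : R) m n :
  a%:P * 'X^m * (d%:P * 'X^n) - b%:P * 'X^m * (c%:P * 'X^n) =
  (a * d - b * c)%:P * 'X^(m + n).
Proof.
by rewrite mulrACA [X in _ - X]mulrACA -exprD -mulrBl -!polyCM -polyCB.
Qed.

Fact cramer_left (R : comNzRingType) (x y a b c d : R) :
  x * a + y * c = 0 -> x * b + y * d = 0 -> x * (a * d - b * c) = 0.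
Proof.
move=> E1 E2; rewrite (_ : _ * _ = (x * a + y * c) * d - (x * b + y * d) * c).
  by rewrite E1 E2 !mul0r subrr.
by ring.
Qed.

Fact cramer_right (R : comNzRingType) (x y a b c d : R) :
  x * a + y * c = 0 -> x * b + y * d = 0 -> y * (a * d - b * c) = 0.
Proof.
move=> E1 E2; rewrite (_ : _ * _ = (x * b + y * d) * a - (x * a + y * c) * b).
  by rewrite E1 E2 !mul0r subrr.
by ring.
Qed.

Section Saito.
Variable F : fieldType.
Implicit Types (L : seq (F * F)) (h : F * F) (k : nat) (v w : bipoly F * bipoly F).

Definition adet v w : bipoly F := v.1 * w.2 - v.2 * w.1.

Lemma tsizeB (p q : bipoly F) k : (tsize p <= k)%N -> (tsize q <= k)%N -> (tsize (p - q) <= k)%N.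
Proof.
by move=> pk qk; rewrite slope_subB (leq_trans (size_polyD _ _)) // size_polyN geq_max pk.
Qed.

Lemma tsizeM (p q : bipoly F) k l : (tsize p <= k)%N -> (tsize q <= l)%N ->
  (tsize (p * q) <= (k + l).-1)%N.
Proof.
move=> pk ql; apply: leq_trans (size_slopeM _ _) _.
by rewrite -!subn1 leq_sub2r // leq_add.
Qed.

Lemma tsize_adet L k l v w : in_aff L k v -> in_aff L l w ->
  (tsize (adet v w) <= (k + l).-1)%N.
Proof. by move=> [v1 v2 _] [w1 w2 _]; apply: tsizeB; apply: tsizeM. Qed.

Lemma adet_lines L k l v w : uniq L -> in_aff L k v -> in_aff L l w ->
  exists q : bipoly F, adet v w = q * \prod_(h <- L) line_poly h.
Proof.
move=> UL [_ _ vL] [_ _ wL]; apply: line_poly_rootM => // h hL.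
rewrite /adet (det_line h.1%:P%:P) -!bipoly_scaleE hornerD hornerN !hornerM.
have := vL h hL; have := wL h hL; rewrite /on_line => -> ->.
by rewrite !mul0r subrr.
Qed.

Lemma tsize_det_quotient L k l v w (q : bipoly F) : in_aff L k v -> in_aff L l w ->
  adet v w = q * \prod_(h <- L) line_poly h -> q != 0 ->
  (tsize q + size L <= (k + l).-1)%N.
Proof.
move=> vL wL qE q0; rewrite -size_slope_mul_lines // -qE.
exact: tsize_adet vL wL.
Qed.

Lemma top_adet L k l v w : in_aff L k.+1 v -> in_aff L l.+1 w ->
  (slope_sub (adet v w))`_(k + l) = pdet (top k v) (top l w).
Proof.
move=> [v1 v2 _] [w1 w2 _].
by rewrite /adet slope_subB !slope_subM coefB !coefM_top.
Qed.

Lemma tsize1_const (q : bipoly F) : (tsize q <= 1)%N -> exists c : F, q = c%:P%:P.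
Proof.
move=> q1; have /size1_polyC kE := q1.
have /size1_polyC cE := size_slope_coef q 0.
exists (slope_sub q)`_0`_0; apply: slope_sub_inj.
by rewrite slope_subC map_polyC /= -cE.
Qed.

(** Saito's criterion for the fields killing z: complementary degrees and
    determinant the equation of the lines of L. *)
Definition saito_pair L (d1 d2 : nat) v w : Prop :=
  [/\ (d1 + d2 = size L)%N, in_aff L d1.+1 v, in_aff L d2.+1 w
    & exists2 c : F, c != 0 & adet v w = c%:P%:P * \prod_(h <- L) line_poly h].

(** The determinant of lifts of a basis of the multiarrangement is divisible by
    the equation of the lines. It is nonzero because its leading form is the
    determinant of the basis, and both sides have the same degree. *)
Lemma saito_pair_exists L : uniq L -> (forall k, top_surjective L k) ->
  exists d1 d2 v w, saito_pair L d1 d2 v w.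
Proof.
move=> UL surj; have [d1 [d2 [u1 [u2 ex]]]] := exponents_exist (map fst L).
have det0 := pdet_neq0 ex.
case: ex => _ dE u1M u2M _; rewrite size_map in dE.
have [v vL vT] := surj _ _ u1M; have [w wL wT] := surj _ _ u2M.
exists d1, d2, v, w; split=> //.
have [q qE] := adet_lines UL vL wL.
have a0 : adet v w != 0.
  apply: contraNneq det0 => a0; rewrite -vT -wT -(top_adet vL wL) a0.
  by rewrite slope_sub0 coef0.
have q0 : q != 0 by apply: contraNneq a0 => q0; rewrite qE q0 mul0r.
have := tsize_det_quotient vL wL qE q0.
rewrite addSn addnS dE /= -[X in (_ <= X)%N]add1n leq_add2r => /tsize1_const[c cE].
exists c; last by rewrite qE cE.
by apply: contraNneq q0 => c0; rewrite cE c0.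
Qed.

Lemma saito_decomp L d1 d2 v w k x : uniq L -> saito_pair L d1 d2 v w -> in_aff L k x ->
  exists ab : bipoly F * bipoly F,
    [/\ (tsize ab.1 <= k - d1)%N, (tsize ab.2 <= k - d2)%N,
      x.1 = ab.1 * v.1 + ab.2 * w.1 & x.2 = ab.1 * v.2 + ab.2 * w.2].
Proof.
move=> UL [dE vL wL [c c0 DE]] xL.
pose P : bipoly F := \prod_(h <- L) line_poly h.
have P0 : P != 0 by rewrite -slope_sub_eq0 -size_poly_eq0 (slope_prod_lines L).1.
have cP0 : (c%:P%:P : bipoly F) * P != 0 by rewrite mulf_neq0 // !polyC_eq0.
have [a aE] := adet_lines UL xL wL; have [b bE] := adet_lines UL vL xL.
have div (p : bipoly F) n : (p != 0 -> (tsize p <= n)%N) ->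
    exists2 p' : bipoly F, (tsize p' <= n)%N & c%:P%:P * P * p' = p * P.
  move=> pn; exists (c^-1 *: p).
    rewrite (leq_trans (size_slope_scale _ _)) //.
    by have [->|/pn //] := eqVneq p 0; rewrite slope_sub0 size_poly0.
  by rewrite bipoly_scaleE mulrACA -!polyCM divff // mul1r [RHS]mulrC.
have [|a' sa a'E] := div a (k - d1)%N.
  by move=> a0; apply: cramer_bound dE (tsize_det_quotient xL wL aE a0).
have [|b' sb b'E] := div b (k - d2)%N.
  move=> b0; apply: (@cramer_bound _ (size L) d2 d1); first by rewrite addnC.
  have -> : (k + d1.+1).-1 = (d1.+1 + k).-1 by rewrite addnC.
  exact: tsize_det_quotient vL xL bE b0.
exists (a', b'); split=> //=; apply: (mulfI cP0); rewrite mulrDr [X in _ = X + _]mulrA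
  [X in _ = _ + X]mulrA a'E b'E -DE -aE -bE; [exact: cramer_x | exact: cramer_y].
Qed.

End Saito.

Section Freeness.
Variables (F : fieldType) (E : 'M[F]_3).
Hypothesis Eunit : E \in unitmx.

Local Notation S := {mpoly F[3]}.
Local Notation T := {poly {poly {poly F}}}.
Local Notation crd := (coord E).
Local Notation hx := (coord E ord0).
Local Notation hy := (coord E 1).
Local Notation hz := (coord E ord_max).
Local Notation rees := (rees E).

(** Coefficients found separately in each degree k assemble to elements of S; the
    coefficient of v, homogenized in degree d1, lives in degree k - d1. *)
Lemma rees_comb (A B : nat -> bipoly F) (p q : bipoly F) d1 d2 K (r : S) :
  (forall k, (tsize (A k) <= k.+1 - d1)%N) -> (forall k, (tsize (B k) <= k.+1 - d2)%N) ->
  (tsize p <= d1.+1)%N -> (tsize q <= d2.+1)%N -> (size (rees r) <= K)%N ->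
  (forall k, (rees r)`_k = A k * p + B k * q) ->
  rees r = \poly_(m < K - d1) A (m + d1)%N * (p%:P * 'X^d1) +
           \poly_(m < K - d2) B (m + d2)%N * (q%:P * 'X^d2).
Proof.
move=> sA sB sp sq sK rE.
have term (C : nat -> bipoly F) (u : bipoly F) d k : (forall k, (tsize (C k) <= k.+1 - d)%N) ->
    (\poly_(m < K - d) C (m + d)%N * (u%:P * 'X^d))`_k = if (k < K)%N then C k * u else 0.
  move=> sC; rewrite mulrA coefMXn; case: ltnP => [kd|dk].
    have -> : C k = 0.
      apply/eqP; rewrite -slope_sub_eq0 -size_poly_eq0 -leqn0.
      by have := sC k; rewrite (eqP (_ : (k.+1 - d)%N == 0%N)).
    by rewrite mul0r if_same.
  by rewrite coefMC coef_poly subnK // ltn_sub2rE // (fun_if (fun z => z * u)) mul0r.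
apply/polyP => k; rewrite coefD !term //; case: ltnP => [//|Kk].
by rewrite addr0 nth_default // (leq_trans sK).
Qed.

(** The Euler field together with a Saito pair is a basis. *)
Lemma surjective_free L : uniq L -> (forall k, top_surjective L k) -> free_DL E L.
Proof.
move=> UL surj; have [d1 [d2 [v [w sp]]]] := saito_pair_exists UL surj.
have [dE vL wL [c c0 DE]] := sp.
have [v1 v2 _] := vL; have [w1 w2 _] := wL.
pose b (i : 'I_3) := if i == ord0 then euler E
  else if i == ord_max then homog_field E d2 w else homog_field E d1 v.
exists 'I_3, b; split.
- apply: I3_case; rewrite /b /=; first exact: euler_in.
    exact: homog_field_in.
  exact: homog_field_in.
- move=> theta tD; have [dt [r rE] _] := tD.
  have res k := residue_in_aff Eunit k tD rE.
  have /choice[ab abP] k := saito_decomp UL sp (res k).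
  pose K := maxn (size (rees (theta hx - r * hx))) (size (rees (theta hy - r * hy))).
  have sA k : (tsize (ab k).1 <= k.+1 - d1)%N by have [] := abP k.
  have sB k : (tsize (ab k).2 <= k.+1 - d2)%N by have [] := abP k.
  have in_shift (C : nat -> bipoly F) d : (forall k, (tsize (C k) <= k.+1 - d)%N) ->
      in_rees (\poly_(m < K - d) C (m + d)%N).
    move=> sC m; rewrite coef_poly; case: ifP => _; last by rewrite slope_sub0 size_poly0.
    by rewrite (leq_trans (sC _)) // -addSn addnK.
  have [C1 C1E] := rees_surj Eunit (in_shift _ _ sA).
  have [C2 C2E] := rees_surj Eunit (in_shift _ _ sB).
  have xE : theta hx - r * hx = C1 * homog_lift E d1 v.1 + C2 * homog_lift E d2 w.1.
    apply: (rees_inj Eunit); rewrite [RHS]reesD [in RHS]reesM [in RHS]reesM C1E C2E !rees_lift //.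
    apply: (rees_comb (A := fun k => (ab k).1) (B := fun k => (ab k).2)) => //; first exact: leq_maxl.
    by move=> k; case: (abP k) => _ _ H _; exact: H.
  have yE : theta hy - r * hy = C1 * homog_lift E d1 v.2 + C2 * homog_lift E d2 w.2.
    apply: (rees_inj Eunit); rewrite [RHS]reesD [in RHS]reesM [in RHS]reesM C1E C2E !rees_lift //.
    apply: (rees_comb (A := fun k => (ab k).1) (B := fun k => (ab k).2)) => //; first exact: leq_maxr.
    by move=> k; case: (abP k) => _ _ _ H; exact: H.
  pose cc (i : 'I_3) := if i == ord0 then r else if i == ord_max then C2 else C1.
  exists 3%N, id, cc => f.
  have bD : forall i, in_DL E L (b i).
    apply: I3_case; rewrite /b /=; first exact: euler_in.
      exact: homog_field_in.
    exact: homog_field_in.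
  have [dd _ _] := in_DL_sum (index_enum 'I_3) cc bD.
  suff H a : theta (crd a) = \sum_(j < 3) cc j * b j (crd a).
    exact: (derivation_eq Eunit dt dd H f).
  have sum3 g : \sum_(j < 3) cc j * b j g =
      r * euler E g + C1 * homog_field E d1 v g + C2 * homog_field E d2 w g.
    by rewrite !big_ord_recl big_ord0 addr0 addrA.
  have eulerE i : euler E (crd i) = crd i by rewrite /euler der_coord.
  move: a; apply: I3_case; rewrite sum3 eulerE.
  + by rewrite !homog_field_x // -addrA -xE addrC subrK.
  + by rewrite !homog_field_y // -addrA -yE addrC subrK.
  + by rewrite !homog_field_z // !mulr0 !addr0 rE mulrC.
- move=> n s cj sI rel; pose C i := \sum_(j | s j == i) cj j.
  have relC f : C ord0 * euler E f + C 1 * homog_field E d1 v f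
      + C ord_max * homog_field E d2 w f = 0.
    rewrite -[RHS](rel f) (partition_big s xpredT) //= !big_ord_recl big_ord0 addr0 addrA.
    have sub i : \sum_(j | s j == i) cj j * b (s j) f = C i * b i f.
      by rewrite /C mulr_suml; apply: eq_bigr => j /eqP ->.
    have -> : lift ord0 ord0 = 1 :> 'I_3 by apply/val_inj.
    have -> : lift ord0 (lift ord0 ord0) = ord_max :> 'I_3 by apply/val_inj.
    by rewrite !sub.
  have eulerE i : euler E (crd i) = crd i by rewrite /euler der_coord.
  have z0 : hz != 0 := coord_neq0 Eunit _.
  have C0 : C ord0 = 0.
    apply: (mulIf z0); rewrite mul0r -[RHS](relC hz) eulerE !homog_field_z //.
    by rewrite !mulr0 !addr0.
  have xE : C 1 * homog_lift E d1 v.1 + C ord_max * homog_lift E d2 w.1 = 0.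
    by rewrite -[RHS](relC hx) C0 mul0r add0r !homog_field_x.
  have yE : C 1 * homog_lift E d1 v.2 + C ord_max * homog_lift E d2 w.2 = 0.
    by rewrite -[RHS](relC hy) C0 mul0r add0r !homog_field_y.
  pose D := homog_lift E d1 v.1 * homog_lift E d2 w.2 - homog_lift E d1 v.2 * homog_lift E d2 w.1.
  have D0 : D != 0.
    rewrite -(rees_eq0 Eunit) reesB !reesM !rees_lift //.
    rewrite det_lift mulf_neq0 ?expf_neq0 ?polyX_eq0 // polyC_eq0 -/(adet v w) DE.
    rewrite mulf_neq0 // ?polyC_eq0 //.
    by rewrite -slope_sub_eq0 -size_poly_eq0 (slope_prod_lines L).1.
  have C1 : C 1 = 0 by apply: (mulIf D0); rewrite mul0r; apply: cramer_left xE yE.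
  have C2 : C ord_max = 0 by apply: (mulIf D0); rewrite mul0r; apply: cramer_right xE yE.
  move=> j; have : C (s j) = 0.
    by move: (s j); apply: I3_case.
  by rewrite /C (big_pred1 j) // => i; rewrite /= (inj_eq sI).
Qed.

End Freeness.

(** * Coordinates adapted to a line of the arrangement *)

Section Avoidance.
Variable F : numFieldType.
Local Notation V := 'rV[F]_3.
Implicit Types (H G l : {vspace V}) (u v w : V).

(** Each subspace contains at most one of the points w + n v. *)
Lemma eventually_outside (s : seq {vspace V}) v w : (forall H, H \in s -> v \notin H) ->
  exists N, forall n, (N <= n)%N -> forall H, H \in s -> w + n%:R *: v \notin H.
Proof.
elim: s => [|H s IH] vs; first by exists 0%N.
have [|N NP] := IH; first by move=> G Gs; apply: vs; rewrite mem_behead.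
have vH : v \notin H by apply: vs; rewrite mem_head.
have [[n0 n0H]|no] := pselect (exists n, w + n%:R *: v \in H); last first.
  exists N => n Nn G; rewrite inE => /orP[/eqP ->|]; last exact: NP.
  by apply/negP => wH; apply: no; exists n.
exists (maxn N n0.+1) => n; rewrite geq_max => /andP[Nn n0n] G.
rewrite inE => /orP[/eqP ->|]; last exact: NP.
apply: contra vH => nH; have := rpredB nH n0H.
rewrite opprD addrACA subrr add0r -scalerBl -natrB 1?ltnW //.
by rewrite rpredZeq pnatr_eq0 subn_eq0 leqNgt n0n.
Qed.

Lemma avoid_planes l (s : seq {vspace V}) : (forall H, H \in s -> ~~ (l <= H)%VS) ->
  exists2 v, v \in l & forall H, H \in s -> v \notin H.
Proof.
elim: s => [|H s IH] ls; first by exists 0; rewrite ?mem0v.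
have [|v vl vs] := IH; first by move=> G Gs; apply: ls; rewrite mem_behead.
have [vH|vH] := boolP (v \in H); last first.
  by exists v => // G; rewrite inE => /orP[/eqP ->|] //; apply: vs.
have /subvPn[w wl wH] := ls H (mem_head _ _).
have [N NP] := eventually_outside w vs.
exists (w + N%:R *: v); first by rewrite rpredD // rpredZ.
move=> G; rewrite inE => /orP[/eqP ->|]; last by apply: NP.
by rewrite rpredDr // rpredZ.
Qed.

End Avoidance.

Section PlaneCoordinates.
Variable F : fieldType.
Local Notation V := 'rV[F]_3.
Local Notation S := {mpoly F[3]}.
Implicit Types (H G l : {vspace V}) (u v w : V).

Lemma dimV : \dim {:V} = 3%N.
Proof. by rewrite dimvf /dim /= mul1n. Qed.

Lemma plane_complement H v w : \dim H = 2%N -> v \notin H -> exists a, w + a *: v \in H.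
Proof.
move=> dH vH; have vH0 : (H :&: <[v]> = 0)%VS.
  apply/eqP; rewrite -subv0; apply/subvP => x; rewrite memv_cap => /andP[xH /vlineP[a xE]].
  move: xH; rewrite xE rpredZeq (negPf vH) orbF => /eqP ->.
  by rewrite scale0r mem0v.
have full : (H + <[v]>)%VS = fullv.
  apply/eqP; rewrite eqEdim subvf dimV dimv_disjoint_sum // dH dim_vline.
  by case: eqP vH => // ->; rewrite mem0v.
have : w \in (H + <[v]>)%VS by rewrite full memvf.
case/memv_addP=> h hH [x /vlineP[a ->] ->]; exists (- a).
by rewrite -addrA -scalerDl subrr scale0r addr0.
Qed.

(** Linear coordinates in which l is the line at infinity z = 0 and the line H
    is x = t y + c z with (t, c) = par H. A vector v has the coordinates
    v E^-1. *)
Definition adapted l (Ls : seq {vspace V}) (E : 'M[F]_3) (par : {vspace V} -> F * F) : Prop :=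
  [/\ E \in unitmx, forall v, (v \in l) = ((v *m invmx E) 0 ord_max == 0)
    & forall H, H \in Ls -> forall v, (v \in H) =
        ((v *m invmx E) 0 ord0 - (par H).1 * (v *m invmx E) 0 1
          - (par H).2 * (v *m invmx E) 0 ord_max == 0)].

End PlaneCoordinates.

(** Take e0 in l outside all other lines, e1 completing it to a basis of l, and e2
    outside l. A line H contains e1 + t e0 and e2 + c e0 for suitable t and c. *)
Lemma adapted_exists (F : numFieldType) (l : {vspace 'rV[F]_3}) (Ls : seq {vspace 'rV[F]_3}) :
  \dim l = 2%N -> (forall H, H \in Ls -> \dim H = 2%N) -> l \notin Ls ->
  exists E par, adapted l Ls E par.
Proof.
move=> dl dLs lLs.
have [|e0 e0l e0H] := @avoid_planes _ l (0%VS :: Ls).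
  move=> H; rewrite inE => /orP[/eqP ->|HL].
    by apply/negP => /dimvS; rewrite dl dimv0.
  apply: contra lLs => lH; suff -> : l = H by [].
  by apply/eqP; rewrite eqEdim lH dl dLs.
have e00 : e0 != 0 by have := e0H 0%VS (mem_head _ _); rewrite memv0.
have {}e0H H : H \in Ls -> e0 \notin H by move=> HL; apply: e0H; rewrite mem_behead.
have /subvPn[e1 e1l e10] : ~~ (l <= <[e0]>)%VS.
  by apply/negP => /dimvS; rewrite dl dim_vline e00.
have /subvPn[e2 _ e2l] : ~~ (fullv <= l)%VS.
  by apply/negP => /dimvS; rewrite dl dimV.
pose row3 (i : 'I_3) := if i == ord0 then e0 else if i == ord_max then e2 else e1.
pose E := \matrix_(i < 3) row3 i.
have comb (c : 'rV[F]_3) : c *m E = c 0 ord0 *: e0 + c 0 1 *: e1 + c 0 ord_max *: e2.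
  rewrite mulmx_sum_row !big_ord_recl big_ord0 addr0 addrA !rowK /row3 /=.
  have -> : lift ord0 ord0 = 1 :> 'I_3 by apply/val_inj.
  by have -> : lift ord0 (lift ord0 ord0) = ord_max :> 'I_3 by apply/val_inj.
have comb_l (c : 'rV[F]_3) : (c *m E \in l) = (c 0 ord_max == 0).
  rewrite comb rpredDl; last by rewrite rpredD // rpredZ.
  by rewrite rpredZeq (negPf e2l) orbF.
have Eunit : E \in unitmx.
  rewrite -row_free_unit; apply: inj_row_free => c cE.
  have c2 : c 0 ord_max = 0 by apply/eqP; rewrite -comb_l cE mem0v.
  move: cE; rewrite comb c2 scale0r addr0 => cE.
  have c1 : c 0 1 = 0.
    apply/eqP; have : c 0 1 *: e1 \in <[e0]>%VS.
      by rewrite -[_ *: e1](addKr (c 0 ord0 *: e0)) cE addr0 rpredN rpredZ // memv_line.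
    by rewrite rpredZeq (negPf e10) orbF.
  move: cE; rewrite c1 scale0r addr0 => /eqP.
  rewrite scaler_eq0 (negPf e00) orbF => /eqP c0.
  by apply/rowP => i; rewrite mxE; move: i; apply: I3_case.
have /choice[par parP] : forall H, exists p : F * F, H \in Ls ->
    e1 + p.1 *: e0 \in H /\ e2 + p.2 *: e0 \in H.
  move=> H; have [HL|_] := boolP (H \in Ls); last by exists (0, 0).
  have [t tH] := plane_complement e1 (dLs H HL) (e0H H HL).
  by have [c cH] := plane_complement e2 (dLs H HL) (e0H H HL); exists (t, c).
exists E, par; split=> // [v|H HL v]; rewrite -{1}[v](mulmxKV Eunit).
  exact: comb_l.
move: (v *m invmx E) => c; have [tH cH] := parP H HL.
rewrite comb (_ : _ + _ = (c 0 ord0 - (par H).1 * c 0 1 - (par H).2 * c 0 ord_max) *: e0 +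
  (c 0 1 *: (e1 + (par H).1 *: e0) + c 0 ord_max *: (e2 + (par H).2 *: e0))).
  rewrite rpredDr; last by rewrite rpredD // rpredZ.
  by rewrite rpredZeq (negPf (e0H H HL)) orbF.
by apply/rowP => i; rewrite !mxE; ring.
Qed.

Section Restriction.
Variable F : fieldType.
Local Notation V := 'rV[F]_3.
Local Notation S := {mpoly F[3]}.
Variables (A : line_arrangement F) (l : {vspace V}) (Ls : seq {vspace V}).
Variables (E : 'M[F]_3) (par : {vspace V} -> F * F).
Hypothesis adE : adapted l Ls E par.
Hypothesis AL : forall H, (H \in lines A) = (H == l) || (H \in Ls).

Let Eunit : E \in unitmx. Proof. by case: adE. Qed.

Lemma dhomog1_eval (p : S) : p \is 1.-homog -> p = \sum_i p@_U_(i) *: 'X_i.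
Proof.
move=> p1; apply/mpolyP => m; rewrite raddf_sum /=.
under eq_bigr => i _ do rewrite mcoeffZ mcoeffX.
have [/mdeg1P[i /eqP ->]|m1] := boolP (mdeg m == 1%N).
  rewrite (bigD1 i) //= big1 ?addr0 => [|j ji]; first by rewrite -mcoeffX mcoeffXU eqxx mulr1.
  by rewrite -mcoeffX mcoeffXU (negPf ji) mulr0.
rewrite (dhomog_nemf_coeff p1) // big1 // => i _.
have [mE|_] := eqVneq U_(i)%MM m; last by rewrite mulr0.
by rewrite -mE mdeg1 in m1.
Qed.

Lemma dhomog1_ext (p q : S) : p \is 1.-homog -> q \is 1.-homog ->
  (forall v : V, p.@[v 0] = q.@[v 0]) -> p = q.
Proof.
move=> p1 q1 pq; rewrite (dhomog1_eval p1) (dhomog1_eval q1).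
apply: eq_bigr => i _; congr (_ *: _).
have ev (r : S) : r \is 1.-homog -> r.@[(delta_mx 0 i : V) 0] = r@_U_(i).
  move=> r1; rewrite {1}(dhomog1_eval r1) raddf_sum (bigD1 i) //= big1 ?addr0 => [|j ji].
    by rewrite mevalZ mevalXU mxE !eqxx mulr1.
  by rewrite mevalZ mevalXU mxE (negPf ji) andbF mulr0.
by rewrite -(ev p p1) -(ev q q1) pq.
Qed.

Lemma coord_homog a : coord E a \is 1.-homog.
Proof.
apply: rpred_sum => i _; apply: rpredZ.
by rewrite dhomogX; apply/eqP/mdeg1.
Qed.

Lemma coord_eval a (v : V) : (coord E a).@[v 0] = (v *m invmx E) 0 a.
Proof.
rewrite /coord raddf_sum mxE /=; apply: eq_bigr => i _.
by rewrite mevalZ mevalXU mulrC.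
Qed.

Lemma coord_dual a b : (coord E a).@[(row b E) 0] = (b == a)%:R.
Proof. by rewrite coord_eval -row_mul mulmxV // !mxE. Qed.

Lemma line_form_homog h : line_form E h \is 1.-homog.
Proof. by rewrite /line_form !rpredB ?rpredZ ?coord_homog. Qed.

Lemma line_form_eval h (v : V) : (line_form E h).@[v 0] =
  (v *m invmx E) 0 ord0 - h.1 * (v *m invmx E) 0 1 - h.2 * (v *m invmx E) 0 ord_max.
Proof. by rewrite /line_form !mevalB !mevalZ !coord_eval. Qed.

Lemma line_form_defining H : H \in Ls -> defining_form H (line_form E (par H)).
Proof.
move=> HL; split; first exact: line_form_homog.
by move=> v; rewrite line_form_eval; case: adE => _ _ ->.
Qed.

Lemma infinity_defining : defining_form l (coord E ord_max).
Proof.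
split; first exact: coord_homog.
by move=> v; rewrite coord_eval; case: adE => _ -> _.
Qed.

Lemma meval_lin (p : S) (c : F) (v w : V) : p \is 1.-homog ->
  p.@[(v - c *: w) 0] = p.@[v 0] - c * p.@[w 0].
Proof.
move=> p1; rewrite (dhomog1_eval p1) !raddf_sum mulr_sumr -sumrB.
by apply: eq_bigr => i _ /=; rewrite !mevalZ !mevalXU !mxE; ring.
Qed.

(** The value of alpha at e is the ratio, since v - beta(v) e lies on H. *)
Lemma defining_form_unique H alpha beta (e : V) : defining_form H alpha ->
  defining_form H beta -> beta.@[e 0] = 1 -> exists c, alpha = c *: beta.
Proof.
move=> [a1 aH] [b1 bH] be; exists alpha.@[e 0].
apply: dhomog1_ext => // [|v]; first by rewrite rpredZ.
rewrite mevalZ mulrC; apply/eqP; rewrite -subr_eq0 -meval_lin // -aH bH.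
by rewrite meval_lin // be mulr1 subrr.
Qed.

Lemma in_D_form theta H alpha beta (e : V) : is_derivation theta ->
  defining_form H alpha -> defining_form H beta -> beta.@[e 0] = 1 ->
  (exists q, theta beta = beta * q) -> exists q, theta alpha = alpha * q.
Proof.
move=> dt da db be [q qE]; have [c ->] := defining_form_unique da db be.
by exists q; rewrite (derivationZ _ _ dt) qE scalerAl.
Qed.

Lemma in_D_coordinates theta : in_D A theta <-> in_DL E (map par Ls) theta.
Proof.
have lf h : is_derivation theta -> theta (line_form E h) =
    theta (coord E ord0) - h.1 *: theta (coord E 1) - h.2 *: theta (coord E ord_max).
  move=> dt; rewrite /line_form !(derivationB _ _ dt).
  by rewrite !(derivationZ _ _ dt).
split=> [[dt tA]|[dt tl tL]].
  split=> //.
    have lA : l \in lines A by rewrite AL eqxx.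
    exact: tA lA infinity_defining.
  move=> _ /mapP[H HL ->]; rewrite -lf //.
  have HA : H \in lines A by rewrite AL HL orbT.
  exact: tA HA (line_form_defining HL).
split=> // H alpha; rewrite AL => /orP[/eqP ->|HL] da.
  apply: (in_D_form (e := row ord_max E) dt da infinity_defining) tl.
  by rewrite coord_dual.
apply: (in_D_form (e := row ord0 E) dt da (line_form_defining HL)).
  rewrite line_form_eval -!coord_eval !coord_dual /=.
  by rewrite mulr0 mulr0 !subr0.
by rewrite lf //; apply: tL; apply: map_f.
Qed.

Lemma free_coordinates : free_arrangement A <-> free_DL E (map par Ls).
Proof.
split=> -[I [b [bD gen ind]]]; exists I, b; split=> //.
- by move=> i; apply/in_D_coordinates.
- by move=> theta /in_D_coordinates/gen.
- by move=> i; apply/in_D_coordinates.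
- by move=> theta /in_D_coordinates/gen.
Qed.

End Restriction.

(** * Incidence, parallelism and the intersection lattice *)

Local Open Scope fset_scope.
Local Open Scope ring_scope.

Section Incidence.
Variable F : fieldType.
Local Notation V := 'rV[F]_3.
Variables (l : {vspace V}) (Ls : seq {vspace V}).
Variables (E : 'M[F]_3) (par : {vspace V} -> F * F).
Hypothesis adE : adapted l Ls E par.

Let Eunit : E \in unitmx. Proof. by case: adE. Qed.

Definition vec3 (a b c : F) : V :=
  \row_i (if i == ord0 then a else if i == ord_max then c else b).

Lemma vec3_l a b c : (vec3 a b c *m E \in l) = (c == 0).
Proof. by case: adE => _ -> _; rewrite mulmxK // mxE. Qed.

Lemma vec3_line H a b c : H \in Ls ->
  (vec3 a b c *m E \in H) = (a - (par H).1 * b - (par H).2 * c == 0).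
Proof. by case: adE => _ _ HP HL; rewrite HP // mulmxK // !mxE. Qed.

Lemma par_inj : {in Ls &, injective par}.
Proof.
move=> H G HL GL HG; apply/vspaceP => v.
by case: adE => _ _ P; rewrite !P // HG.
Qed.

(** Parallel affine lines are those meeting at a point of l. *)
Lemma parallelE H G : H \in Ls -> G \in Ls ->
  (l :&: H <= G)%VS = ((par H).1 == (par G).1).
Proof.
move=> HL GL; have [_ lP HP] := adE; apply/idP/eqP => [/subvP HG|tt].
  have := HG (vec3 (par H).1 1 0 *m E).
  rewrite memv_cap vec3_l eqxx !vec3_line // !mulr1 !mulr0 !subr0 subrr eqxx.
  by move=> /(_ isT); rewrite subr_eq0 => /eqP.
apply/subvP => v; rewrite memv_cap lP !HP // => /andP[/eqP ->].
by rewrite tt !mulr0.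
Qed.

Lemma concurrentE H G G' : H \in Ls -> G \in Ls -> G' \in Ls ->
  (par G).1 != (par H).1 -> (par G').1 != (par H).1 ->
  (H :&: G <= G')%VS =
  (((par G).2 - (par H).2) / ((par H).1 - (par G).1) ==
   ((par G').2 - (par H).2) / ((par H).1 - (par G').1)).
Proof.
move=> HL GL GL' tG tG'; have [_ lP HP] := adE.
move: (HP) => /[dup] /(_ _ HL) Hv /[dup] /(_ _ GL) Gv /(_ _ GL') Gv'.
have vH a b c := vec3_line a b c HL; have vG a b c := vec3_line a b c GL.
have vG' a b c := vec3_line a b c GL'.
move: (par H) (par G) (par G') tG tG' Hv Gv Gv' vH vG vG' => [t c] [t1 c1] [t2 c2] /=.
move=> t1t t2t Hv Gv Gv' vH vG vG'.
have d1 : t - t1 != 0 by rewrite subr_eq0 eq_sym.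
have d2 : t - t2 != 0 by rewrite subr_eq0 eq_sym.
set y := (c1 - c) / (t - t1).
apply/idP/eqP => [/subvP HG|yE].
  have := HG (vec3 (t * y + c) y 1 *m E).
  have yv : (t - t1) * y = c1 - c by rewrite /y mulrC divfK.
  rewrite memv_cap vH vG vG' !mulr1.
  have -> : t * y + c - t * y - c = 0 by ring.
  have -> : t * y + c - t1 * y - c1 = (t - t1) * y - (c1 - c) by ring.
  rewrite yv subrr eqxx => /(_ isT) /eqP E0.
  apply: (mulIf d2); rewrite divfK // mulrC; apply/eqP; rewrite -subr_eq0; apply/eqP.
  by rewrite -[RHS]E0; ring.
have yv : (t - t1) * y = c1 - c by rewrite /y mulrC divfK.
have yv' : (t - t2) * y = c2 - c by rewrite yE mulrC divfK.
apply/subvP => v; rewrite memv_cap Hv Gv Gv'.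
move: ((v *m invmx E) 0 ord0) ((v *m invmx E) 0 1) ((v *m invmx E) 0 ord_max) => x0 x1 x2.
move=> /andP[/eqP Hx /eqP Gx].
have x1E : x1 = y * x2.
  apply: (mulfI d1); rewrite mulrA yv; apply/eqP; rewrite -subr_eq0; apply/eqP.
  rewrite (_ : _ - _ = (x0 - t1 * x1 - c1 * x2) - (x0 - t * x1 - c * x2)); last by ring.
  by rewrite Hx Gx subrr.
apply/eqP; rewrite (_ : _ - _ = (x0 - t * x1 - c * x2) + ((t - t2) * x1 - (c2 - c) * x2)).
  by rewrite Hx add0r x1E mulrA yv' subrr.
by ring.
Qed.

End Incidence.

Section Lattice.
Variable F : fieldType.
Local Notation V := 'rV[F]_3.
Implicit Types (A B : line_arrangement F) (H G K : {vspace V}).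

Lemma lattice_line A H : H \in lines A -> H \in intersection_lattice A.
Proof.
move=> HA; apply/imfsetP; exists [fset H] => /=.
  by rewrite fpowersetE fsub1set.
by rewrite big_seq_fset1.
Qed.

Lemma lattice_full A : fullv \in intersection_lattice A.
Proof.
apply/imfsetP; exists fset0 => /=; first by rewrite fpowersetE fsub0set.
by rewrite big_seq_fset0.
Qed.

Lemma lattice_cap A H G : H \in lines A -> G \in lines A ->
  (H :&: G)%VS \in intersection_lattice A.
Proof.
move=> HA GA; have [->|HG] := eqVneq H G; first by rewrite capvv lattice_line.
apply/imfsetP; exists [fset H; G] => /=.
  by rewrite fpowersetE; apply/fsubsetP => X; rewrite in_fset2 => /orP[]/eqP->.
by rewrite big_fsetU1 /= ?big_seq_fset1 // in_fset1.
Qed.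

Lemma line_not_full A H : H \in lines A -> H != fullv.
Proof. by move=> HA; apply/eqP => HF; have := lines_dim HA; rewrite HF dimV. Qed.

(** Lines are the maximal proper members of the lattice. *)
Lemma lattice_lineP A (X : {vspace V}) : X \in intersection_lattice A ->
  reflect (X != fullv /\ forall Y, Y \in intersection_lattice A -> (X <= Y)%VS ->
             Y = X \/ Y = fullv) (X \in lines A).
Proof.
move=> XL; apply: (iffP idP) => [XA|[Xf Xmax]].
  split; first exact: line_not_full XA.
  move=> Y _ XY; have [dY|dY] := leqP (\dim Y) 2.
    by left; apply/esym/eqP; rewrite eqEdim XY (lines_dim XA).
  by right; apply/eqP; rewrite eqEdim subvf dimV.
case/imfsetP: XL Xf Xmax => S /=; rewrite fpowersetE => /fsubsetP SA -> Xf Xmax.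
have /fset0Pn[H HS] : S != fset0.
  by apply: contra Xf => /eqP ->; rewrite big_seq_fset0.
have HA := SA H HS.
have XH : (\bigcap_(H <- enum_fset S) H <= H)%VS.
  by rewrite (big_rem H) //= capvSl.
case: (Xmax H (lattice_line HA) XH) => [<- //|Hf].
by have := line_not_full HA; rewrite Hf eqxx.
Qed.

Lemma lattice_iso_line A B (g : intersection_lattice A -> intersection_lattice B)
    (f : intersection_lattice B -> intersection_lattice A) (X : intersection_lattice A) :
  cancel f g -> cancel g f ->
  (forall X Y, (val (g Y) <= val (g X))%VS = (val Y <= val X)%VS) ->
  val X \in lines A -> val (g X) \in lines B.
Proof.
move=> fK gK gmono /(lattice_lineP (valP X))[Xf Xmax].
pose T : intersection_lattice A := [` lattice_full A].
pose T' : intersection_lattice B := [` lattice_full B].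
have gT : val (g T) = fullv.
  apply/eqP; rewrite eqEsubv subvf /=.
  by have := gmono T (f T'); rewrite fK => ->; apply: subvf.
apply/(lattice_lineP (valP (g X))); split.
  apply: contra Xf => /eqP gX; suff -> : X = T by [].
  by rewrite -[X]gK -[T]gK; congr (f _); apply/val_inj; rewrite gX gT.
move=> Y YB XY; pose Y' := f [` YB].
have gY : val (g Y') = Y by rewrite /Y' fK.
have : (val X <= val Y')%VS by rewrite -gmono gY.
move/(Xmax _ (valP Y')) => [/val_inj YX|Yf].
  by left; rewrite -gY YX.
by right; rewrite -gY -gT; congr (val (g _)); apply/val_inj.
Qed.

(** A lattice isomorphism induces a bijection between lines which preserves
    concurrency, the meet of two lines being their greatest common member. *)
Lemma lattice_isomorphic_lines A B : lattice_isomorphic B A ->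
  exists beta : {vspace V} -> {vspace V},
    [/\ forall H, H \in lines A -> beta H \in lines B,
        {in lines A &, injective beta},
        forall K, K \in lines B -> exists2 H, H \in lines A & beta H = K
      & forall H G K, H \in lines A -> G \in lines A -> K \in lines A ->
          (beta H :&: beta G <= beta K)%VS = (H :&: G <= K)%VS].
Proof.
move=> [f [g fK gK] fmono].
have gmono X Y : (val (g Y) <= val (g X))%VS = (val Y <= val X)%VS.
  by rewrite -fmono !gK.
pose beta H := if insub H is Some X then val (g X) else H.
have betaE X : beta (val X) = val (g X) by rewrite /beta valK.
have lift H : H \in lines A -> {X : intersection_lattice A | val X = H}.
  by move=> HA; exists [` lattice_line HA].
exists beta; split.
- move=> H /[dup] HA /lift[X XE]; rewrite -XE betaE.
  by apply: lattice_iso_line fK gK gmono _; rewrite XE.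
- move=> H G /lift[X <-] /lift[Y <-]; rewrite !betaE => /val_inj XY.
  by rewrite -[X]gK -[Y]gK XY.
- move=> K KB; pose X : intersection_lattice B := [` lattice_line KB].
  exists (val (f X)); first by apply: lattice_iso_line gK fK fmono _.
  by rewrite betaE fK.
move=> H G K HA GA KA; have [X XE] := lift H HA; have [Y YE] := lift G GA.
have [Z ZE] := lift K KA; rewrite -XE -YE -ZE !betaE.
have capP (C : line_arrangement F) (P Q R : intersection_lattice C) : val P \in lines C -> val Q \in lines C ->
    (val P :&: val Q <= val R)%VS <-> (forall W : intersection_lattice C,
      (val W <= val P)%VS -> (val W <= val Q)%VS -> (val W <= val R)%VS).
  move=> PC QC; split=> [PQ W WP WQ|/(_ [` lattice_cap PC QC])].
    by apply: subv_trans PQ; rewrite subv_cap WP WQ.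
  by apply; rewrite /= ?capvSl ?capvSr.
have gX U : val U \in lines A -> val (g U) \in lines B by apply: lattice_iso_line fK gK gmono.
have XA : val X \in lines A by rewrite XE.
have YA : val Y \in lines A by rewrite YE.
apply/idP/idP => [/(capP B _ _ _ (gX _ XA) (gX _ YA)) PQ|/(capP A _ _ _ XA YA) PQ].
  apply/(capP A _ _ _ XA YA) => W WX WY.
  by rewrite -gmono; apply: PQ; rewrite gmono.
apply/(capP B _ _ _ (gX _ XA) (gX _ YA)) => W.
by rewrite -[W]fK !gmono; apply: PQ.
Qed.

End Lattice.

(** * From the four conditions to freeness *)

Section Conditions.
Variable F : fieldType.
Local Notation V := 'rV[F]_3.
Variables (A : line_arrangement F) (l : {vspace V}) (Ls : seq {vspace V}).
Hypothesis AL : forall H, (H \in lines A) = (H == l) || (H \in Ls).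
Hypothesis lLs : l \notin Ls.
Hypothesis UL : uniq Ls.

Let lA : l \in lines A. Proof. by rewrite AL eqxx. Qed.
Let LA H : H \in Ls -> H \in lines A. Proof. by rewrite AL orbC => ->. Qed.

(** The points where the other lines meet l, each listed as often as its
    multiplicity in the restriction. *)
Definition traces : seq {vspace V} := [seq (l :&: H)%VS | H <- Ls].

Lemma dim_trace (H : {vspace V}) : H \in Ls -> \dim (l :&: H) = 1%N.
Proof.
move=> HL; have dl := lines_dim lA; have dH := lines_dim (LA HL).
have d3 : \dim (l + H) = 3%N.
  apply/eqP; rewrite eqn_leq; apply/andP; split.
    by rewrite (leq_trans (dimvS (subvf _))) // dimV.
  rewrite ltnNge; apply: contra lLs => d2.
  have lE : l = (l + H)%VS by apply/eqP; rewrite eqEdim addvSl dl.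
  have HE : H = (l + H)%VS by apply/eqP; rewrite eqEdim addvSr dH.
  by rewrite lE -HE.
by have := dimv_sum_cap l H; rewrite d3 dl dH => -[].
Qed.

Lemma trace_sub (p H : {vspace V}) : \dim p = 1%N -> (p <= l)%VS -> H \in Ls ->
  (p <= H)%VS = ((l :&: H)%VS == p).
Proof.
move=> dp pl HL; apply/idP/eqP => [pH|<-]; last exact: capvSr.
by apply/esym/eqP; rewrite eqEdim subv_cap pl pH dim_trace // dp.
Qed.

Lemma trace_eq (H G : {vspace V}) : H \in Ls -> G \in Ls ->
  ((l :&: H)%VS == (l :&: G)%VS) = (l :&: H <= G)%VS.
Proof.
by move=> HL GL; rewrite (trace_sub _ _ GL) ?dim_trace ?capvSl // eq_sym.
Qed.

Lemma point_mult_trace (p : {vspace V}) : \dim p = 1%N -> (p <= l)%VS ->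
  point_mult A p = (count_mem p traces).+1.
Proof.
move=> dp pl; have -> : point_mult A p = size [seq H <- l :: Ls | (p <= H)%VS].
  rewrite /point_mult; apply: perm_size; apply: uniq_perm.
  - exact: fset_uniq.
  - by rewrite filter_uniq //= lLs UL.
  - by move=> H; rewrite !inE mem_filter inE AL andbC.
rewrite /= pl /=; congr _.+1; rewrite size_filter count_map.
by apply: eq_in_count => H HL /=; apply: trace_sub.
Qed.

Lemma points_on_traces p : (p \in points_on A l) = (p \in traces).
Proof.
rewrite /points_on in_fset inE /= mem_intersection_points; apply/andP/mapP => [[/andP[/eqP dp]]|[H HL ->]].
  move=> + pl; rewrite point_mult_trace // ltnS -has_count has_pred1 => /mapP[H HL ->].
  by exists H.
rewrite capvSl dim_trace // eqxx; split=> //=.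
by rewrite point_mult_trace ?dim_trace ?capvSl // ltnS -has_count has_pred1 map_f.
Qed.

Lemma perm_points : perm_eq (enum_fset (points_on A l)) (undup traces).
Proof.
apply: uniq_perm; [exact: fset_uniq | exact: undup_uniq |].
by move=> p; rewrite mem_undup -points_on_traces.
Qed.

Lemma perm_mults :
  perm_eq (restriction_mults A l) [seq count_mem p traces | p <- undup traces].
Proof.
rewrite /restriction_mults perm_sort.
apply: perm_trans (perm_map _ perm_points) _.
have -> : [seq (point_mult A p - 1)%N | p <- undup traces] =
    [seq count_mem p traces | p <- undup traces]; last exact: perm_refl.
apply/eq_in_map => p; rewrite mem_undup => /mapP[H HL ->].
by rewrite point_mult_trace ?dim_trace ?capvSl // subn1.
Qed.

Lemma sum_mults : sumn (restriction_mults A l) = size traces.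
Proof. by rewrite (perm_sumn perm_mults) sumnE big_map sum_count_undup. Qed.

Lemma size_mults : size (restriction_mults A l) = size (undup traces).
Proof. by rewrite (perm_size perm_mults) size_map. Qed.

Lemma tame_traces :
  [\/ (#|` points_on A l| <= 3)%N,
      forall p, p \in points_on A l -> (point_mult A p <= 3)%N,
      (\sum_(1 <= i < size (restriction_mults A l)) nth 0 (restriction_mults A l) i
        <= nth 0 (restriction_mults A l) 0)%N
    | (\sum_(0 <= i < size (restriction_mults A l)) nth 0 (restriction_mults A l) i)%N%:R
        / (size (restriction_mults A l))%:R < 2 :> rat] ->
  tame traces.
Proof.
case=> [n3|c3|m1|avg].
- by constructor 1; rewrite -(perm_size perm_points).
- constructor 2 => p; have [pK|/count_memPn -> //] := boolP (p \in traces).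
  have := c3 p; rewrite points_on_traces => /(_ pK).
  by case/mapP: pK => H HL ->; rewrite point_mult_trace ?dim_trace ?capvSl.
- have := sum_mults; have := perm_mem perm_mults; have := size_mults.
  case: (restriction_mults A l) m1 => [|x m] /=.
    by move=> _ n0 _ _; constructor 1; rewrite -n0.
  rewrite big_add1 /= => m1 _ mE sE; constructor 3.
  have /mapP[p _ xE] : x \in [seq count_mem p traces | p <- undup traces].
    by rewrite -mE mem_head.
  exists p; rewrite -sE -xE mul2n -addnn leq_add2l sumnE (big_nth 0%N).
  exact: m1.
- have := sum_mults; have := size_mults; move: avg; rewrite -(big_nth 0%N xpredT id) -sumnE.
  move=> + nE sE; rewrite nE sE.
  have [n0|n0] := posnP (size (undup traces)); first by constructor 1; rewrite n0.
  by rewrite ltr_pdivrMr ?ltr0n // -natrM ltr_nat => ?; constructor 4.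
Qed.

End Conditions.

Definition meeting_ordinate (F : fieldType) (h g : F * F) : F := (g.2 - h.2) / (h.1 - g.1).

(** Conclusions on incidence are stated in terms of A, so that two arrangements
    with the lattice of A satisfy the same conditions on the index list Ls. *)
Lemma arrangement_model (F : numFieldType) (A B : line_arrangement F)
    (l : {vspace 'rV[F]_3}) (Ls : seq {vspace 'rV[F]_3}) :
  (forall H, (H \in lines A) = (H == l) || (H \in Ls)) -> l \notin Ls -> uniq Ls ->
  lattice_isomorphic B A ->
  exists (E : 'M[F]_3) (a : {vspace 'rV[F]_3} -> F * F),
    [/\ E \in unitmx, uniq (map a Ls),
        free_arrangement B <-> free_DL E (map a Ls),
        {in Ls &, forall x y, ((a x).1 == (a y).1) = (l :&: x <= y)%VS}
      & {in Ls & &, forall x y z, (a y).1 != (a x).1 -> (a z).1 != (a x).1 ->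
          (meeting_ordinate (a x) (a y) == meeting_ordinate (a x) (a z)) = (x :&: y <= z)%VS}].
Proof.
move=> AL lLs UL /lattice_isomorphic_lines[beta [bB bI bS bC]].
have lA : l \in lines A by rewrite AL eqxx.
have LA H : H \in Ls -> H \in lines A by rewrite AL orbC => ->.
have lLB : beta l \notin map beta Ls.
  apply/mapP => -[H HL /bI lH]; move: lLs.
  by rewrite (lH lA (LA H HL)) HL.
have BL K : (K \in lines B) = (K == beta l) || (K \in map beta Ls).
  apply/idP/orP => [/bS[H + <-]|[/eqP ->|/mapP[H HL ->]]].
  - by rewrite AL => /orP[/eqP ->|HL]; [left | right; rewrite map_f].
  - exact: bB.
  - by apply: bB; apply: LA.
have [||E [par ad]] := adapted_exists (l := beta l) (Ls := map beta Ls) _ _ lLB.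
- exact: lines_dim (bB l lA).
- by move=> H HL; apply: (@lines_dim _ B); rewrite BL HL orbT.
have bL x : x \in Ls -> beta x \in map beta Ls by move=> xL; apply: map_f.
exists E, (par \o beta); split.
- by case: ad.
- rewrite map_inj_in_uniq // => x y xL yL /= xy.
  by apply: bI; rewrite ?LA //; apply: (par_inj ad) xy; apply: bL.
- by rewrite map_comp; apply: free_coordinates ad BL.
- by move=> x y xL yL /=; rewrite -(parallelE ad) ?bL // bC //; exact: LA.
- move=> x y z xL yL zL /= yx zx; rewrite /meeting_ordinate.
  by rewrite -(concurrentE ad) ?bL // bC //; exact: LA.
Qed.

Lemma npoints_pattern (F : fieldType) (T : eqType) (s : seq T) (a b : T -> F * F) x :
  {in x :: s &, forall y z, ((a y).1 == (a z).1) = ((b y).1 == (b z).1)} ->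
  {in s &, forall y z, (a y).1 != (a x).1 -> (a z).1 != (a x).1 ->
     (meeting_ordinate (a x) (a y) == meeting_ordinate (a x) (a z)) =
     (meeting_ordinate (b x) (b y) == meeting_ordinate (b x) (b z))} ->
  npoints (a x) (map a s) = npoints (b x) (map b s).
Proof.
move=> par conc; rewrite /npoints /meeting_points !filter_map -!map_comp.
rewrite (eq_in_filter (a2 := fun y => (b y).1 != (b x).1)); last first.
  by move=> y ys /=; rewrite par ?mem_head // mem_behead.
apply: size_undup_pattern => y z; rewrite !mem_filter => /andP[yx ys] /andP[zx zs].
have par_x u : u \in s -> (a u).1 != (a x).1 = ((b u).1 != (b x).1).
  by move=> us; rewrite par ?mem_head // mem_behead.
by apply: conc => //; rewrite par_x.
Qed.

(** Both arrangements with the lattice of A are modelled over the lines of A other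
    than l, where [top_surjective_pattern] compares them. *)
Lemma terao_numField (F : numFieldType) (A : line_arrangement F) (l : {vspace 'rV[F]_3}) :
  l \in lines A -> tame (traces l [seq H <- enum_fset (lines A) | H != l]) ->
  terao_conjecture_for A.
Proof.
set Ls := [seq H <- _ | _] => lA tm B B' iB iB'.
have AL H : (H \in lines A) = (H == l) || (H \in Ls).
  by rewrite mem_filter; case: eqP => [->|].
have lLs : l \notin Ls by rewrite mem_filter eqxx.
have UL : uniq Ls by rewrite filter_uniq // fset_uniq.
have [E [a [Eu Ua freeB pa ca]]] := arrangement_model AL lLs UL iB.
have [E' [b [Eu' Ub freeB' pb cb]]] := arrangement_model AL lLs UL iB'.
move=> /freeB fB; apply/freeB'.
apply: (surjective_free Eu' Ub); apply: (top_surjective_pattern Ua Ub).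
- move=> x r /suffixP[t LsE].
  have sub y : y \in x :: r -> y \in Ls by rewrite LsE mem_cat orbC => ->.
  apply: npoints_pattern => [y z /sub yL /sub zL|y z yr zr yx zx].
    by rewrite pa // pb.
  have xL := sub x (mem_head _ _).
  have yL := sub y (mem_behead (s := x :: r) yr).
  have zL := sub z (mem_behead (s := x :: r) zr).
  by rewrite ca // cb // ?pb // -?pa.
- by move=> x y xL yL; rewrite pa // pb.
- apply: (tame_pattern _ tm) => x y xL yL /=.
  by rewrite (trace_eq AL) // pa.
- by move=> k u uM; apply: (free_top_surjective Eu Ua fB uM).
Qed.

Local Open Scope complex_scope.

Theorem mainTheorem4 (R : realType) (A : line_arrangement R[i]) :
  [\/ exists2 l, l \in lines A & (#|` points_on A l| <= 3)%N,
      exists2 l, l \in lines A &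
        forall p, p \in points_on A l -> (point_mult A p <= 3)%N,
      exists2 l, l \in lines A &
        let m := restriction_mults A l in
        (\sum_(1 <= i < size m) nth 0 m i <= nth 0 m 0)%N
    | (* for n = 0 the quotient is 0, but then the first condition holds *)
      exists2 l, l \in lines A &
        let m := restriction_mults A l in
        (\sum_(0 <= i < size m) nth 0 m i)%N%:R / (size m)%:R < 2 :> rat] ->
  terao_conjecture_for A.
Proof.
have reduce l : l \in lines A ->
    tame (traces l [seq H <- enum_fset (lines A) | H != l]) -> terao_conjecture_for A.
  exact: terao_numField.
case=> -[l lA cond]; apply: (reduce l lA); apply: (tame_traces (A := A)).
all: try by move=> H; rewrite mem_filter; case: eqP => [->|].
all: try by rewrite mem_filter eqxx.
all: try by rewrite filter_uniq // fset_uniq.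
- by constructor 1.
- by constructor 2.
- by constructor 3.
- by constructor 4.
Qed.
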